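(* Let $\mathcal{T} \in \mathbb{R}^{I_1 \times \cdots \times I_N}$ be a dense tensor and let $\varepsilon, \delta \in (0,1)$. Suppose rank-$R$ CP decomposition of $\mathcal{T}$ is carried out by alternating least squares (ALS), with each least squares problem in ALS solved by a randomized sketching algorithm. Then leverage score sampling guarantees that with $\tilde O(R/(\varepsilon\delta))$ samples per solve, the residual of each sketched least squares problem is within a factor $(1+\varepsilon)$ of the optimal residual with probability $1-\delta$; and, using an efficient data structure for exact leverage score sampling from Khatri-Rao products, the total complexity of ALS with these guarantees can be brought to $$\tilde O\left( \frac{\#\mathrm{it}}{\varepsilon\delta} \cdot \sum_{j=1}^N \left( N R^3 \log I_j + I_j R^2 \right) \right),$$ where $\#\mathrm{it}$ is the number of ALS iterations (rounds), and with any term $\log I_j$ replaced by $\log R$ if $I_j < R$.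
   Context: ALS for CP decomposition: the algorithm maintains factor matrices $U_j \in \mathbb{R}^{I_j \times R}$, $1 \le j \le N$, initialized randomly, with $R$ the rank of the decomposition; the represented tensor has entries $\sum_{r=1}^R \sigma[r]\, U_1[i_1,r] \cdots U_N[i_N,r]$ for a coefficient vector $\sigma \in \mathbb{R}^R$. One iteration (round) performs, for $j = 1,\dots,N$ in sequence, the update $$U_j := \operatorname{argmin}_X \left\| U_{\neq j}\, X^\top - \mathrm{mat}(\mathcal{T}, j)^\top \right\|_F,$$ where all other factors are held fixed, after which $\sigma[i]$ is set to the norm of column $i$ of $U_j$ and the columns of $U_j$ are renormalized to unit norm. Here $U_{\neq j} = U_N \odot \cdots \odot U_{j+1} \odot U_{j-1} \odot \cdots \odot U_1$, where the Khatri-Rao product $\odot$ is the column-wise Kronecker product. The mode-$j$ matricization $\mathrm{mat}(\mathcal{T}, j) \in \mathbb{R}^{I_j \times \prod_{k\ne j} I_k}$ has $\mathcal{T}[i_1,\dots,i_N]$ as its entry in row $i_j$ and column $u = 1 + \sum_{k \neq j} (i_k - 1) \prod_{m < k,\, m \neq j} I_m$. Leverage score sampling for $\min_X \|AX - B\|_F$ with $A \in \mathbb{R}^{I \times R}$ nonzero: the leverage scores are $\ell_i = A[i,:](A^\top A)^+A[i,:]^\top$ ($M^+$ the pseudoinverse), and $q_i = \ell_i/\sum_{i'} \ell_{i'}$. Draw $\hat x_1,\dots,\hat x_J$ i.i.d. from $q$, let $S \in \mathbb{R}^{J \times I}$ have $S[j,i] = 1/\sqrt{J q_i}$ if $\hat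 x_j = i$ and $0$ otherwise, and return $\tilde X = \operatorname{argmin}_X \|SAX - SB\|_F$. The residual guarantee is $\|A\tilde X - B\|_F \le (1+\varepsilon)\min_X\|AX-B\|_F$ with probability at least $1-\delta$, for each individual solve. The sketched problem replaces the exact update of each $U_j$. The design matrices $U_{\neq j}$ encountered are assumed nonzero. Conventions: $\tilde O$ hides multiplicative factors polylogarithmic in $R$ and $1/\delta$. Cost model: exact real arithmetic with unit-cost arithmetic operations (including square roots), unit-cost random access to entries of the dense tensor and of all matrices, unit-cost uniform draws from $[0,1]$, and $O(R^3)$ time for the pseudoinverse and symmetric eigendecomposition of an $R \times R$ symmetric matrix. Logarithmic factors are read as at least a positive constant. The cost of evaluating any convergence criterion is not counted. *)

(* Defs.v *)
From HB Require Import structures.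
From mathcomp Require Export all_boot all_order all_algebra.
From mathcomp Require Export finmap.
From mathcomp Require Export mxtens.
From mathcomp Require Export all_classical all_reals all_analysis.
Export Order.TTheory GRing.Theory Num.Theory.
Export numFieldNormedType.Exports.

Set Implicit Arguments.
Unset Strict Implicit.
Unset Printing Implicit Defensive.

Local Open Scope classical_set_scope.
Local Open Scope ring_scope.

Section LeastSquares.
Variable R : realType.

Definition frob m n (A : 'M[R]_(m, n)) : R :=
  Num.sqrt (\sum_i \sum_j A i j ^+ 2).

Definition is_argmin m k n (A : 'M[R]_(m, k)) (B : 'M[R]_(m, n))
    (X : 'M[R]_(k, n)) : Prop :=
  forall Y : 'M[R]_(k, n), frob (A *m X - B) <= frob (A *m Y - B).

Definition min_residual m k n (A : 'M[R]_(m, k)) (B : 'M[R]_(m, n)) : R :=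
  inf [set frob (A *m Y - B) | Y in [set: 'M[R]_(k, n)]].

(* A deterministic way of selecting one minimizer when the argmin is not
   unique. *)
Definition solver : Type :=
  forall m k n, 'M[R]_(m, k) -> 'M[R]_(m, n) -> 'M[R]_(k, n).

Definition argmin_solver (lsq : solver) : Prop :=
  forall m k n (A : 'M[R]_(m, k)) (B : 'M[R]_(m, n)),
    is_argmin A B (lsq m k n A B).

Definition moore_penrose m n (A : 'M[R]_(m, n)) (X : 'M[R]_(n, m)) : Prop :=
  [/\ A *m X *m A = A, X *m A *m X = X,
      (A *m X)^T = A *m X & (X *m A)^T = X *m A].

(* The Penrose conditions have exactly one solution, so the default 0 is never
   returned. *)
Definition pinv m n (A : 'M[R]_(m, n)) : 'M[R]_(n, m) :=
  xget 0 [set X | moore_penrose A X].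

Definition leverage m k (A : 'M[R]_(m, k)) (i : 'I_m) : R :=
  (row i A *m pinv (A^T *m A) *m (row i A)^T) 0 0.

Definition leverage_prob m k (A : 'M[R]_(m, k)) (i : 'I_m) : R :=
  leverage A i / \sum_i' leverage A i'.

(* Probability that J i.i.d. draws from leverage_prob A are x 0, ..., x (J-1). *)
Definition sample_prob m k (A : 'M[R]_(m, k)) J (x : {ffun 'I_J -> 'I_m}) : R :=
  \prod_(s < J) leverage_prob A (x s).

Definition sample_Pr m k (A : 'M[R]_(m, k)) J
    (E : set {ffun 'I_J -> 'I_m}) : R :=
  \sum_(x : {ffun 'I_J -> 'I_m} | x \in E) sample_prob A x.

Definition sketch m k (A : 'M[R]_(m, k)) J (x : {ffun 'I_J -> 'I_m}) :
    'M[R]_(J, m) :=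
  \matrix_(s, i) if x s == i then 1 / Num.sqrt (J%:R * leverage_prob A i)
                 else 0.

Definition good_sample m k n (A : 'M[R]_(m, k)) (B : 'M[R]_(m, n)) (eps : R) J :
    set {ffun 'I_J -> 'I_m} :=
  [set x | forall X, is_argmin (sketch A x *m A) (sketch A x *m B) X ->
     frob (A *m X - B) <= (1 + eps) * min_residual A B].

End LeastSquares.

Section Tensors.
Variables (R : realType) (N : nat) (I : 'I_N -> nat) (r : nat).

Definition mindex : Type := {dffun forall k : 'I_N, 'I_(I k)}.

Definition tensor : Type := mindex -> R.

Definition factors : Type := forall k : 'I_N, 'M[R]_(I k, r).

Definition khatri_rao m n (A : 'M[R]_(m, r)) (B : 'M[R]_(n, r)) :
    'M[R]_(m * n, r) :=
  \matrix_(u, c) (A (mxtens_unindex u).1 c * B (mxtens_unindex u).2 c).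

Definition kr_rows (s : seq 'I_N) : nat :=
  foldr (fun k m => (I k * m)%N) 1%N s.

(* The empty Khatri-Rao product is the all-ones row. *)
Fixpoint kr_product (U : factors) (s : seq 'I_N) : 'M[R]_(kr_rows s, r) :=
  match s with
  | [::] => const_mx 1
  | k :: s' => khatri_rao (U k) (kr_product U s')
  end.

(* N, ..., j+1, j-1, ..., 1: the last mode is the most significant one in the
   row index. *)
Definition other_modes (j : 'I_N) : seq 'I_N :=
  rev [seq k <- enum 'I_N | k != j].

Definition rows_but (j : 'I_N) : nat := kr_rows (other_modes j).

Definition design (U : factors) (j : 'I_N) : 'M[R]_(rows_but j, r) :=
  kr_product U (other_modes j).

Definition column_index (j : 'I_N) (i : mindex) : nat :=
  (\sum_(k < N | k != j) i k * \prod_(m < N | (m < k) && (m != j)) I m)%N.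

(* For each (a, u) exactly one multi-index i has i j = a and column index u. *)
Definition matricize (T : tensor) (j : 'I_N) : 'M[R]_(I j, rows_but j) :=
  \matrix_(a, u)
    (if [pick i : mindex | (i j == a) && (column_index j i == u)] is Some i
     then T i else 0).

Record cp := CP { fac : factors; coef : 'rV[R]_r }.

Variable J : nat.

(* One least squares solve: its mode and the J sampled rows. *)
Definition solve_sample : Type :=
  {j : 'I_N & {ffun 'I_J -> 'I_(rows_but j)}}.

Definition column_norms m (V : 'M[R]_(m, r)) : 'rV[R]_r :=
  \row_c frob (col c V).

(* A zero column has no unit-norm multiple; as 0 / 0 = 0 it stays zero. *)
Definition normalize_columns m (V : 'M[R]_(m, r)) : 'M[R]_(m, r) :=
  \matrix_(a, c) (V a c / column_norms V 0 c).

Definition als_update (lsq : solver R) (T : tensor) (W : cp)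
    (x : solve_sample) : cp :=
  let j := tag x in
  let A := design (fac W) j in
  let B := (matricize T j)^T in
  let S := sketch A (tagged x) in
  let V := (lsq _ _ _ (S *m A) (S *m B))^T in
  CP (eqtype.dfwith (fac W) (normalize_columns V)) (column_norms V).

Definition als_run (lsq : solver R) (T : tensor) :
    cp -> seq solve_sample -> cp := foldl (als_update lsq T).

Fixpoint als_prob (lsq : solver R) (T : tensor) (W : cp)
    (p : seq solve_sample) : R :=
  match p with
  | [::] => 1
  | x :: p' => sample_prob (design (fac W) (tag x)) (tagged x)
               * als_prob lsq T (als_update lsq T W x) p'
  end.

Fixpoint nonzero_designs (lsq : solver R) (T : tensor) (W : cp)
    (p : seq solve_sample) : Prop :=
  match p with
  | [::] => True
  | x :: p' => design (fac W) (tag x) != 0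
               /\ nonzero_designs lsq T (als_update lsq T W x) p'
  end.

Definition als_path (it : nat) (p : seq solve_sample) : Prop :=
  map (@tag _ _) p = flatten (nseq it (enum 'I_N)).

End Tensors.

(* Programs of a real random-access machine with an integer part and a real
   part.  A program is a fixed text that knows nothing about its input.  Memory
   consists of arrays, named by numbers and addressed by index lists whose length
   is fixed in the text; scalars are arrays addressed by the empty list.  There
   is no conversion from reals to integers and no integer division, so reals
   influence control flow only through comparisons. *)
Inductive nexp : Type :=
  | NConst of nat
  | NGet of nat & seq nexp
  | NAdd of nexp & nexp
  | NSub of nexp & nexp
  | NMul of nexp & nexp.

Inductive rexp : Type :=
  | RNat of nexp
  | RGet of nat & seq nexp
  | RAdd of rexp & rexp
  | RSub of rexp & rexp
  | RMul of rexp & rexp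
  | RDiv of rexp & rexp
  | RSqrt of rexp.

Inductive bexp : Type :=
  | NLe of nexp & nexp
  | RLe of rexp & rexp
  | BNot of bexp
  | BAnd of bexp & bexp.

Inductive cmd : Type :=
  | Skip
  | NSet of nat & seq nexp & nexp
  | RSet of nat & seq nexp & rexp
  | Draw of nat & seq nexp
  | Pinv of nat & nat & nexp
  | Eig of nat & nat & nat & nexp
  | Seq of cmd & cmd
  | If of bexp & cmd & cmd
  | For of nat & nexp & cmd.

Fixpoint ncost (e : nexp) : nat :=
  match e with
  | NConst _ => 1
  | NGet _ ix => (1 + sumn (map ncost ix))%N
  | NAdd e1 e2 | NSub e1 e2 | NMul e1 e2 => (1 + ncost e1 + ncost e2)%N
  end.

Definition ixcost (ix : seq nexp) : nat := sumn (map ncost ix).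

Fixpoint rcost (e : rexp) : nat :=
  match e with
  | RNat e1 => (1 + ncost e1)%N
  | RGet _ ix => (1 + ixcost ix)%N
  | RAdd e1 e2 | RSub e1 e2 | RMul e1 e2 | RDiv e1 e2 =>
      (1 + rcost e1 + rcost e2)%N
  | RSqrt e1 => (1 + rcost e1)%N
  end.

Fixpoint bcost (b : bexp) : nat :=
  match b with
  | NLe e1 e2 => (1 + ncost e1 + ncost e2)%N
  | RLe e1 e2 => (1 + rcost e1 + rcost e2)%N
  | BNot b1 => (1 + bcost b1)%N
  | BAnd b1 b2 => (1 + bcost b1 + bcost b2)%N
  end.

Section Semantics.
Variable R : realType.

(* draws is the number of random draws made so far, clock the time spent. *)
Record state := State {
  nmem : nat -> seq nat -> nat;
  rmem : nat -> seq nat -> R;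
  draws : nat;
  clock : nat }.

Definition tick (c : nat) (s : state) : state :=
  State (nmem s) (rmem s) (draws s) (clock s + c).

Definition set_nat (a : nat) (ix : seq nat) (v : nat) (s : state) : state :=
  State (fun b iy => if (b == a) && (iy == ix) then v else nmem s b iy)
        (rmem s) (draws s) (clock s).

Definition set_real (a : nat) (ix : seq nat) (v : R) (s : state) : state :=
  State (nmem s)
        (fun b iy => if (b == a) && (iy == ix) then v else rmem s b iy)
        (draws s) (clock s).

Definition get_mx (a m n : nat) (s : state) : 'M[R]_(m, n) :=
  \matrix_(i, j) rmem s a [:: val i; val j].

Definition set_mx (a m n : nat) (M : 'M[R]_(m, n)) (s : state) : state :=
  State (nmem s)
        (fun b iy =>
           match iy with
           | [:: i; j] =>
               match insub i : option 'I_m, insub j : option 'I_n with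
               | Some i', Some j' => if b == a then M i' j' else rmem s b iy
               | _, _ => rmem s b iy
               end
           | _ => rmem s b iy
           end)
        (draws s) (clock s).

Fixpoint neval (s : state) (e : nexp) : nat :=
  match e with
  | NConst n => n
  | NGet a ix => nmem s a (map (neval s) ix)
  | NAdd e1 e2 => (neval s e1 + neval s e2)%N
  | NSub e1 e2 => (neval s e1 - neval s e2)%N
  | NMul e1 e2 => (neval s e1 * neval s e2)%N
  end.

Fixpoint reval (s : state) (e : rexp) : R :=
  match e with
  | RNat e1 => (neval s e1)%:R
  | RGet a ix => rmem s a (map (neval s) ix)
  | RAdd e1 e2 => reval s e1 + reval s e2
  | RSub e1 e2 => reval s e1 - reval s e2
  | RMul e1 e2 => reval s e1 * reval s e2
  | RDiv e1 e2 => reval s e1 / reval s e2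
  | RSqrt e1 => Num.sqrt (reval s e1)
  end.

Fixpoint beval (s : state) (b : bexp) : bool :=
  match b with
  | NLe e1 e2 => (neval s e1 <= neval s e2)%N
  | RLe e1 e2 => reval s e1 <= reval s e2
  | BNot b1 => ~~ beval s b1
  | BAnd b1 b2 => beval s b1 && beval s b2
  end.

(* The symmetric eigendecomposition is not unique; the machine may use any
   routine meeting eig_correct. *)
Definition eig_routine : Type := forall n, 'M[R]_n -> 'M[R]_n * 'rV[R]_n.

Definition eig_correct (eig : eig_routine) : Prop :=
  forall n (M : 'M[R]_n), M^T = M ->
    (eig n M).1^T *m (eig n M).1 = 1%:M
    /\ M = (eig n M).1 *m diag_mx (eig n M).2 *m (eig n M).1^T.

(* us is the stream of random draws.  The bound of For x e c is evaluated once,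
   then c runs with x = 0, 1, ..., e - 1.  Pinv is not restricted to symmetric
   matrices: M^+ = (M^T M)^+ M^T, so this changes costs by a constant factor
   only. *)
Fixpoint run (eig : eig_routine) (us : nat -> R) (c : cmd) (s : state) :
    state :=
  match c with
  | Skip => tick 1 s
  | NSet a ix e =>
      set_nat a (map (neval s) ix) (neval s e)
        (tick (1 + ixcost ix + ncost e) s)
  | RSet a ix e =>
      set_real a (map (neval s) ix) (reval s e)
        (tick (1 + ixcost ix + rcost e) s)
  | Draw a ix =>
      let s' := set_real a (map (neval s) ix) (us (draws s))
                  (tick (1 + ixcost ix) s) in
      State (nmem s') (rmem s') (draws s').+1 (clock s')
  | Pinv dst src e =>
      let n := neval s e in
      set_mx dst (pinv (get_mx src n n s)) (tick (1 + ncost e + n ^ 3) s)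
  | Eig vecs vals src e =>
      let n := neval s e in
      let VL := eig n (get_mx src n n s) in
      set_mx vals VL.2 (set_mx vecs VL.1 (tick (1 + ncost e + n ^ 3) s))
  | Seq c1 c2 => run eig us c2 (run eig us c1 s)
  | If b c1 c2 =>
      let s' := tick (1 + bcost b) s in
      if beval s b then run eig us c1 s' else run eig us c2 s'
  | For x e c1 =>
      foldl (fun s' k => run eig us c1 (tick 1 (set_nat x [::] k s')))
            (tick (1 + ncost e) s) (iota 0 (neval s e))
  end.

(* Input/output conventions.  Integer cells: 0 holds N, 1 the CP rank, 2 the
   number of samples per solve, 3 the number of rounds, 4 the dimensions.  Real
   arrays: 0 holds the tensor in the linear order with the first mode running
   fastest, 1 the factor matrices, 2 the coefficient vector.  The content of all
   other cells is arbitrary. *)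
Definition linear_index N (I : 'I_N -> nat) (i : mindex I) : nat :=
  (\sum_(k < N) i k * \prod_(m < N | m < k) I m)%N.

Definition stores_factors N (I : 'I_N -> nat) r (U : factors R I r)
    (s : state) : Prop :=
  forall (k : 'I_N) (a : 'I_(I k)) (c : 'I_r),
    rmem s 1 [:: val k; val a; val c] = U k a c.

(* The clock starts at one unit per entry of the initial factor matrices, the
   cost of the random initialization. *)
Definition als_input N (I : 'I_N -> nat) r (T : tensor R I)
    (U : factors R I r) (J it : nat) (s : state) : Prop :=
  [/\ [/\ nmem s 0 [::] = N, nmem s 1 [::] = r, nmem s 2 [::] = J
        & nmem s 3 [::] = it],
      forall k : 'I_N, nmem s 4 [:: val k] = I k,
      forall i : mindex I, rmem s 0 [:: linear_index i] = T i,
      stores_factors U s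
    & draws s = 0%N /\ clock s = (\sum_(k < N) I k * r)%N].

Definition als_output N (I : 'I_N -> nat) r (W : cp R I r) (s : state) : Prop :=
  stores_factors (fac W) s
  /\ forall c : 'I_r, rmem s 2 [:: val c] = coef W 0 c.

End Semantics.

Definition iid_uniform (R : realType) (d : measure_display)
    (Omega : measurableType d) (P : probability Omega R)
    (u : nat -> {RV P >-> R}) : Prop :=
  (forall k (B : set R), measurable B ->
     distribution P (u k) B = uniform_prob (@ltr01 R) B)
  /\ (forall (F : {fset nat}) (B : nat -> set R),
        (forall k, measurable (B k)) ->
        P (\bigcap_(k in [set` F]) (u k @^-1` B k))
        = (\prod_(k <- F) P (u k @^-1` B k))%E).

Definition log1 (R : realType) (x : R) : R := Num.max 1 (ln x).

Definition polylog (R : realType) (p r : nat) (delta : R) : R :=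
  (log1 r%:R * log1 delta^-1) ^+ p.

(* Main.v *)
Require Import Defs.
From mathcomp Require Import ring lra zify.

Set Implicit Arguments.
Unset Strict Implicit.
Unset Printing Implicit Defensive.

Local Open Scope classical_set_scope.
Local Open Scope ring_scope.

(* Write q for the leverage distribution of A, Q for an orthonormal basis of the
   column space of A, and y_i for row i of Q divided by sqrt (q i).  Then
   E[y y^T] = 1 and |y|^2 <= rank A <= r.  While D >= l 1 with l >= 2 p r, adding
   one random y y^T to D decreases tr D^-p in mean at least as much as adding 1/2
   to D; Markov's inequality for tr D^-p with p ~ log (r / delta) then bounds all
   eigenvalues of the sampled Gram matrix below by J/8, except with probability
   delta/2.  The sampled cross term Q^T B' with the residual B' has mean 0 and
   variance at most J r |B'|^2, so Chebyshev's inequality bounds its effect on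
   the sketched solution except with probability delta/2, once J >= 128 r / (eps delta).

   For the running time, let G be the pseudoinverse of the Gram matrix of the
   Khatri-Rao product, which is the Hadamard product of the Gram matrices of the
   factors.  The leverage score of a row with mode indices (i_k) is the quadratic
   form of G at the Hadamard product h of the factor rows, and its sum over all
   rows with prescribed leading indices factors through the Gram matrices of
   prefixes of the remaining factors.  Hence, given prefix Gram matrices, one
   uniform draw tau is turned into a row by inverting the cumulative distribution
   one mode at a time, each by a binary search with O(log I_k) evaluations of an
   r x r quadratic form.  The event that the run samples a given path is that
   every draw lies in a prescribed interval, whose length is the sampling
   probability. *)

(** * Pseudoinverses and least squares *)

(** The potential [tr D^-p] takes the place of the exponential moments of a matrix Chernoff bound
    because it can be handled by algebra alone: Sherman-Morrison, Cauchy-Schwarz and traces of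
    products, with no diagonalization. The obstacle is that [D] and [y y^T] do not commute, so
    powers cannot be compared factor by factor. Instead factors [D^-1] are traded one at a time for
    [(D + y y^T)^-1], and each correction is a product of two nonnegative forms. The ballast [J/8]
    added before the first draw keeps [D] at the level [l] where one step is under control; this is
    what asks for [16 p r] samples. The dependence on [1/eps] is linear because, by Pythagoras, an
    error of squared size [eps] times the optimum is added to the squared residual.

    The time bound has to hold for every stream of draws, so it is read off the loop bounds, which
    depend on integer memory only; the binary search therefore makes a fixed number of passes. In
    the law of the run no conditioning occurs: once a path is fixed, the designs of the later
    solves, and hence their intervals, are fixed as well. *)

Section MatrixPreliminaries.
Variable R : realType.

(** The squared Frobenius norm, as a trace so that expansion, orthogonality and cyclic rearrangement
    become matrix identities. *)
Definition sqn m n (A : 'M[R]_(m, n)) : R := \tr (A^T *m A).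

Lemma sqnE m n (A : 'M[R]_(m, n)) : sqn A = \sum_i \sum_j A i j ^+ 2.
Proof.
rewrite /sqn /mxtrace exchange_big; apply: eq_bigr => j _; rewrite mxE.
by apply: eq_bigr => i _; rewrite mxE expr2.
Qed.

Lemma sqn_ge0 m n (A : 'M[R]_(m, n)) : 0 <= sqn A.
Proof. by rewrite sqnE; do 2!apply: sumr_ge0 => ? _; rewrite sqr_ge0. Qed.

Lemma sqn_eq0 m n (A : 'M[R]_(m, n)) : (sqn A == 0) = (A == 0).
Proof.
apply/idP/idP => [|/eqP->]; last by rewrite /sqn mulmx0 mxtrace0.
rewrite sqnE psumr_eq0; last by move=> i _; apply: sumr_ge0 => ? _; rewrite sqr_ge0.
move/allP => h; apply/eqP/matrixP => i j; rewrite mxE; apply/eqP.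
have := h i (mem_index_enum _).
rewrite psumr_eq0 => [|? _]; last by rewrite sqr_ge0.
by move/allP/(_ j (mem_index_enum _)); rewrite sqrf_eq0.
Qed.

Lemma frobE m n (A : 'M[R]_(m, n)) : frob A = Num.sqrt (sqn A).
Proof. by rewrite /frob sqnE. Qed.

Lemma ler_frob m n p q (A : 'M[R]_(m, n)) (B : 'M[R]_(p, q)) :
  (frob A <= frob B) = (sqn A <= sqn B).
Proof. by rewrite !frobE ler_sqrt // sqn_ge0. Qed.

Lemma mxtrace_dotC m n (A B : 'M[R]_(m, n)) : \tr (A^T *m B) = \tr (B^T *m A).
Proof. by rewrite -mxtrace_tr trmx_mul trmxK. Qed.

Lemma sqnD m n (A B : 'M[R]_(m, n)) :
  sqn (A + B) = sqn A + 2 * \tr (A^T *m B) + sqn B.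
Proof.
rewrite /sqn [(A + B)^T]linearD /= mulmxDl !mulmxDr !mxtraceD (mxtrace_dotC B A).
by ring.
Qed.

Lemma sqnZ m n c (A : 'M[R]_(m, n)) : sqn (c *: A) = c ^+ 2 * sqn A.
Proof.
by rewrite /sqn [(c *: A)^T]linearZ /= -scalemxAl -scalemxAr !mxtraceZ mulrA.
Qed.

Lemma trmx_symm_unit n (M : 'M[R]_n) : M^T = M -> (invmx M)^T = invmx M.
Proof. by move=> h; rewrite trmx_inv h. Qed.

Lemma unitmx_ker0 n (M : 'M[R]_n) :
  (forall v : 'cV_n, M *m v = 0 -> v = 0) -> M \in unitmx.
Proof.
move=> h; rewrite -unitmx_tr -row_free_unit -kermx_eq0.
apply/eqP/row_matrixP => i; rewrite row0.
apply: trmx_inj; rewrite trmx0; apply: h.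
by apply: trmx_inj; rewrite trmx_mul trmxK -row_mul mulmx_ker row0 trmx0.
Qed.

(** Gram-Schmidt over the columns, with the number [k] of basis vectors left existential since
    dependent columns contribute none. The two factorizations together give [X *m Y = 1%:M], which
    is how rank enters later. *)
Lemma orthonormal_column_basis m n (A : 'M[R]_(m, n)) :
  exists k (Q : 'M[R]_(m, k)) X Y, [/\ Q^T *m Q = 1%:M, A = Q *m X & Q = A *m Y].
Proof.
elim: n A => [|n IHn] A.
  exists 0%N, 0, 0, 0; split; first by rewrite [RHS]flatmx0 [LHS]flatmx0.
    by rewrite [LHS]thinmx0 [RHS]thinmx0.
  by rewrite mulmx0.
move: A; rewrite -[n.+1]/(1 + n)%N => A.
rewrite -[A]hsubmxK; set v := lsubmx _; set A' := rsubmx _.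
have [k [Q [X [Y [QQ AE QE]]]]] := IHn A'.
(* What remains of the first column after projection onto the span of the others; if it vanishes,
   the basis is kept as it is. *)
pose w := v - Q *m (Q^T *m v).
have Qw : Q^T *m w = 0 by rewrite mulmxBr (mulmxA _ Q) QQ mul1mx subrr.
have [w0|w0] := eqVneq w 0.
  exists k, Q, (row_mx (Q^T *m v) X), (col_mx 0 Y); split => //.
    by rewrite mul_mx_row -AE -[v in LHS](subrK (Q *m (Q^T *m v))) -/w w0 add0r.
  by rewrite mul_row_col mulmx0 add0r.
pose a := Num.sqrt (sqn w).
have a0 : a != 0.
  by rewrite sqrtr_eq0 -ltNge lt_neqAle sqn_ge0 eq_sym sqn_eq0 w0.
have aw : w^T *m w = (a ^+ 2)%:M.
  by rewrite sqr_sqrtr ?sqn_ge0 // /sqn trace_mx11; apply: mx11_scalar.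
have wQ : w^T *m Q = 0 by apply: trmx_inj; rewrite trmx_mul trmxK Qw trmx0.
have vE : v = w + Q *m (Q^T *m v) by rewrite subrK.
exists (1 + k)%N, (row_mx (a^-1 *: w) Q),
  (block_mx a%:M 0 (Q^T *m v) X),
  (block_mx (a^-1)%:M 0 (- a^-1 *: (Y *m (Q^T *m v))) Y); split.
- rewrite tr_row_mx mul_col_row [(_ *: w)^T]linearZ /= -!scalemxAl -!scalemxAr aw wQ Qw QQ.
  rewrite !scaler0 scalerA [RHS]scalar_mx_block.
  congr block_mx; apply/matrixP => i j; rewrite !mxE.
  by rewrite !ord1 eqxx !mulr1n -expr2 exprVn mulVf // expf_neq0.
- rewrite mul_row_block mul_mx_scalar scalerA divff // scale1r mulmx0 add0r -AE.
  by rewrite -vE.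
- rewrite mul_row_block mulmx0 add0r -QE mul_mx_scalar.
  by rewrite -scalemxAr (mulmxA A' Y) -QE -[w](addrK (Q *m (Q^T *m v))) -vE scalerBr scaleNr.
Qed.

Lemma moore_penrose_uniq m n (A : 'M[R]_(m, n)) (X Y : 'M[R]_(n, m)) :
  moore_penrose A X -> moore_penrose A Y -> X = Y.
Proof.
move=> [x1 x2 x3 x4] [y1 y2 y3 y4].
have AXY : A *m X = A *m Y.
  by rewrite -x3 -{1}y1 -mulmxA trmx_mul x3 y3 mulmxA x1.
have XYA : X *m A = Y *m A.
  by rewrite -x4 -{1}y1 !mulmxA -mulmxA trmx_mul x4 y4 -mulmxA (mulmxA A X) x1.
by rewrite -x2 -mulmxA AXY mulmxA XYA y2.
Qed.

(** The witness comes from the full-rank factorization [A = Q X]: since [Q] is orthonormal and [X]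
    has the right inverse [Y], the matrix [X X^T] is invertible and [X^T (X X^T)^-1 Q^T] is the
    pseudoinverse. *)
Lemma pinvP m n (A : 'M[R]_(m, n)) : moore_penrose A (pinv A).
Proof.
rewrite /pinv; apply: (@xgetPex _ 0 [set X | moore_penrose A X]).
have [k [Q [X [Y [QQ AE QE]]]]] := orthonormal_column_basis A.
have XY : X *m Y = 1%:M.
  by rewrite -[LHS]mul1mx -QQ -mulmxA (mulmxA Q) -AE -QE.
have XXu : X *m X^T \in unitmx.
  apply: unitmx_ker0 => v; rewrite -mulmxA => /(congr1 (mulmx v^T)).
  rewrite mulmx0 mulmxA -{1}[X]trmxK -trmx_mul => h.
  have : sqn (X^T *m v) == 0 by rewrite /sqn h mxtrace0.
  rewrite sqn_eq0 => /eqP /(congr1 (mulmx Y^T)).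
  by rewrite mulmx0 mulmxA -trmx_mul XY trmx1 mul1mx.
exists (X^T *m invmx (X *m X^T) *m Q^T).
have AP : A *m (X^T *m invmx (X *m X^T) *m Q^T) = Q *m Q^T.
  by rewrite AE !mulmxA -(mulmxA Q) mulmxK.
have PA : X^T *m invmx (X *m X^T) *m Q^T *m A = X^T *m invmx (X *m X^T) *m X.
  by rewrite AE -!mulmxA (mulmxA Q^T) QQ mul1mx.
split; rewrite ?AP ?PA.
- by rewrite AE -!mulmxA (mulmxA Q^T) QQ mul1mx.
- by rewrite -!mulmxA (mulmxA X) (mulmxA _ _ Q^T) mulmxV // mul1mx.
- by rewrite trmx_mul trmxK.
- rewrite !trmx_mul trmxK mulmxA trmx_symm_unit //.
  by rewrite trmx_mul trmxK.
Qed.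

Lemma pinv_sym n (A : 'M[R]_n) : A^T = A -> (pinv A)^T = pinv A.
Proof.
move=> sA; have [p1 p2 p3 p4] := pinvP A.
apply: (@moore_penrose_uniq _ _ A); last exact: pinvP.
split.
- by apply: trmx_inj; rewrite !trmx_mul trmxK sA mulmxA p1.
- by apply: trmx_inj; rewrite !trmx_mul !trmxK sA mulmxA p2.
- by rewrite trmx_mul trmxK sA -[LHS]p4 trmx_mul sA.
- by rewrite trmx_mul trmxK sA -[LHS]p3 trmx_mul sA.
Qed.

Lemma trmx_gram m n (A : 'M[R]_(m, n)) : (A^T *m A)^T = A^T *m A.
Proof. by rewrite trmx_mul trmxK. Qed.

(** Only the first Penrose condition enters: with Gram matrix [X^T X], multiplying it by [Y^T] on
    the left and [Y] on the right leaves [X Z X^T = 1]. It turns leverage scores into squared row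
    norms of [Q]. *)
Lemma pinv_gram_projector m n k (A : 'M[R]_(m, n)) (Q : 'M[R]_(m, k)) X Y :
  Q^T *m Q = 1%:M -> A = Q *m X -> Q = A *m Y ->
  A *m pinv (A^T *m A) *m A^T = Q *m Q^T.
Proof.
move=> QQ AE QE.
have XY : X *m Y = 1%:M.
  by rewrite -[LHS]mul1mx -QQ -mulmxA (mulmxA Q) -AE -QE.
have GE : A^T *m A = X^T *m X.
  by rewrite AE trmx_mul -mulmxA (mulmxA Q^T) QQ mul1mx.
have [p1 _ _ _] := pinvP (A^T *m A); set Z := pinv _ in p1 *.
have YX : Y^T *m X^T = 1%:M by rewrite -trmx_mul XY trmx1.
have XZ : X *m Z *m X^T = 1%:M.
  have := congr1 (fun M => Y^T *m M *m Y) p1; rewrite !GE !mulmxA YX !mul1mx.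
  by rewrite -!mulmxA XY mulmx1 !mulmxA.
by rewrite {1 2}AE trmx_mul !mulmxA -(mulmxA Q X) -(mulmxA Q) XZ mulmx1.
Qed.

Lemma gram_pinv_absorb m n (A : 'M[R]_(m, n)) :
  A^T *m (A *m pinv (A^T *m A) *m A^T) = A^T.
Proof.
have [k [Q [X [Y [QQ AE QE]]]]] := orthonormal_column_basis A.
rewrite (pinv_gram_projector QQ AE QE) {1}AE trmx_mul -mulmxA (mulmxA Q^T) QQ.
by rewrite mul1mx -trmx_mul -AE.
Qed.

Definition pinv_solver m k n (A : 'M[R]_(m, k)) (B : 'M[R]_(m, n)) :
  'M[R]_(k, n) := pinv (A^T *m A) *m A^T *m B.

(** Pythagoras: the normal equation makes the residual orthogonal to the range of [A]. *)
Lemma sqn_normal_eq m k n (A : 'M[R]_(m, k)) (B : 'M[R]_(m, n)) X Y :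
  A^T *m (A *m X - B) = 0 ->
  sqn (A *m Y - B) = sqn (A *m X - B) + sqn (A *m (Y - X)).
Proof.
move=> h; have -> : A *m Y - B = (A *m X - B) + A *m (Y - X).
  by rewrite mulmxBr [_ + (_ - _)]addrC addrA subrK.
by rewrite sqnD mxtrace_dotC trmx_mul -mulmxA h mulmx0 mxtrace0 mulr0 addr0.
Qed.

Lemma pinv_solver_normal_eq m k n (A : 'M[R]_(m, k)) (B : 'M[R]_(m, n)) :
  A^T *m (A *m pinv_solver A B - B) = 0.
Proof.
rewrite mulmxBr /pinv_solver (mulmxA A) (mulmxA A) (mulmxA A^T).
by rewrite gram_pinv_absorb subrr.
Qed.

Lemma pinv_solver_argmin : argmin_solver pinv_solver.
Proof.
move=> m k n A B Y; rewrite ler_frob.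
by rewrite (sqn_normal_eq Y (pinv_solver_normal_eq A B)) lerDl sqn_ge0.
Qed.

(** Comparison with the explicit solution through Pythagoras forces both fits [A X] to coincide.
    [good_sample] quantifies over all minimizers of the sketched problem, so each of them must be
    covered. *)
Lemma argmin_normal_eq m k n (A : 'M[R]_(m, k)) (B : 'M[R]_(m, n)) X :
  is_argmin A B X -> A^T *m (A *m X - B) = 0.
Proof.
move=> h; have n0 := pinv_solver_normal_eq A B; set X0 := pinv_solver A B in n0.
have := h X0; rewrite ler_frob (sqn_normal_eq X n0) gerDl => h1.
have /eqP : sqn (A *m (X - X0)) == 0 by rewrite eq_le h1 sqn_ge0.
by move/eqP; rewrite sqn_eq0 mulmxBr subr_eq0 => /eqP ->.
Qed.

Lemma min_residualE m k n (A : 'M[R]_(m, k)) (B : 'M[R]_(m, n)) :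
  min_residual A B = frob (A *m pinv_solver A B - B).
Proof.
apply/eqP; rewrite eq_le; apply/andP; split.
  apply: ge_inf; last by exists (pinv_solver A B).
  by exists 0 => _ [Y _ <-]; rewrite sqrtr_ge0.
apply: lb_le_inf; first by exists (frob (A *m pinv_solver A B - B)), (pinv_solver A B).
by move=> _ [Y _ <-]; apply: pinv_solver_argmin.
Qed.

End MatrixPreliminaries.

(** * Potentials of rank-one updates *)

Section LogConvexSequences.
Variables (R : realType) (a : nat -> R).
Hypothesis a_gt0 : forall i, 0 < a i.
Hypothesis a_lc : forall i, a i.+1 ^+ 2 <= a i * a i.+2.

(** Monotonicity of the ratios of consecutive terms, cleared of denominators. *)
Lemma logconvex_ratio i k : a i.+1 * a (i + k)%N <= a i * a (i + k).+1.
Proof.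
elim: k => [|k IHk]; first by rewrite addn0 mulrC.
rewrite addnS -(ler_pM2l (a_gt0 (i + k))) mulrCA mulrA [X in X * _]mulrC.
have := a_lc (i + k); rewrite expr2 => lc.
apply: (@le_trans _ _ (a i * a (i + k).+1 * a (i + k).+1)).
  by rewrite ler_pM2r // mulrC.
by rewrite -mulrA [X in _ <= X]mulrCA ler_pM2l.
Qed.

(** Chebyshev's correlation inequality for moments: by monotone ratios, moving one index unit from
    the smaller to the larger factor does not decrease the product. *)
Lemma logconvex_chebyshev j k : a j.+1 * a k.+1 <= a 1%N * a (j + k).+1.
Proof.
elim: j => [|j IHj] //; rewrite -(ler_pM2l (a_gt0 j.+1)).
apply: (@le_trans _ _ (a j.+2 * (a 1%N * a (j + k).+1))).
  by rewrite mulrCA ler_pM2l.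
have := logconvex_ratio j.+1 k; rewrite addSn => h.
by rewrite mulrCA [X in _ <= X]mulrCA ler_pM2l.
Qed.

Lemma logconvex_jensen p : a 1%N ^+ p.+1 <= a 0%N ^+ p * a p.+1.
Proof.
elim: p => [|p IHp]; first by rewrite expr1 expr0 mul1r.
rewrite exprS; apply: (@le_trans _ _ (a 1%N * (a 0%N ^+ p * a p.+1))).
  by rewrite ler_pM2l.
have := logconvex_ratio 0 p.+1; rewrite add0n => h.
rewrite mulrCA [in X in _ <= X]exprS -mulrA [X in _ <= X]mulrCA ler_pM2l //.
by rewrite exprn_gt0.
Qed.

End LogConvexSequences.

(** * Quadratic forms and the semidefinite order *)

Section QuadraticForms.
Variable R : realType.

Definition bl n k (M : 'M[R]_n) (X Z : 'M[R]_(n, k)) : R := \tr (X^T *m M *m Z).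

Lemma bl_mul n k (A P B : 'M[R]_n) (X Z : 'M[R]_(n, k)) :
  bl P (A *m X) (B *m Z) = bl (A^T *m P *m B) X Z.
Proof. by rewrite /bl trmx_mul !mulmxA. Qed.

Lemma bl_outer n (A B : 'M[R]_n) (u v x z : 'cV[R]_n) :
  bl (A *m u *m (v^T *m B)) x z = bl A x u * bl B v z.
Proof.
rewrite /bl !mulmxA -(mulmxA (x^T *m A *m u)) -(mulmxA (x^T *m A *m u)).
rewrite [x^T *m A *m u]mx11_scalar mul_scalar_mx mxtraceZ -trace_mx11.
by rewrite mxtrace_scalar mulr1n.
Qed.

Definition qf n k (M : 'M[R]_n) (X : 'M[R]_(n, k)) : R := \tr (X^T *m M *m X).

Definition psd n (M : 'M[R]_n) : Prop :=
  M^T = M /\ forall k (X : 'M[R]_(n, k)), 0 <= qf M X.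

(** The Loewner bound [l 1 <= M]; positivity of [l] is always a separate hypothesis. *)
Definition pd n (l : R) (M : 'M[R]_n) : Prop :=
  M^T = M /\ forall k (X : 'M[R]_(n, k)), l * sqn X <= qf M X.

Lemma qfM n k (P M : 'M[R]_n) (X : 'M[R]_(n, k)) :
  M^T = M -> qf P (M *m X) = qf (M * P * M) X.
Proof.
by move=> sM; rewrite /qf trmx_mul sM -!mulmxE !mulmxA.
Qed.

Lemma qf1 n k (X : 'M[R]_(n, k)) : qf 1%:M X = sqn X.
Proof. by rewrite /qf mulmx1. Qed.

Lemma qfD n k (P M : 'M[R]_n) (X : 'M[R]_(n, k)) : qf (P + M) X = qf P X + qf M X.
Proof. by rewrite /qf mulmxDr mulmxDl mxtraceD. Qed.

Lemma qfZ n k c (M : 'M[R]_n) (X : 'M[R]_(n, k)) : qf (c *: M) X = c * qf M X.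
Proof. by rewrite /qf -scalemxAr -scalemxAl mxtraceZ. Qed.

Lemma psd_cauchy n k (P : 'M[R]_n) (X Z : 'M[R]_(n, k)) : psd P ->
  (\tr (X^T *m P *m Z)) ^+ 2 <= qf P X * qf P Z.
Proof.
move=> [sP psdP]; set t := \tr _.
have tC : \tr (Z^T *m P *m X) = t.
  by rewrite /t -mxtrace_tr !trmx_mul trmxK sP mulmxA.
have h c e : 0 <= c ^+ 2 * qf P X + 2 * c * e * t + e ^+ 2 * qf P Z.
  have := psdP _ (c *: X + e *: Z); rewrite {1}/qf.
  rewrite [(c *: X + _)^T]linearD /= [(c *: X)^T]linearZ [(e *: Z)^T]linearZ /=.
  rewrite !mulmxDl !mulmxDr -!scalemxAl -!scalemxAr !mxtraceD !mxtraceZ tC.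
  rewrite -/(qf P X) -/(qf P Z) -/t => h; rewrite (le_trans h) // le_eqVlt.
  by apply/orP; left; apply/eqP; ring.
have x0 := psdP _ X; have z0 := psdP _ Z.
have [zz|zn0] := eqVneq (qf P Z) 0; rewrite ?zz.
  rewrite mulr0; have [->|t0] := eqVneq t 0; first by rewrite expr0n.
  have t2 : 0 < t ^+ 2 by rewrite lt_def sqrf_eq0 t0 sqr_ge0.
  (* If [t] were nonzero while [Z] is null for the form, this multiple of [Z] would bring the form
     down to [-1]. *)
  have := h 1 (- ((qf P X + 1) / (2 * t ^+ 2)) * t); rewrite zz mulr0 addr0.
  have -> : 1 ^+ 2 * qf P X + 2 * 1 * (- ((qf P X + 1) / (2 * t ^+ 2)) * t) * t =
            - 1 by field.
  by rewrite lerNr oppr0 ler10.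
have zp : 0 < qf P Z by rewrite lt_def zn0.
(* The component of [X] orthogonal to [Z] for the form, scaled by [qf P Z] to avoid a division. *)
have := h (qf P Z) (- t).
have -> : qf P Z ^+ 2 * qf P X + 2 * qf P Z * - t * t + (- t) ^+ 2 * qf P Z =
          qf P Z * (qf P X * qf P Z - t ^+ 2) by ring.
by rewrite pmulr_rge0 // subr_ge0.
Qed.

Lemma psd1 n : psd (1%:M : 'M[R]_n).
Proof. by split=> [|k X]; rewrite ?trmx1 // qf1 sqn_ge0. Qed.

Lemma sqn_col m n (B : 'M[R]_(m, n)) j : sqn (col j B) = \sum_i B i j ^+ 2.
Proof. by rewrite sqnE; apply: eq_bigr => i _; rewrite big_ord1 mxE. Qed.

Lemma sqn_mul m n p (A : 'M[R]_(m, n)) (B : 'M[R]_(n, p)) :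
  sqn (A *m B) <= sqn A * sqn B.
Proof.
rewrite sqnE; apply: (@le_trans _ _
  (\sum_i \sum_j sqn (row i A)^T * sqn (col j B))).
  apply: ler_sum => i _; apply: ler_sum => j _.
  have := psd_cauchy (row i A)^T (col j B) (psd1 n); rewrite !qf1 mulmx1 trmxK.
  suff -> : (A *m B) i j = \tr (row i A *m col j B) by [].
  by rewrite trace_mx11 !mxE; apply: eq_bigr => k _; rewrite !mxE.
under eq_bigr do rewrite -big_distrr /=.
rewrite -big_distrl /= le_eqVlt; apply/orP; left; apply/eqP; congr (_ * _).
  rewrite [RHS]sqnE; apply: eq_bigr => i _; rewrite tr_row sqn_col.
  by apply: eq_bigr => j _; rewrite mxE.
by rewrite [RHS]sqnE [RHS]exchange_big; apply: eq_bigr => j _; rewrite sqn_col.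
Qed.

Lemma pow_sym n (M : 'M[R]_n) p : M^T = M -> (M ^+ p)^T = M ^+ p.
Proof.
move=> sM; elim: p => [|p IHp]; first by rewrite expr0 trmx1.
by rewrite [in LHS]exprS -mulmxE trmx_mul IHp sM mulmxE -exprSr.
Qed.

Lemma psd_sandwich n (P S : 'M[R]_n) : psd P -> psd (S^T * P * S).
Proof.
move=> [sP hP]; split; first by rewrite -!mulmxE !trmx_mul trmxK sP mulmxA.
by move=> k X; have := hP _ (S *m X); rewrite /qf trmx_mul -!mulmxE !mulmxA.
Qed.

(** Half of the factors are moved to each side, so that the power is a sandwich of [1] or [M]
    according to the parity of [p]; no spectral theorem is involved. *)
Lemma psd_pow n (M : 'M[R]_n) p : psd M -> psd (M ^+ p).
Proof.
move=> pM; have sM := pM.1.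
have -> : M ^+ p = (M ^+ p./2)^T * (M ^+ odd p) * M ^+ p./2.
  by rewrite pow_sym // -!exprD addnC addnA addnn addnC odd_double_half.
by apply: psd_sandwich; case: (odd p); [rewrite expr1 | exact: psd1].
Qed.

Lemma pd_psd n l (M : 'M[R]_n) : 0 <= l -> pd l M -> psd M.
Proof.
move=> l0 [sM h]; split => // k X; apply: le_trans (h _ X).
by rewrite mulr_ge0 // sqn_ge0.
Qed.

Lemma pd_unit n l (M : 'M[R]_n) : 0 < l -> pd l M -> M \in unitmx.
Proof.
move=> l0 [sM h]; apply: unitmx_ker0 => v Mv; apply/eqP; rewrite -sqn_eq0 eq_le sqn_ge0 andbT.
by have := h _ v; rewrite /qf -mulmxA Mv mulmx0 mxtrace0 pmulr_rle0.
Qed.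

Section PositiveDefiniteInverse.
Variables (n : nat) (l : R) (D : 'M[R]_n).
Hypotheses (l0 : 0 < l) (pD : pd l D).
Let N := invmx D.

Lemma pd_inv_sym : N^T = N. Proof. by rewrite trmx_symm_unit // pD.1. Qed.

Lemma pd_inv_qf k (X : 'M[R]_(n, k)) : qf N X = qf D (N *m X).
Proof.
by rewrite qfM ?pd_inv_sym // -!mulmxE -mulmxA mulmxV ?(pd_unit l0 pD) // mulmx1.
Qed.

Lemma pd_inv_gt0 k (X : 'M[R]_(n, k)) : X != 0 -> 0 < qf N X.
Proof.
move=> X0; rewrite pd_inv_qf; apply: lt_le_trans (pD.2 _ _).
rewrite pmulr_rgt0 // lt_def sqn_ge0 sqn_eq0 andbT; apply: contra X0 => /eqP h.
by rewrite -[X](mulKVmx (pd_unit l0 pD)) h mulmx0.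
Qed.

Lemma pd_inv_psd : psd N.
Proof.
split=> [|k X]; first exact: pd_inv_sym.
by have [->|/pd_inv_gt0/ltW//] := eqVneq X 0; rewrite /qf mulmx0 mxtrace0.
Qed.

Lemma pd_inv_le k (X : 'M[R]_(n, k)) : l * qf N X <= sqn X.
Proof.
set z := N *m X; have tE : \tr (X^T *m z) = qf N X by rewrite /qf mulmxA.
have h1 : l * sqn z <= qf N X by rewrite pd_inv_qf pD.2.
(* Expanding [|X - l N X|^2 >= 0] and using [l |N X|^2 <= X^T N X] once gives the claim. *)
have := sqn_ge0 (X + (- l) *: z); rewrite sqnD sqnZ -scalemxAr mxtraceZ tE => h.
have : l * (l * sqn z) <= l * qf N X by rewrite ler_pM2l.
lra.
Qed.

Lemma pd_inv_pow_gt0 k (X : 'M[R]_(n, k)) p : X != 0 -> 0 < qf (N ^+ p) X.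
Proof.
move=> X0; have uN : N \in unitmx by rewrite unitmx_inv (pd_unit l0 pD).
have nz q : N ^+ q *m X != 0.
  elim: q => [|q IHq]; first by rewrite expr0 mul1mx.
  apply: contra IHq => /eqP h; rewrite -(mulKmx uN (N ^+ q *m X)).
  by rewrite (mulmxA N) mulmxE -exprS h mulmx0.
have -> : N ^+ p = (N ^+ p./2) * (N ^+ odd p) * N ^+ p./2.
  by rewrite -!exprD addnC addnA addnn addnC odd_double_half.
rewrite -qfM ?pow_sym ?pd_inv_sym //.
case: (odd p); first by rewrite expr1 pd_inv_gt0.
by rewrite expr0 qf1 lt_def sqn_ge0 sqn_eq0 nz.
Qed.

(** Cauchy-Schwarz for the form [N ^+ b] at [N ^+ q *m X] and [N ^+ q.+1 *m X], where [p = 2 q + b].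
    These forms are the moments of the spectral measure of [N] at [X], whence the log-convexity. *)
Lemma pd_inv_pow_logconvex k (X : 'M[R]_(n, k)) p :
  qf (N ^+ p.+1) X ^+ 2 <= qf (N ^+ p) X * qf (N ^+ p.+2) X.
Proof.
set q := p./2; set b : nat := odd p.
have pE : p = (q + b + q)%N.
  by rewrite addnC addnA addnn addnC odd_double_half.
have sN := pd_inv_sym.
have h := psd_cauchy (N ^+ q *m X) (N ^+ q.+1 *m X) (psd_pow b pd_inv_psd).
have e1 : qf (N ^+ b) (N ^+ q *m X) = qf (N ^+ p) X.
  by rewrite qfM ?pow_sym // -!exprD -pE.
have e2 : qf (N ^+ b) (N ^+ q.+1 *m X) = qf (N ^+ p.+2) X.
  by rewrite qfM ?pow_sym // -!exprD !addSn addnS -pE.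
have e3 : \tr ((N ^+ q *m X)^T *m N ^+ b *m (N ^+ q.+1 *m X)) = qf (N ^+ p.+1) X.
  have := bl_mul (N ^+ q) (N ^+ b) (N ^+ q.+1) X X.
  by rewrite /bl pow_sym // !mulmxE -!exprD addnS -pE.
by rewrite e1 e2 e3 in h.
Qed.

End PositiveDefiniteInverse.

(** * Effect of a rank-one update on the trace potential *)

Section RankOneUpdate.
Variables (n : nat) (l : R) (D : 'M[R]_n) (y : 'cV[R]_n).
Hypotheses (l0 : 0 < l) (pD : pd l D).
Let N := invmx D.
Let M := invmx (D + y *m y^T).
Let u := M *m y.
Let d := 1 + qf N y.

Lemma pd_rank_one : pd l (D + y *m y^T).
Proof.
split=> [|k X]; first by rewrite linearD /= pD.1 trmx_mul trmxK.
apply: le_trans (pD.2 _ X) _; rewrite qfD lerDl /qf.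
by rewrite mulmxA -mulmxA -{1}[y]trmxK -trmx_mul sqn_ge0.
Qed.

Let pDy := pd_rank_one.

Lemma rank_one_factor_ge1 : 1 <= d.
Proof. by rewrite lerDl; apply: (pd_inv_psd l0 pD).2. Qed.

Let d_gt0 : 0 < d. Proof. exact: lt_le_trans ltr01 rank_one_factor_ge1. Qed.

Lemma rank_one_solve : N *m y = d *: u.
Proof.
have uD := pd_unit l0 pD; have uDy := pd_unit l0 pDy.
rewrite -[LHS](mulKmx uDy) mulmxDl mulKVmx // -mulmxA (mulmxA y^T).
rewrite [y^T *m _ *m _]mx11_scalar -trace_mx11 mul_mx_scalar.
by rewrite /u scalemxAr scalerDl scale1r.
Qed.

(** Sherman-Morrison solved for the old inverse: in terms of the new [M] and [u], the correction is
    positive semidefinite, and all later expansions stay sums of nonnegative terms. *)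
Lemma rank_one_resolvent : N = M + d *: (u *m u^T).
Proof.
have uD := pd_unit l0 pD; have uDy := pd_unit l0 pDy.
apply/eqP; rewrite addrC -subr_eq; apply/eqP.
have -> : N - M = M *m (y *m y^T) *m N.
  have -> : y *m y^T = (D + y *m y^T) - D by rewrite addrC addKr.
  by rewrite mulmxBr mulVmx // mulmxBl mul1mx mulmxK.
have sN : N^T = N := pd_inv_sym pD.
rewrite !mulmxA -/u -mulmxA -{1}sN -trmx_mul rank_one_solve.
by rewrite linearZ /= scalemxAr.
Qed.

Let sM : M^T = M := pd_inv_sym pDy.
Let sN : N^T = N := pd_inv_sym pD.
Let pN := pd_inv_psd l0 pD.
Let pM := pd_inv_psd l0 pDy.

(** Since [M] and [N] do not commute, [M <= N] is not enough. Replacing one [N] by [M + d u u^T]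
    leaves a correction that factors into [u^T M^a u] times [u^T N^i u], both nonnegative. *)
Lemma rank_one_krylov_ge a i : qf (M ^+ (a + i)) u <= qf (M ^+ a * N ^+ i) u.
Proof.
elim: i a => [|i IHi] a; first by rewrite addn0 expr0 mulr1.
have -> : M ^+ a * N ^+ i.+1 =
    M ^+ a.+1 * N ^+ i + d *: (M ^+ a *m u *m (u^T *m N ^+ i)).
  rewrite exprS {1}rank_one_resolvent mulrDl mulrDr mulrA -exprSr; congr (_ + _).
  by rewrite -!mulmxE -scalemxAl -scalemxAr !mulmxA.
rewrite qfD qfZ addnS -addSn; apply: le_trans (IHi a.+1) _; rewrite lerDl.
rewrite mulr_ge0 ?(ltW d_gt0) // -[qf _ _]/(bl _ u u) bl_outer.
by rewrite mulr_ge0 //; [apply: (psd_pow _ pM).2|apply: (psd_pow _ pN).2].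
Qed.

(** The [p] factors [N] are replaced one by one, each releasing [d u^T M^b N^p u] for the current
    exponents; the preceding lemma bounds every release below by the same moment of [M]. The
    parameter [b] counts the factors already replaced. *)
Lemma rank_one_trace_drop p b :
  \tr (M ^+ (p + b)) + p%:R * d * qf (M ^+ (p + b).-1) u <= \tr (N ^+ p * M ^+ b).
Proof.
elim: p b => [|p IHp] b; first by rewrite !mul0r addr0 add0n expr0 mul1r.
have -> : N ^+ p.+1 * M ^+ b =
    N ^+ p * M ^+ b.+1 + d *: (N ^+ p *m u *m (u^T *m M ^+ b)).
  rewrite exprSr {2}rank_one_resolvent mulrDr mulrDl -mulrA -exprS; congr (_ + _).
  by rewrite -!mulmxE -scalemxAr -scalemxAl !mulmxA.
rewrite mxtraceD mxtraceZ [\tr (_ *m (_ *m _))]mxtrace_mulC mulmxA.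
rewrite -(mulmxA u^T) mulmxE -/(qf _ u).
have := IHp b.+1; rewrite addnS /= => h; rewrite addSn /=.
have h2 := rank_one_krylov_ge b p; rewrite [(b + p)%N]addnC in h2.
have h3 : d * qf (M ^+ (p + b)) u <= d * qf (M ^+ b * N ^+ p) u.
  by rewrite ler_pM2l.
rewrite -natr1; lra.
Qed.

(** The opposite comparison, available at [y] because [N y = d M y]. Each replaced factor costs a
    product of two moments, which Chebyshev's inequality merges into one; the total factor is then
    [1 + d a_1]. *)
Lemma rank_one_moment_le j k :
  qf (M ^+ j * N ^+ k) y <= d ^+ k * qf (M ^+ (j + k)) y.
Proof.
have [->|y0] := eqVneq y 0; first by rewrite /qf !mulmx0 mxtrace0 mulr0.
pose a i := qf (M ^+ i) y.
have a_gt0 i : 0 < a i := pd_inv_pow_gt0 l0 pDy i y0.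
have a_lc i : a i.+1 ^+ 2 <= a i * a i.+2 := pd_inv_pow_logconvex l0 pDy y i.
(* As [N y = d M y], the first moment [y^T M y] equals [(d - 1) / d], so the factor produced by each
   replacement is exactly [d]. *)
have dE : d = 1 + d * a 1%N.
  by rewrite {1}/d /a expr1 /qf -!mulmxA rank_one_solve -scalemxAr mxtraceZ.
elim: k j => [|k IHk] j; first by rewrite addn0 expr0 mulr1 mul1r.
have -> : M ^+ j * N ^+ k.+1 =
    M ^+ j.+1 * N ^+ k + d *: (M ^+ j *m u *m (u^T *m N ^+ k)).
  rewrite exprS {1}rank_one_resolvent mulrDl mulrDr mulrA -exprSr; congr (_ + _).
  by rewrite -!mulmxE -scalemxAl -scalemxAr !mulmxA.
rewrite qfD qfZ -[qf (M ^+ j *m _ *m _) y]/(bl _ y y) bl_outer.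
have -> : bl (M ^+ j) y u = a j.+1 by rewrite /bl /u /a /qf exprSr -mulmxE !mulmxA.
have -> : bl (N ^+ k) u y = qf (M ^+ 1 * N ^+ k) y.
  by rewrite /bl /u trmx_mul sM expr1 /qf -mulmxE !mulmxA.
have h1 := IHk j.+1; have h2 := IHk 1%N; rewrite add1n in h2.
have h3 := logconvex_chebyshev a_gt0 a_lc j k.
rewrite -/(a _) in h1 h2 *; rewrite addnS -addSn.
apply: (@le_trans _ _ (d ^+ k * a (j.+1 + k)%N + d * (a j.+1 * (d ^+ k * a k.+1)))).
  by rewrite lerD // !ler_pM2l.
have -> : d ^+ k.+1 * a (j.+1 + k)%N =
    d ^+ k * a (j.+1 + k)%N + d ^+ k.+1 * (a 1%N * a (j + k).+1).
  by rewrite exprS {1}dE -addSn; ring.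
have -> : d * (a j.+1 * (d ^+ k * a k.+1)) = d ^+ k.+1 * (a j.+1 * a k.+1).
  by rewrite exprS; ring.
by rewrite lerD2l ler_pM2l ?exprn_gt0.
Qed.

(** The drop, first found as a moment of the new inverse [M], is converted into a moment of the old
    inverse [N]. Apart from the factor [d^-p] it is then linear in [y y^T] and can be averaged over
    the draw. *)
Lemma rank_one_potential_drop p : (0 < p)%N ->
  \tr (M ^+ p) + p%:R * d^-1 ^+ p * qf (N ^+ p.+1) y <= \tr (N ^+ p).
Proof.
move=> p0; have := rank_one_trace_drop p 0; rewrite addn0 expr0 mulr1.
apply: le_trans; rewrite lerD2l -!mulrA ler_pM2l ?ltr0n //.
have := rank_one_moment_le 0 p.+1; rewrite expr0 mul1r add0n => h.
rewrite exprVn mulrC ler_pdivrMr ?exprn_gt0 //.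
have -> : qf (M ^+ p.-1) u = qf (M ^+ p.+1) y.
  by case: p p0 {h} => // q _; rewrite /u qfM //= -exprS -exprSr.
by rewrite mulrAC -exprS.
Qed.

End RankOneUpdate.

(** * Effect of a scalar shift on the trace potential *)

Section SpectralShift.
Variables (n : nat) (l c : R) (D : 'M[R]_n).
Hypotheses (l0 : 0 < l) (pD : pd l D) (c0 : 0 <= c).
Let N := invmx D.
Let N' := invmx (D + c%:M).

Lemma pd_shift : pd (l + c) (D + c%:M).
Proof.
split=> [|k X]; first by rewrite linearD /= pD.1 tr_scalar_mx.
by rewrite qfD mulrDl lerD ?pD.2 // -scalemx1 qfZ qf1.
Qed.

Let lc0 : 0 < l + c. Proof. by rewrite ltr_wpDr. Qed.
Let pDc := pd_shift.
Let sN : N^T = N := pd_inv_sym pD.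
Let sN' : N'^T = N' := pd_inv_sym pDc.
Let pN := pd_inv_psd l0 pD.
Let pN' := pd_inv_psd lc0 pDc.

Lemma shift_resolvent : N = N' + c *: (N * N').
Proof.
have uD := pd_unit l0 pD; have uDc := pd_unit lc0 pDc.
apply/eqP; rewrite addrC -subr_eq; apply/eqP.
transitivity (N *m ((D + c%:M) - D) *m N').
  by rewrite mulmxBr mulVmx // mulmxBl mul1mx mulmxK.
by rewrite addrC addKr mul_mx_scalar -scalemxAl.
Qed.

Lemma shift_comm : GRing.comm N N'.
Proof.
have uD := pd_unit l0 pD; have uDc := pd_unit lc0 pDc.
have KN : (D + c%:M) *m N = N *m (D + c%:M).
  by rewrite mulmxDl mulmxDr mulmxV // mulVmx // mul_mx_scalar mul_scalar_mx.
by rewrite /GRing.comm -!mulmxE -[LHS](mulKmx uDc) (mulmxA _ N) KN mulmxK.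
Qed.

(** With [v = N' X] the form equals [v^T (D + c) N v = |v|^2 + c v^T N v]. *)
Lemma shift_mixed_psd : psd (N * N').
Proof.
split=> [|k X]; first by rewrite -mulmxE trmx_mul sN sN' !mulmxE shift_comm.
have uD := pd_unit l0 pD; have uDc := pd_unit lc0 pDc.
rewrite -[X](mulKVmx uDc) qfM ?pDc.1 // -!mulmxE -!mulmxA mulVmx // mulmx1.
rewrite mulmxDl mulmxV // mul_scalar_mx qfD qf1 qfZ.
by rewrite addr_ge0 ?sqn_ge0 // mulr_ge0 // pN.2.
Qed.

Lemma shift_step a b :
  N ^+ a.+1 * N' ^+ b = N ^+ a * N' ^+ b.+1 + c *: (N ^+ a.+1 * N' ^+ b.+1).
Proof.
have := congr1 (fun Z => N ^+ a * Z * N' ^+ b) shift_resolvent.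
rewrite mulrDr mulrDl -!mulmxE -scalemxAr -scalemxAl !mulmxE !mulrA -exprSr.
by rewrite -!mulrA -!exprS.
Qed.

Lemma psd_trace_ge0 (P : 'M[R]_n) : psd P -> 0 <= \tr P.
Proof. by move=> [_ h]; have := h _ 1%:M; rewrite /qf trmx1 mul1mx mulmx1. Qed.

Lemma shift_trace_ge0 a b : 0 <= \tr (N ^+ a * N' ^+ b).
Proof.
have cab i j : GRing.comm (N ^+ i) (N' ^+ j).
  by apply: commrX; apply: commr_sym; apply: commrX; apply: commr_sym; apply: shift_comm.
have tE i j : (N ^+ i * N' ^+ j)^T = N ^+ i * N' ^+ j.
  by rewrite -mulmxE trmx_mul !pow_sym // mulmxE -cab.
have mE i j k m : N ^+ i * N' ^+ j * (N ^+ k * N' ^+ m) = N ^+ (i + k) * N' ^+ (j + m).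
  by rewrite mulrA -(mulrA _ (N' ^+ j)) -cab mulrA -exprD -mulrA -exprD.
have hE m : m = (m./2 + odd m + m./2)%N.
  by rewrite addnAC addnn addnC odd_double_half.
have -> : N ^+ a * N' ^+ b = (N ^+ a./2 * N' ^+ b./2)^T *
    (N ^+ odd a * N' ^+ odd b) * (N ^+ a./2 * N' ^+ b./2).
  by rewrite tE !mE -!hE.
apply: psd_trace_ge0; apply: psd_sandwich.
case: (odd a); case: (odd b); rewrite ?expr1 ?expr0 ?mulr1 ?mul1r //.
- exact: shift_mixed_psd.
- exact: psd1.
Qed.

(** The tangent at [0] lies below the convex function [c -> tr (D + c)^-p]. The proof trades factors
    [N] for [N'] one at a time, each trade costing at most [c tr N^(p+1)] in the starting case. *)
Lemma shift_potential_le p : \tr (N ^+ p) <= \tr (N' ^+ p) + p%:R * c * \tr (N ^+ p.+1).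
Proof.
have mono a b : \tr (N ^+ a * N' ^+ b) <= \tr (N ^+ (a + b)).
  elim: b a => [|b IHb] a; first by rewrite addn0 expr0 mulr1.
  apply: le_trans (_ : \tr (N ^+ a.+1 * N' ^+ b) <= _); last by rewrite addnS -addSn.
  rewrite shift_step mxtraceD mxtraceZ lerDl mulr_ge0 //.
  exact: shift_trace_ge0.
suff h b : \tr (N ^+ p * N' ^+ b) <= \tr (N' ^+ (p + b)) + p%:R * c * \tr (N ^+ (p + b).+1).
  by have := h 0%N; rewrite expr0 mulr1 addn0.
elim: p b => [|p IHp] b; first by rewrite expr0 mul1r add0n !mul0r addr0.
rewrite shift_step mxtraceD mxtraceZ.
have h1 := IHp b.+1; have h2 := mono p.+1 b.+1.
have h3 : c * \tr (N ^+ p.+1 * N' ^+ b.+1) <= c * \tr (N ^+ (p.+1 + b.+1)).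
  by rewrite ler_wpM2l.
rewrite !(addSn, addnS) in h1 h3 *; rewrite -natr1; lra.
Qed.

End SpectralShift.

End QuadraticForms.

(** * Leverage score sampling *)

Section IIDSampling.
Variables (R : realType) (T : finType) (q : T -> R).
Hypotheses (q_ge0 : forall i, 0 <= q i) (q_sum : \sum_i q i = 1).

Definition iid_E J (F : {ffun 'I_J -> T} -> R) : R :=
  \sum_(x : {ffun 'I_J -> T}) (\prod_(s < J) q (x s)) * F x.

Definition ffcons J (i : T) (x : {ffun 'I_J -> T}) : {ffun 'I_J.+1 -> T} :=
  [ffun s => oapp x i (unlift ord0 s)].

Lemma ffcons0 J i (x : {ffun 'I_J -> T}) : ffcons i x ord0 = i.
Proof. by rewrite ffunE unlift_none. Qed.

Lemma ffconsS J i (x : {ffun 'I_J -> T}) s : ffcons i x (lift ord0 s) = x s.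
Proof. by rewrite ffunE liftK. Qed.

Lemma iid_ES J (F : {ffun 'I_J.+1 -> T} -> R) :
  iid_E F = \sum_i q i * iid_E (fun x => F (ffcons i x)).
Proof.
rewrite /iid_E (reindex (fun p : T * {ffun 'I_J -> T} => ffcons p.1 p.2)) /=.
  under [RHS]eq_bigr do rewrite big_distrr /=.
  rewrite pair_bigA /=; apply: eq_bigr => -[i x] _ /=.
  rewrite big_ord_recl ffcons0 -mulrA; congr (_ * (_ * _)).
  by apply: eq_bigr => s _; rewrite ffconsS.
exists (fun y : {ffun 'I_J.+1 -> T} => (y ord0, [ffun s => y (lift ord0 s)])).
  move=> [i x] _ /=; rewrite ffcons0; congr (_, _).
  by apply/ffunP => s; rewrite !ffunE liftK.
move=> y _ /=; apply/ffunP => s; rewrite ffunE.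
by case: unliftP => [j ->|->] //=; rewrite ffunE.
Qed.

Lemma iid_E0 (F : {ffun 'I_0 -> T} -> R) x : iid_E F = F x.
Proof.
have h (y : {ffun 'I_0 -> T}) : y = x by apply/ffunP => -[].
by rewrite /iid_E (big_pred1 x) ?big_ord0 ?mul1r // => y; rewrite (h y) /= eqxx.
Qed.

Lemma iid_E_le J (F G : {ffun 'I_J -> T} -> R) :
  (forall x, F x <= G x) -> iid_E F <= iid_E G.
Proof.
by move=> h; apply: ler_sum => x _; rewrite ler_wpM2l ?prodr_ge0.
Qed.

Lemma iid_EZ J c (F : {ffun 'I_J -> T} -> R) :
  iid_E (fun x => c * F x) = c * iid_E F.
Proof. by rewrite /iid_E big_distrr; apply: eq_bigr => x _; rewrite mulrCA. Qed.

Lemma iid_ED J (F G : {ffun 'I_J -> T} -> R) :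
  iid_E (fun x => F x + G x) = iid_E F + iid_E G.
Proof. by rewrite /iid_E -big_split; apply: eq_bigr => x _; rewrite mulrDr. Qed.

Lemma iid_E1 J : iid_E (fun _ : {ffun 'I_J -> T} => 1) = 1.
Proof.
rewrite /iid_E; under eq_bigr do rewrite mulr1.
by rewrite -(bigA_distr_bigA (fun (s : 'I_J) i => q i)) big1.
Qed.

Lemma iid_markov J (P : pred {ffun 'I_J -> T}) (F : {ffun 'I_J -> T} -> R) a :
  0 < a -> (forall x, 0 <= F x) -> (forall x, P x -> a <= F x) ->
  iid_E (fun x => (P x)%:R) <= iid_E F / a.
Proof.
move=> a0 F0 h; rewrite mulrC -iid_EZ; apply: iid_E_le => x.
case Px: (P x); last by rewrite mulr_ge0 // invr_ge0 ltW.
by rewrite mulrC ler_pdivlMr // mul1r h.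
Qed.

(** Additivity of the variance. The offset [c] carries the terms already drawn; its cross term with
    the next draw averages to zero. *)
Lemma iid_sum_sqn m n (z : T -> 'M[R]_(m, n)) J c :
  \sum_i q i *: z i = 0 ->
  iid_E (fun x : {ffun 'I_J -> T} => sqn (c + \sum_s z (x s))) =
  sqn c + J%:R * \sum_i q i * sqn (z i).
Proof.
move=> z0; elim: J c => [|J IHJ] c.
  (* The explicit function on ['I_0] is the empty sample. *)
  by rewrite (iid_E0 _ [ffun s => match (s : 'I_0) with Ordinal _ p => False_rect _ (notF p) end])
    big_ord0 addr0 mul0r addr0.
rewrite iid_ES.
transitivity (\sum_i q i * (sqn (c + z i) + J%:R * \sum_i q i * sqn (z i))).
  apply: eq_bigr => i _; rewrite -IHJ; congr (_ * _); apply: eq_bigr => x _.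
  congr (_ * sqn _); rewrite big_ord_recl ffcons0 addrA; congr (_ + _).
  by apply: eq_bigr => s _; rewrite ffconsS.
under eq_bigr do rewrite sqnD !mulrDr.
rewrite !big_split /= -!mulr_suml q_sum !mul1r.
have -> : \sum_i q i * (2 * \tr (c^T *m z i)) = 0.
  transitivity (2 * \tr (c^T *m \sum_i q i *: z i)).
    rewrite mulmx_sumr linear_sum big_distrr; apply: eq_bigr => i _.
    by rewrite -scalemxAr /= mxtraceZ; ring.
  by rewrite z0 mulmx0 mxtrace0 mulr0.
by rewrite addr0 -natr1; ring.
Qed.

Lemma bernoulli_le (h : R) p : 0 <= h <= 1 -> 1 - p%:R * h <= (1 - h) ^+ p.
Proof.
move=> /andP[h0 h1]; elim: p => [|p IHp]; first by rewrite mul0r subr0 expr0.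
have a0 : 0 <= 1 - h by rewrite subr_ge0.
rewrite exprS; apply: le_trans (_ : (1 - h) * (1 - p%:R * h) <= _); last exact: ler_wpM2l.
have : 0 <= p%:R * h * h by rewrite !mulr_ge0.
rewrite -natr1; lra.
Qed.

Variables (n : nat) (y : T -> 'cV[R]_n) (rho : R) (p : nat).
Hypotheses (y_iso : \sum_i q i *: (y i *m (y i)^T) = 1%:M).
Hypotheses (y_le : forall i, sqn (y i) <= rho) (p_gt0 : (0 < p)%N).

(** The mean drop is at least [p/2 tr N^(p+1)], since [y y^T] has mean [1] and [d^-p >= 1/2]. A
    shift by [1/2] lowers the potential by at most this amount, by the tangent inequality. *)
Lemma potential_supermartingale_step l (D : 'M[R]_n) :
  0 < l -> 2 * p%:R * rho <= l -> pd l D ->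
  \sum_i q i * \tr (invmx (D + y i *m (y i)^T) ^+ p) <=
  \tr (invmx (D + (2^-1)%:M) ^+ p).
Proof.
move=> l0 lp pD; set N := invmx D.
have pr : 0 < p%:R :> R by rewrite ltr0n.
have pNp : psd (N ^+ p.+1) := psd_pow _ (pd_inv_psd l0 pD).
have step i : \tr (invmx (D + y i *m (y i)^T) ^+ p) <=
    \tr (N ^+ p) - p%:R / 2 * qf (N ^+ p.+1) (y i).
  have := rank_one_potential_drop (y i) l0 pD p_gt0; rewrite -/N.
  set e := qf N (y i); have e0 : 0 <= e := (pd_inv_psd l0 pD).2 _ (y i).
  (* From [l y^T N y <= |y|^2 <= rho] and [2 p rho <= l]: one draw moves [d] at most [1/(2p)] away
     from [1]. *)
  have pe : p%:R * e <= 2^-1.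
    have h : l * e <= rho := le_trans (pd_inv_le l0 pD (y i)) (y_le i).
    have h2 : 2 * p%:R * (l * e) <= l.
      by apply: le_trans lp; rewrite ler_pM2l // mulr_gt0.
    rewrite -(ler_pM2l l0); lra.
  have e1 : e <= 1.
    rewrite -(ler_pM2l pr) mulr1; apply: le_trans pe _.
    by apply: le_trans (_ : 1 <= _); [lra | rewrite ler1n].
  (* [1/(1 + e) >= 1 - e], and Bernoulli's inequality then gives [(1 - e)^p >= 1 - p e >= 1/2]. *)
  have d2 : 2^-1 <= (1 + e)^-1 ^+ p.
    apply: le_trans (_ : (1 - e) ^+ p <= _).
      by apply: le_trans (bernoulli_le p _); [lra | rewrite e0 e1].
    rewrite ler_pXn2r ?nnegrE ?subr_ge0 ?invr_ge0 ?addr_ge0 //.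
    rewrite -[X in _ <= X]mul1r ler_pdivlMr; last lra.
    have : 0 <= e * e by rewrite mulr_ge0.
    lra.
  have Q0 := pNp.2 _ (y i).
  have : p%:R * 2^-1 * qf (N ^+ p.+1) (y i) <=
         p%:R * (1 + e)^-1 ^+ p * qf (N ^+ p.+1) (y i).
    by rewrite ler_wpM2r // ler_pM2l.
  lra.
have := shift_potential_le l0 pD (_ : 0 <= 2^-1) p; rewrite invr_ge0 ler0n => /(_ isT) sh.
apply: le_trans (_ : \sum_i q i * (\tr (N ^+ p) - p%:R / 2 * qf (N ^+ p.+1) (y i)) <= _).
  by apply: ler_sum => i _; rewrite ler_wpM2l.
under eq_bigr do rewrite mulrBr.
rewrite sumrB -mulr_suml q_sum mul1r.
have -> : \sum_i q i * (p%:R / 2 * qf (N ^+ p.+1) (y i)) = p%:R / 2 * \tr (N ^+ p.+1).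
  rewrite -[X in \tr X]mulmx1 -y_iso mulmx_sumr linear_sum big_distrr.
  apply: eq_bigr => i _; rewrite -scalemxAr /= mxtraceZ mulmxA mxtrace_mulC mulmxA /qf.
  by ring.
by rewrite lerBlDr.
Qed.

(** After conditioning on the first draw, the remaining draws are replaced by their shift. Shift and
    rank-one term commute as summands, so the one-step bound applies to [C] with the shift already
    added, which still dominates [l]. *)
Lemma potential_supermartingale l J (C : 'M[R]_n) :
  0 < l -> 2 * p%:R * rho <= l -> pd l C ->
  iid_E (fun x : {ffun 'I_J -> T} =>
           \tr (invmx (C + \sum_s y (x s) *m (y (x s))^T) ^+ p)) <=
  \tr (invmx (C + (J%:R / 2)%:M) ^+ p).
Proof.
move=> l0 lp; elim: J C => [|J IHJ] C pC.
  rewrite (iid_E0 _ [ffun s => match (s : 'I_0) with Ordinal _ p => False_rect _ (notF p) end]).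
  by rewrite big_ord0 mul0r raddf0.
rewrite iid_ES.
apply: le_trans (_ : \sum_i q i *
    \tr (invmx (C + (J%:R / 2)%:M + y i *m (y i)^T) ^+ p) <= _).
  apply: ler_sum => i _; rewrite ler_wpM2l //.
  apply: le_trans (_ : \tr (invmx (C + y i *m (y i)^T + (J%:R / 2)%:M) ^+ p) <= _); last first.
    by rewrite addrAC.
  apply: le_trans (IHJ _ (pd_rank_one (y i) pC)); rewrite le_eqVlt; apply/orP; left; apply/eqP.
  apply: eq_bigr => x _; rewrite big_ord_recl ffcons0 addrA.
  rewrite (eq_bigr (fun s => y (x s) *m (y (x s))^T)) // => s _.
  by rewrite ffconsS.
have pC' : pd l (C + (J%:R / 2)%:M).
  have [s h] := pd_shift (J%:R / 2) pC; split=> [|k X]; first exact: s.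
  by apply: le_trans (h k X); rewrite mulrDl lerDl mulr_ge0 ?sqn_ge0 ?divr_ge0.
apply: le_trans (potential_supermartingale_step l0 lp pC') _.
rewrite -addrA -raddfD /=.
by have -> : J%:R / 2 + 2^-1 = J.+1%:R / 2 :> R by rewrite -[J.+1%:R]natr1; field.
Qed.

(* Jensen's inequality for the spectral measure of [D] at [X]. *)
Lemma trace_pow_inv_ge l t k (D : 'M[R]_n) (X : 'M[R]_(n, k)) m :
  0 < l -> pd l D -> qf D X < t * sqn X -> ~~ odd m -> 1 <= t ^+ m * \tr (invmx D ^+ m).
Proof.
move=> l0 pD hX mE; have uD := pd_unit l0 pD.
set N := invmx D; have sN : N^T = N := pd_inv_sym pD.
have X0 : X != 0.
  by apply: contraTneq hX => ->; rewrite /sqn /qf !mulmx0 mxtrace0 mulr0 ltxx.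
have sX : 0 < sqn X by rewrite lt_def sqn_ge0 sqn_eq0 X0.
have t0 : 0 < t.
  by rewrite -(pmulr_lgt0 _ sX); apply: le_lt_trans hX; apply: (pd_psd (ltW l0) pD).2.
have DX0 : D *m X != 0.
  by apply: contra X0 => /eqP h; rewrite -(mulKmx uD X) h mulmx0.
(* Moments taken at [D X] rather than [X] make the sequence start with [X^T D X], followed by
   [|X|^2] and the moments of [N] at [X]. *)
pose a i := qf (N ^+ i.+1) (D *m X).
have aE i : a i.+1 = qf (N ^+ i) X.
  rewrite /a qfM ?pD.1 // exprSr exprS -!mulmxE !mulmxA mulmxV // mul1mx.
  by rewrite -mulmxA mulVmx // mulmx1.
have a0E : a 0%N = qf D X.
  by rewrite /a expr1 qfM ?pD.1 // -!mulmxE mulmxV // mul1mx.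
have := logconvex_jensen (a := a) (fun i => pd_inv_pow_gt0 l0 pD _ DX0)
  (fun i => pd_inv_pow_logconvex l0 pD (D *m X) i.+1) m.
rewrite !aE expr0 qf1 a0E => jen.
(* For even [m] the form is the squared norm of [N^(m/2) X], and the squared Frobenius norm of
   [N^(m/2)] is [tr N^m]. *)
have hm : qf (N ^+ m) X <= \tr (N ^+ m) * sqn X.
  have -> : N ^+ m = N ^+ m./2 * 1%:M * N ^+ m./2.
    rewrite mulr1 -exprD; congr (_ ^+ _).
    by rewrite addnn -[LHS]odd_double_half (negbTE mE).
  rewrite -qfM ?pow_sym // qf1; apply: le_trans (sqn_mul _ _) _.
  by rewrite /sqn pow_sym // mulmxE mulr1.
have qD : qf D X ^+ m <= t ^+ m * sqn X ^+ m.
  rewrite -exprMn; case: (posnP m) => [->|m0]; first by rewrite !expr0.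
  rewrite ler_pXn2r // ?nnegrE ?(ltW hX) //; last by rewrite mulr_ge0 // ltW.
  exact: (pd_psd (ltW l0) pD).2.
have nn : 0 <= qf (N ^+ m) X by apply: (psd_pow _ (pd_inv_psd l0 pD)).2.
have : sqn X ^+ m.+1 <= t ^+ m * sqn X ^+ m * (\tr (N ^+ m) * sqn X).
  apply: le_trans jen _; apply: ler_pM => //.
  by rewrite exprn_ge0 //; apply: (pd_psd (ltW l0) pD).2.
have -> : t ^+ m * sqn X ^+ m * (\tr (N ^+ m) * sqn X) =
  sqn X ^+ m.+1 * (t ^+ m * \tr (N ^+ m)) by rewrite exprSr; ring.
by rewrite -{1}[sqn X ^+ m.+1]mulr1 ler_pM2l // exprn_gt0.
Qed.

Lemma covariance_lower_tail J : ~~ odd p -> (0 < J)%N -> 16 * p%:R * rho <= J%:R ->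
  iid_E (fun x : {ffun 'I_J -> T} =>
    (`[< exists X : 'cV[R]_n,
         qf (\sum_s y (x s) *m (y (x s))^T) X < J%:R / 8 * sqn X >])%:R) <=
  n%:R * 2^-1 ^+ p.
Proof.
move=> pe J0 Jp; have Jr : 0 < J%:R :> R by rewrite ltr0n.
have l0 : 0 < J%:R / 8 :> R by rewrite divr_gt0.
(* The ballast keeps every partial sum above [J/8], hence above [2 p rho]. A direction where the
   sample stays below [J/8] is below [J/4] after adding it, which forces the potential above
   [(4/J)^p]. *)
pose C : 'M[R]_n := (J%:R / 8)%:M.
have pC : pd (J%:R / 8) C.
  by split=> [|k X]; rewrite ?tr_scalar_mx // /C -scalemx1 qfZ qf1.
pose S (x : {ffun 'I_J -> T}) := \sum_s y (x s) *m (y (x s))^T.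
have pS x : psd (S x).
  apply: big_ind => [|A B [sA hA] [sB hB]|s _].
  - by split=> [|k X]; rewrite ?trmx0 // /qf mulmx0 mul0mx mxtrace0.
  - by split=> [|k X]; rewrite ?linearD /= ?sA ?sB // qfD addr_ge0.
  split=> [|k X]; first by rewrite trmx_mul trmxK.
  by rewrite /qf mulmxA -mulmxA -{1}[y _]trmxK -trmx_mul sqn_ge0.
have pCx x : pd (J%:R / 8) (C + S x).
  split=> [|k X]; first by rewrite linearD /= pC.1 (pS x).1.
  by rewrite qfD; apply: le_trans (pC.2 _ X) _; rewrite lerDl (pS x).2.
have J4 : 0 < J%:R / 4 :> R by rewrite divr_gt0.
apply: (le_trans (iid_markov (a := (J%:R / 4) ^- p)
  (F := fun x => \tr (invmx (C + S x) ^+ p)) _ _ _)).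
- by rewrite invr_gt0 exprn_gt0.
- by move=> x; apply/psd_trace_ge0/psd_pow/(pd_inv_psd l0).
- move=> x /asboolP[X hX]; rewrite -[X in X <= _]mul1r ler_pdivrMr ?exprn_gt0 // mulrC.
  apply: (trace_pow_inv_ge l0 (pCx x) (X := X)) => //.
  rewrite qfD /C -scalemx1 qfZ qf1 (_ : J%:R / 4 = J%:R / 8 + J%:R / 8 :> R).
    by rewrite mulrDl ltrD2l.
  by field.
have lp : 2 * p%:R * rho <= J%:R / 8.
  by rewrite ler_pdivlMr //; apply: le_trans Jp; rewrite le_eqVlt; apply/orP; left; apply/eqP; ring.
have := potential_supermartingale J l0 lp pC.
have scalar_pow (a : R) : (a%:M : 'M[R]_n) ^+ p = (a ^+ p)%:M.
  by elim: (p) => [|m IHm]; rewrite ?expr0 // !exprS IHm -mulmxE -scalar_mxM.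
rewrite /C -raddfD /= invmx_scalar scalar_pow mxtrace_scalar => h.
rewrite invrK; apply: (@le_trans _ _ ((J%:R / 8 + J%:R / 2)^-1 ^+ p *+ n * (J%:R / 4) ^+ p)).
  by rewrite ler_pM2r // exprn_gt0.
rewrite mulrnAl -exprMn -mulr_natl ler_wpM2l //.
(* The mean potential is at most [n (5J/8)^-p]; against the threshold [(4/J)^p] each factor is
   [2/5], rounded up to [1/2]. *)
have -> : (J%:R / 8 + J%:R / 2)^-1 * (J%:R / 4) = 2 / 5 :> R.
  rewrite (_ : J%:R / 8 + J%:R / 2 = J%:R * (5 / 8)); last by field.
  by field; rewrite gt_eqF.
by rewrite ler_pXn2r ?nnegrE ?divr_ge0 ?invr_ge0 //; lra.
Qed.

End IIDSampling.

(** * From concentration to the residual guarantee *)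

Section SketchedRegression.
Variables (R : realType) (m r : nat) (A : 'M[R]_(m, r)).

Section Basis.
Variables (k : nat) (Q : 'M[R]_(m, k)) (X : 'M[R]_(k, r)) (Y : 'M[R]_(r, k)).
Hypotheses (QQ : Q^T *m Q = 1%:M) (AE : A = Q *m X) (QE : Q = A *m Y).

Lemma leverage_basis i : leverage A i = sqn (row i Q).
Proof.
rewrite /leverage.
have -> : (row i A *m pinv (A^T *m A) *m (row i A)^T) 0 0 =
    (A *m pinv (A^T *m A) *m A^T) i i.
  by rewrite -row_mul !mxE; apply: eq_bigr => c _; rewrite !mxE.
rewrite (pinv_gram_projector QQ AE QE) mxE sqnE big_ord1.
by apply: eq_bigr => c _; rewrite !mxE expr2.
Qed.

Lemma sum_leverage_basis : \sum_i leverage A i = k%:R.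
Proof.
transitivity (sqn Q); last by rewrite /sqn QQ mxtrace1.
by rewrite [RHS]sqnE; apply: eq_bigr => i _; rewrite leverage_basis sqnE big_ord1;
   apply: eq_bigr => c _; rewrite mxE.
Qed.

Lemma basis_rank_le : (k <= r)%N.
Proof.
apply: (@mulmx1_min _ _ _ X Y).
by rewrite -[LHS]mul1mx -QQ -mulmxA (mulmxA Q) -AE -QE.
Qed.

Lemma basis_rank_gt0 : A != 0 -> (0 < k)%N.
Proof.
move=> A0; rewrite lt0n; apply: contra A0 => /eqP k0; apply/eqP.
by move: X Q AE; rewrite k0 => X' Q' ->; rewrite [X']flatmx0 mulmx0.
Qed.

End Basis.

Lemma leverage_ge0 i : 0 <= leverage A i.
Proof.
have [k [Q [X [Y [QQ AE QE]]]]] := orthonormal_column_basis A.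
by rewrite (leverage_basis QQ AE QE) sqn_ge0.
Qed.

Lemma sum_leverage_gt0 : A != 0 -> 0 < \sum_i leverage A i.
Proof.
have [k [Q [X [Y [QQ AE QE]]]]] := orthonormal_column_basis A => A0.
by rewrite (sum_leverage_basis QQ AE QE) ltr0n (basis_rank_gt0 AE).
Qed.

Lemma leverage_prob_ge0 i : 0 <= leverage_prob A i.
Proof.
by rewrite divr_ge0 ?leverage_ge0 // sumr_ge0 // => i' _; apply: leverage_ge0.
Qed.

Lemma sum_leverage_prob : A != 0 -> \sum_i leverage_prob A i = 1.
Proof. by move=> A0; rewrite -mulr_suml divff // gt_eqF // sum_leverage_gt0. Qed.

(** The two square-root weights of a sampled row multiply to [1/(J q)]. The pair [P], [B] is
    general: it serves the design, the basis [Q] and the residual in the analysis, and the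
    accumulations of the program. *)
Lemma sketch_gram J (x : {ffun 'I_J -> 'I_m}) a b (P : 'M[R]_(m, a)) (B : 'M[R]_(m, b)) :
  (sketch A x *m P)^T *m (sketch A x *m B) =
  J%:R^-1 *: \sum_s (leverage_prob A (x s))^-1 *: ((row (x s) P)^T *m row (x s) B).
Proof.
have sE c (Z : 'M[R]_(m, c)) s j : (sketch A x *m Z) s j =
    (Num.sqrt (J%:R * leverage_prob A (x s)))^-1 * Z (x s) j.
  rewrite mxE (bigD1 (x s)) //= big1 ?addr0 => [|i /negbTE ix]; rewrite !mxE ?eqxx.
    by rewrite div1r.
  by rewrite eq_sym ix mul0r.
apply/matrixP => i j; rewrite !mxE summxE big_distrr; apply: eq_bigr => s _.
rewrite mxE !sE !mxE big_ord1 !mxE mulrACA -invfM -expr2 sqr_sqrtr.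
  by rewrite invfM /= !mulrA.
by rewrite mulr_ge0 // leverage_prob_ge0.
Qed.

Lemma qf_cols k n (M : 'M[R]_k) (Z : 'M[R]_(k, n)) :
  qf M Z = \sum_j qf M (col j Z).
Proof.
rewrite {1}/qf /mxtrace; apply: eq_bigr => j _.
rewrite /qf trace_mx11 -!mulmxA !mxE; apply: eq_bigr => i _; rewrite !mxE; congr (_ * _).
by apply: eq_bigr => c _; rewrite !mxE.
Qed.

Section Guarantee.
Variables (k : nat) (Q : 'M[R]_(m, k)) (X : 'M[R]_(k, r)) (Y : 'M[R]_(r, k)).
Hypotheses (QQ : Q^T *m Q = 1%:M) (AE : A = Q *m X) (QE : Q = A *m Y).
Variables (n : nat) (B : 'M[R]_(m, n)).
Let Bo := B - Q *m (Q^T *m B).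
Let q := leverage_prob A.

Definition whitened_row i : 'cV[R]_k := (Num.sqrt (q i))^-1 *: (row i Q)^T.

Definition noise_term i : 'M[R]_(k, n) := (q i)^-1 *: ((row i Q)^T *m row i Bo).

Lemma whitened_row_gram i :
  whitened_row i *m (whitened_row i)^T = (q i)^-1 *: ((row i Q)^T *m row i Q).
Proof.
rewrite /whitened_row [(_ *: _)^T]linearZ /= trmxK -scalemxAl -scalemxAr scalerA.
by rewrite -invfM -expr2 sqr_sqrtr ?leverage_prob_ge0.
Qed.

(** Ensures that the convention [0^-1 = 0] loses nothing in the averages over [q]: rows that are
    never drawn contribute zero. *)
Lemma row_basis_eq0 i : A != 0 -> q i = 0 -> row i Q = 0.
Proof.
move=> A0 /eqP; rewrite mulf_eq0 invr_eq0 (gt_eqF (sum_leverage_gt0 A0)) orbF.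
by rewrite (leverage_basis QQ AE QE) sqn_eq0 => /eqP.
Qed.

Lemma sum_whitened_rows : A != 0 ->
  \sum_i q i *: (whitened_row i *m (whitened_row i)^T) = 1%:M.
Proof.
move=> A0; transitivity (\sum_i (row i Q)^T *m row i Q).
  apply: eq_bigr => i _; rewrite whitened_row_gram scalerA.
  have [/(row_basis_eq0 A0) ->|qi] := eqVneq (q i) 0.
    by rewrite mulmx0 scaler0.
  by rewrite divff // scale1r.
rewrite -QQ; apply/matrixP => a b; rewrite summxE mxE; apply: eq_bigr => i _.
by rewrite mxE big_ord1 !mxE.
Qed.

Lemma sum_noise_terms : A != 0 -> \sum_i q i *: noise_term i = 0.
Proof.
move=> A0; transitivity (\sum_i (row i Q)^T *m row i Bo).
  apply: eq_bigr => i _; rewrite /noise_term scalerA.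
  have [/(row_basis_eq0 A0) ->|qi] := eqVneq (q i) 0.
    by rewrite trmx0 mul0mx scaler0.
  by rewrite divff // scale1r.
transitivity (Q^T *m Bo); last by rewrite mulmxBr (mulmxA _ Q) QQ mul1mx subrr.
apply/matrixP => a b; rewrite summxE mxE; apply: eq_bigr => i _.
by rewrite mxE big_ord1 !mxE.
Qed.

Lemma sqn_row_basis i : sqn (row i Q) = k%:R * q i.
Proof.
rewrite -(leverage_basis QQ AE QE) /q /leverage_prob (sum_leverage_basis QQ AE QE).
have [k0|k0] := posnP k; last by rewrite mulrC divfK // pnatr_eq0 -lt0n.
have -> : leverage A i = 0; last by rewrite mul0r mulr0.
rewrite (leverage_basis QQ AE QE) (_ : row i Q = 0) ?/sqn ?mulmx0 ?mxtrace0 //.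
by apply/rowP => -[c ck]; exfalso; rewrite k0 in ck.
Qed.

Lemma sqn_whitened_row i : sqn (whitened_row i) <= k%:R.
Proof.
rewrite /whitened_row sqnZ exprVn sqr_sqrtr ?leverage_prob_ge0 //.
have -> : sqn (row i Q)^T = sqn (row i Q) by rewrite /sqn mxtrace_mulC trmxK.
rewrite sqn_row_basis mulrCA; have [->|qi] := eqVneq (q i) 0; first by rewrite !mulr0.
by rewrite mulVf // mulr1.
Qed.

(** Where leverage scores pay off: [|row i Q|^2 / q i] equals [k] for every row of positive
    probability, so the variance is compared with the squared residual row by row. *)
Lemma sum_sqn_noise_terms : \sum_i q i * sqn (noise_term i) <= k%:R * sqn Bo.
Proof.
have -> : k%:R * sqn Bo = \sum_i k%:R * sqn (row i Bo).
  rewrite -big_distrr /=; congr (_ * _); rewrite sqnE; apply: eq_bigr => i _.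
  by rewrite sqnE big_ord1; apply: eq_bigr => c _; rewrite [in RHS]mxE.
apply: ler_sum => i _; rewrite /noise_term sqnZ exprVn.
have le1 : sqn ((row i Q)^T *m row i Bo) <= k%:R * q i * sqn (row i Bo).
  apply: le_trans (sqn_mul _ _) _; rewrite -sqn_row_basis.
  by rewrite [sqn (row i Q)^T]/sqn mxtrace_mulC trmxK.
have [->|qi] := eqVneq (q i) 0; first by rewrite mul0r mulr_ge0 ?sqn_ge0.
have q0 : 0 < q i by rewrite lt_def qi leverage_prob_ge0.
have -> : q i * (q i ^- 2 * sqn ((row i Q)^T *m row i Bo)) =
   (q i)^-1 * sqn ((row i Q)^T *m row i Bo) by field.
by rewrite ler_pdivrMl //; rewrite mulrA (mulrC (q i)).
Qed.

(** In the coordinates of [Q], the sketched normal equations read [G D = g] with [D] the error of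
    the solution. The lower bound on [G] gives [|D| <= 8/J |g|], and the bound on [g] turns this
    into [|D|^2 <= eps |Bo|^2]; the constant [64] is [8^2]. *)
Lemma good_sample_deterministic eps J (x : {ffun 'I_J -> 'I_m}) :
  (0 < J)%N -> 0 <= eps ->
  (forall V : 'cV_k, J%:R / 8 * sqn V <=
     qf (\sum_s whitened_row (x s) *m (whitened_row (x s))^T) V) ->
  64 * sqn (\sum_s noise_term (x s)) <= J%:R ^+ 2 * eps * sqn Bo ->
  good_sample A B eps x.
Proof.
move=> J0 e0; set G := \sum_s _; set g := \sum_s _ => hG hg W /argmin_normal_eq.
have Jr : 0 < J%:R :> R by rewrite ltr0n.
set S := sketch A x; pose D := X *m W - Q^T *m B.
have QBo : Q^T *m Bo = 0 by rewrite mulmxBr (mulmxA _ Q) QQ mul1mx subrr.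
have resE : A *m W - B = Q *m D - Bo.
  by rewrite AE /D mulmxBr mulmxA /Bo opprB addrA subrK.
(* The normal equations hold against [A]; multiplying by [Y^T] states them against [Q = A Y]. *)
rewrite -mulmxA -mulmxBr resE => /(congr1 (mulmx Y^T)).
rewrite mulmx0 mulmxA -trmx_mul -mulmxA -QE mulmxBr mulmxBr => /eqP.
rewrite subr_eq0 (mulmxA S) (mulmxA _ (S *m Q)) !sketch_gram -scalemxAl.
rewrite -(eq_bigr _ (fun s _ => whitened_row_gram (x s))) -/G -/g.
move=> /eqP /(scalerI (invr_neq0 (lt0r_neq0 Jr))) GD.
have h1 : J%:R / 8 * sqn D <= \tr (D^T *m g).
  rewrite -GD mulmxA -/(qf G D) qf_cols -qf1 qf_cols big_distrr.
  by apply: ler_sum => j _ /=; rewrite qf1.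
have h2 : sqn D <= eps * sqn Bo.
  have := sqn_ge0 (D + (- (8 / J%:R)) *: g).
  rewrite sqnD sqnZ -scalemxAr mxtraceZ => h3.
  have h4 : sqn D <= 8 / J%:R * \tr (D^T *m g).
    rewrite -(ler_pM2l (_ : 0 < J%:R / 8)) ?divr_gt0 //.
    by apply: le_trans h1 _; rewrite mulrA mulf_div mulrC [8 * _]mulrC divff ?mulr1 // mulf_neq0 ?gt_eqF.
  have h5 : (8 / J%:R) ^+ 2 * sqn g <= eps * sqn Bo.
    rewrite -(ler_pM2l (_ : 0 < J%:R ^+ 2)) ?exprn_gt0 //.
    have -> : J%:R ^+ 2 * ((8 / J%:R) ^+ 2 * sqn g) = 64 * sqn g.
      by field; rewrite gt_eqF.
    by rewrite mulrA.
  rewrite sqrrN in h3; lra.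
rewrite min_residualE !frobE -[1 + eps]ger0_norm ?addr_ge0 // -sqrtr_sqr -sqrtrM ?sqr_ge0 //.
have -> : A *m pinv_solver A B - B = - Bo.
  by rewrite /pinv_solver !mulmxA (pinv_gram_projector QQ AE QE) /Bo opprB mulmxA.
have -> : sqn (- Bo) = sqn Bo by rewrite -scaleN1r sqnZ sqrrN expr1n mul1r.
rewrite ler_sqrt; last by apply: mulr_ge0; rewrite ?sqr_ge0 ?sqn_ge0.
rewrite -[- Bo]scaleN1r sqnD sqnZ.
rewrite -scalemxAr mxtraceZ trmx_mul -mulmxA QBo mulmx0 mxtrace0 !mulr0 addr0.
have -> : sqn (Q *m D) = sqn D by rewrite /sqn trmx_mul -mulmxA (mulmxA _ Q) QQ mul1mx.
have := sqn_ge0 Bo; set b := sqn Bo in h2 *; set dd := sqn D in h2 *.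
(* Orthogonality has left [|D|^2 + |Bo|^2 <= (1 + eps) |Bo|^2], which is weakened to
   [(1 + eps)^2 |Bo|^2]. *)
move=> b0; have : 0 <= eps * b by rewrite mulr_ge0.
have : 0 <= eps * eps * b by rewrite !mulr_ge0.
rewrite !expr2; lra.
Qed.

End Guarantee.

Lemma leverage_sampling_guarantee n (B : 'M[R]_(m, n)) eps delta p J :
  A != 0 -> 0 < eps -> 0 < delta -> (0 < p)%N -> ~~ odd p ->
  2 * r%:R / delta <= 2 ^+ p -> 16 * p%:R * r%:R <= J%:R :> R ->
  128 * r%:R / (eps * delta) <= J%:R ->
  1 - delta <= sample_Pr A (good_sample A B eps (J := J)).
Proof.
move=> A0 e0 d0 p0 pe hp hJ1 hJ2.
have [k [Q [X [Y [QQ AE QE]]]]] := orthonormal_column_basis A.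
have k0 := basis_rank_gt0 AE A0; have kr := basis_rank_le QQ AE QE.
have krR : k%:R <= r%:R :> R by rewrite ler_nat.
have rR : 0 < r%:R :> R by rewrite ltr0n (leq_trans k0).
have J0 : (0 < J)%N.
  rewrite -(ltr0n R); apply: lt_le_trans hJ1.
  by rewrite !mulr_gt0 // ltr0n.
have Jr : 0 < J%:R :> R by rewrite ltr0n.
pose q := leverage_prob A; have q0 i : 0 <= q i := leverage_prob_ge0 i.
have q1 : \sum_i q i = 1 := sum_leverage_prob A0.
pose Bo := B - Q *m (Q^T *m B).
pose y := whitened_row Q; pose z := noise_term Q B.
pose bad1 (x : {ffun 'I_J -> 'I_m}) := `[< exists V : 'cV[R]_k,
  qf (\sum_s y (x s) *m (y (x s))^T) V < J%:R / 8 * sqn V >].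
pose bad2 (x : {ffun 'I_J -> 'I_m}) :=
  J%:R ^+ 2 * eps * sqn Bo < 64 * sqn (\sum_s z (x s)).
have good x : ~~ bad1 x -> ~~ bad2 x -> x \in good_sample A B eps (J := J).
  move=> /asboolPn h1; rewrite /bad2 -leNgt => h2; rewrite inE.
  apply: (good_sample_deterministic QQ AE QE J0 (ltW e0) _ h2) => V.
  by rewrite leNgt; apply/negP => h; apply: h1; exists V.
have P1 : iid_E q (fun x => (bad1 x)%:R) <= delta / 2.
  apply: (le_trans (covariance_lower_tail q0 q1 (sum_whitened_rows QQ AE QE A0)
     (sqn_whitened_row QQ AE QE) p0 pe J0 _)).
    by apply: le_trans hJ1; rewrite ler_wpM2l // mulr_ge0.
  rewrite exprVn ler_pdivrMr ?exprn_gt0 //.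
  move: hp; rewrite ler_pdivrMr // => hp; lra.
have P2 : iid_E q (fun x => (bad2 x)%:R) <= delta / 2.
  (* For an exact fit the Markov threshold would be zero, but then all noise terms vanish and the
     event is empty. *)
  have b0 := sqn_ge0 Bo; rewrite le_eqVlt in b0; case/orP: b0 => b0.
    have B0 : Bo = 0 by apply/eqP; rewrite -sqn_eq0 eq_sym.
    have z0 i : z i = 0 by rewrite /z /noise_term -/Bo B0 linear0 mulmx0 scaler0.
    rewrite (_ : iid_E _ _ = 0) ?divr_ge0 ?ltW //; apply: big1 => x _.
    have zs : \sum_s z (x s) = 0 by apply: big1.
    by rewrite /bad2 zs -(eqP b0) /sqn mulmx0 mxtrace0 !mulr0 ltxx mulr0.
  have a0 : 0 < J%:R ^+ 2 * eps * sqn Bo by rewrite !mulr_gt0 // exprn_gt0.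
  apply: (le_trans (iid_markov q0 (F := fun x => 64 * sqn (0 + \sum_s z (x s))) a0 _ _)).
  - by move=> x; rewrite mulr_ge0 // sqn_ge0.
  - by move=> x; rewrite add0r; apply: ltW.
  rewrite iid_EZ (iid_sum_sqn q1 _ _ (sum_noise_terms QQ AE QE B A0)).
  rewrite {1}/sqn mulmx0 mxtrace0 add0r ler_pdivrMr //.
  have := sum_sqn_noise_terms QQ AE QE B; rewrite -/Bo -/z -/q; set E := \sum_i _ => hE.
  have hE2 : E <= r%:R * sqn Bo by apply: le_trans hE _; rewrite ler_pM2r.
  have : J%:R * E <= J%:R * (r%:R * sqn Bo) by rewrite ler_pM2l.
  (* Markov gives a failure probability of at most [64 r / (J eps)], which is [delta/2] at
     [J = 128 r / (eps delta)]. *)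
  move: hJ2; rewrite ler_pdivrMr ?mulr_gt0 // => hJ2.
  have : (128 * r%:R) * (J%:R * sqn Bo) <= (J%:R * (eps * delta)) * (J%:R * sqn Bo).
    by rewrite ler_pM2r // mulr_gt0.
  rewrite expr2; lra.
have -> : sample_Pr A (good_sample A B eps (J := J)) =
    iid_E q (fun x => (x \in good_sample A B eps (J := J))%:R).
  rewrite /sample_Pr /iid_E big_mkcond; apply: eq_bigr => x _.
  by case: ifP => _; rewrite ?mulr1 ?mulr0.
rewrite lerBlDr -[X in X <= _](iid_E1 q1 J).
apply: le_trans (_ : iid_E q (fun x => (x \in good_sample A B eps (J := J))%:R +
   ((bad1 x)%:R + (bad2 x)%:R)) <= _).
  apply: (iid_E_le q0) => x.
  case b1: (bad1 x); first by rewrite addrCA lerDl addr_ge0.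
  case b2: (bad2 x); first by rewrite addrCA add0r addrC lerDl.
  by rewrite good ?b1 ?b2 // !addr0.
by rewrite !iid_ED lerD2l [delta in X in _ <= X](splitr delta) lerD.
Qed.

End SketchedRegression.

(** * Choice of the number of samples *)

Section SampleCount.
Variable R : realType.

Lemma log1_ge1 (x : R) : 1 <= log1 x.
Proof. by rewrite /log1 le_max lexx. Qed.

Lemma ln_le_log1 (x : R) : ln x <= log1 x.
Proof. by rewrite /log1 le_max lexx orbT. Qed.

Lemma polylog_ge1 e r (delta : R) : 1 <= polylog e r delta.
Proof. by rewrite exprn_ege1 // mulr_ege1 // log1_ge1. Qed.

Lemma expR1_le4 : expR 1 <= 4 :> R.
Proof.
have h : 2^-1 <= expR (- 2^-1) :> R by apply: le_trans (expR_ge1Dx _); lra.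
have h2 : expR 2^-1 <= 2 :> R.
  by rewrite -[2^-1]opprK expRN -[X in _ <= X]invrK lef_pV2 // posrE ?expR_gt0 ?invr_gt0.
rewrite [X in expR X](_ : 1 = 2^-1 + 2^-1); last by field.
rewrite expRD; apply: le_trans (ler_pM _ _ h2 h2) _; rewrite ?expR_ge0 //.
by rewrite -natrM.
Qed.

(** The factor 2 makes the exponent even, as the Jensen bound requires, and gives
    [2^(2m) = 4^m >= e^m], so the crude estimate [e <= 4] suffices. *)
Definition tail_exponent (r : nat) (delta : R) : nat :=
  (2 * (Num.trunc (ln (2 * r%:R / delta))).+1)%N.

Definition sample_count (r : nat) (eps delta : R) : nat :=
  (Num.trunc (16 * (tail_exponent r delta)%:R * r%:R +
              128 * r%:R / (eps * delta) : R)).+1.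

Variables (r : nat) (eps delta : R).
Hypotheses (r_gt0 : (0 < r)%N) (eps01 : 0 < eps < 1) (delta01 : 0 < delta < 1).

Let y : R := 2 * r%:R / delta.

Let rR : 1 <= r%:R :> R. Proof. by rewrite ler1n. Qed.

Let y_ge1 : 1 <= y.
Proof.
case/andP: delta01 => d0 d1; rewrite /y ler_pdivlMr // mul1r.
by move: rR; lra.
Qed.

Lemma tail_exponent_ge : y <= 2 ^+ tail_exponent r delta.
Proof.
rewrite /tail_exponent -/y; set m := (Num.trunc _).+1.
have y0 : 0 < y := lt_le_trans ltr01 y_ge1.
have hm : ln y <= m%:R.
  by have /andP[_ /ltW] := truncn_itv (ln_ge0 y_ge1).
rewrite exprM -[X in X <= _](lnK (_ : y \is Num.pos)) ?posrE //.
apply: (@le_trans _ _ (expR m%:R)); first by rewrite ler_expR.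
rewrite -[m%:R]mulr1 expRM_natl ler_pXn2r ?nnegrE ?expR_ge0 //.
by rewrite -natrX; apply: expR1_le4.
Qed.

Lemma tail_exponent_le :
  (tail_exponent r delta)%:R <= 8 * (log1 r%:R * log1 delta^-1).
Proof.
case/andP: delta01 => d0 d1; rewrite /tail_exponent -/y natrM -natr1.
have /andP[h _] := truncn_itv (ln_ge0 y_ge1).
have r0 : 0 < r%:R :> R := lt_le_trans ltr01 rR.
have lny : ln y = ln 2 + ln r%:R + ln delta^-1.
  by rewrite /y !lnM ?posrE ?mulr_gt0 ?invr_gt0.
have ln2 : ln 2 <= 1 :> R by have := @le_ln1Dx R 1; rewrite -natr1 => ->//; lra.
have l1 := ln_le_log1 r%:R; have l2 := ln_le_log1 delta^-1.
have g1 := log1_ge1 (r%:R : R); have g2 := log1_ge1 delta^-1.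
(* For [a, b >= 1] one has [a + b <= 1 + a b]; hence [2 (2 + a + b) <= 8 a b]. *)
have : 0 <= (log1 r%:R - 1) * (log1 delta^-1 - 1) by rewrite mulr_ge0 // subr_ge0.
lra.
Qed.

(** The constant is [257 = 16 * 8 + 128 + 1]: the tail exponent, the variance term and the rounding
    up. *)
Lemma sample_count_le : (sample_count r eps delta)%:R <=
  257 * polylog 1 r delta * (r%:R / (eps * delta)).
Proof.
case/andP: (delta01) => d0 d1; case/andP: (eps01) => e0 e1.
have ed0 : 0 < eps * delta by rewrite mulr_gt0.
have ed1 : eps * delta <= 1 by rewrite mulr_ile1 // ltW.
have r0 : 0 < r%:R :> R := lt_le_trans ltr01 rR.
set P := polylog 1 r delta; set F := r%:R / (eps * delta).
have P1 : 1 <= P := polylog_ge1 1 r delta.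
have rF : r%:R <= F by rewrite /F ler_pdivlMr // -[X in _ <= X]mulr1 ler_pM2l.
have F1 : 1 <= F := le_trans rR rF.
have F0 : 0 < F := lt_le_trans ltr01 F1.
rewrite /sample_count -natr1.
set x := (X in Num.trunc X).
have x0 : 0 <= x by rewrite /x addr_ge0 ?divr_ge0 ?mulr_ge0 // ltW.
have /andP[h _] := truncn_itv x0.
have pE : (tail_exponent r delta)%:R <= 8 * P by rewrite /P /polylog expr1 tail_exponent_le.
have h1 : (tail_exponent r delta)%:R * r%:R <= 8 * P * F by apply: ler_pM => //; exact: ltW.
have h2 : F <= P * F by rewrite ler_peMl // ltW.
have h3 : 1 <= P * F := le_trans F1 h2.
have xE : x = 16 * ((tail_exponent r delta)%:R * r%:R) + 128 * F by rewrite /x /F !mulrA.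
lra.
Qed.

Lemma sample_count_ge :
  (16 * (tail_exponent r delta)%:R * r%:R <= (sample_count r eps delta)%:R :> R) /\
  128 * r%:R / (eps * delta) <= (sample_count r eps delta)%:R.
Proof.
case/andP: (delta01) => d0 d1; case/andP: (eps01) => e0 e1.
rewrite /sample_count; set a := 16 * _ * _; set b := 128 * _ / _.
have a0 : 0 <= a by rewrite /a !mulr_ge0.
have b0 : 0 <= b by rewrite /b divr_ge0 ?mulr_ge0 // ltW.
have /andP[_ /ltW h] := truncn_itv (addr_ge0 a0 b0).
by split; apply: le_trans h; rewrite ?lerDl ?lerDr.
Qed.

Lemma leverage_sampling_good m n (A : 'M[R]_(m, r)) (B : 'M[R]_(m, n)) :
  A != 0 ->
  1 - delta <= sample_Pr A (good_sample A B eps (J := sample_count r eps delta)).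
Proof.
move=> A0; case/andP: (delta01) => d0 _; case/andP: (eps01) => e0 _.
have [h1 h2] := sample_count_ge.
apply: (leverage_sampling_guarantee _ A0 e0 d0 _ _ tail_exponent_ge h1 h2).
  by rewrite /tail_exponent mul2n double_gt0.
by rewrite /tail_exponent mul2n odd_double.
Qed.

End SampleCount.

(** * Frames and running times of machine programs *)

Section Machine.

Fixpoint nwrites (c : cmd) : seq nat :=
  match c with
  | NSet a _ _ => [:: a]
  | Seq c1 c2 | If _ c1 c2 => nwrites c1 ++ nwrites c2
  | For x _ c1 => x :: nwrites c1
  | _ => [::]
  end.

Fixpoint rwrites (c : cmd) : seq nat :=
  match c with
  | RSet a _ _ | Draw a _ | Pinv a _ _ => [:: a]
  | Eig a b _ _ => [:: a; b]
  | Seq c1 c2 | If _ c1 c2 => rwrites c1 ++ rwrites c2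
  | For _ _ c1 => rwrites c1
  | _ => [::]
  end.

Fixpoint no_draw (c : cmd) : bool :=
  match c with
  | Draw _ _ => false
  | Seq c1 c2 | If _ c1 c2 => no_draw c1 && no_draw c2
  | For _ _ c1 => no_draw c1
  | _ => true
  end.

(* The flag tells whether only the scalar cell of the array is read. *)
Fixpoint nreads (e : nexp) : seq (nat * bool) :=
  match e with
  | NConst _ => [::]
  | NGet a ix => (a, nilp ix) :: flatten (map nreads ix)
  | NAdd e1 e2 | NSub e1 e2 | NMul e1 e2 => nreads e1 ++ nreads e2
  end.

(* Cells that loop bounds may read before the command has written them. *)
Fixpoint bound_reads (c : cmd) : seq (nat * bool) :=
  match c with
  | Seq c1 c2 | If _ c1 c2 => bound_reads c1 ++ bound_reads c2
  | For x e c1 => nreads e ++ [seq a <- bound_reads c1 | a != (x, true)]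
  | Pinv _ _ e | Eig _ _ _ e => nreads e
  | _ => [::]
  end.

(** A syntactic guarantee that every loop bound has the value it would have on entry, up to
    enclosing loop counters: no cell read by a later bound is overwritten before. A loop counter may
    occur in bounds of the body, but only as a scalar. *)
Fixpoint bounds_stable (c : cmd) : bool :=
  match c with
  | Seq c1 c2 => [&& bounds_stable c1, bounds_stable c2
                   & all (fun a => a.1 \notin nwrites c1) (bound_reads c2)]
  | If _ c1 c2 => bounds_stable c1 && bounds_stable c2
  | For x e c1 =>
      bounds_stable c1 &&
      all (fun a => (a.1 \notin nwrites c1) && (a.2 || (a.1 != x))) (bound_reads c1)
  | _ => true
  end.

Definition nenv : Type := nat -> seq nat -> nat.

Fixpoint nval (nm : nenv) (e : nexp) : nat :=
  match e with
  | NConst n => n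
  | NGet a ix => nm a (map (nval nm) ix)
  | NAdd e1 e2 => (nval nm e1 + nval nm e2)%N
  | NSub e1 e2 => (nval nm e1 - nval nm e2)%N
  | NMul e1 e2 => (nval nm e1 * nval nm e2)%N
  end.

Definition nupd (nm : nenv) (x k : nat) : nenv :=
  fun b iy => if (b == x) && (iy == [::]) then k else nm b iy.

(** Takes the larger branch at each test, so it needs neither real memory nor draws. The environment
    changes only at loop counters. *)
Fixpoint time_bound (nm : nenv) (c : cmd) : nat :=
  match c with
  | Skip => 1
  | NSet _ ix e => (1 + ixcost ix + ncost e)%N
  | RSet _ ix e => (1 + ixcost ix + rcost e)%N
  | Draw _ ix => (1 + ixcost ix)%N
  | Pinv _ _ e | Eig _ _ _ e => (1 + ncost e + nval nm e ^ 3)%N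
  | Seq c1 c2 => (time_bound nm c1 + time_bound nm c2)%N
  | If b c1 c2 => (1 + bcost b + maxn (time_bound nm c1) (time_bound nm c2))%N
  | For x e c1 =>
      (1 + ncost e + \sum_(k < nval nm e) (1 + time_bound (nupd nm x k) c1))%N
  end.

Variables (R : realType) (eig : eig_routine R) (us : nat -> R).
Implicit Types (s : state R) (c : cmd).

Notation exec := (run eig us).

Section NestedInduction.
Variable P : nexp -> Prop.
Hypotheses (hC : forall n, P (NConst n))
  (hG : forall a ix, (forall e, List.In e ix -> P e) -> P (NGet a ix))
  (hA : forall e1 e2, P e1 -> P e2 -> P (NAdd e1 e2))
  (hS : forall e1 e2, P e1 -> P e2 -> P (NSub e1 e2))
  (hM : forall e1 e2, P e1 -> P e2 -> P (NMul e1 e2)).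

(** The automatically generated principle gives no hypothesis for the index list inside [NGet]; the
    inner fixpoint supplies it. *)
Fixpoint nexp_nested_ind (e : nexp) : P e :=
  match e with
  | NConst n => hC n
  | NGet a ix => hG a
      ((fix go (l : seq nexp) : forall e, List.In e l -> P e :=
          match l with
          | [::] => fun e (h : List.In e [::]) => match h with end
          | e0 :: l' => fun e (h : List.In e (e0 :: l')) =>
              match h with
              | or_introl h1 => eq_ind e0 P (nexp_nested_ind e0) e h1
              | or_intror h2 => go l' e h2
              end
          end) ix)
  | NAdd e1 e2 => hA (nexp_nested_ind e1) (nexp_nested_ind e2)
  | NSub e1 e2 => hS (nexp_nested_ind e1) (nexp_nested_ind e2)
  | NMul e1 e2 => hM (nexp_nested_ind e1) (nexp_nested_ind e2)
  end.
End NestedInduction.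

Definition agree_at s (nm : nenv) (a : nat * bool) : Prop :=
  forall iy, a.2 ==> nilp iy -> nmem s a.1 iy = nm a.1 iy.

Lemma nval_agree s nm e :
  (forall a, a \in nreads e -> agree_at s nm a) -> neval s e = nval nm e.
Proof.
elim/nexp_nested_ind: e => //= [a ix IH|e1 e2 IH1 IH2|e1 e2 IH1 IH2|e1 e2 IH1 IH2] h.
- rewrite [LHS](h (a, nilp ix)) ?inE ?eqxx //=; last first.
    by apply/implyP; case: (ix).
  congr (nm a _).
  have {}h b : b \in flatten (map nreads ix) -> agree_at s nm b.
    by move=> hb; apply: h; rewrite inE hb orbT.
  elim: ix IH h => //= e ix IHix IH h.
  rewrite IH ?IHix //; try by [left].
  + by move=> e' he'; apply: IH; right.
  + by move=> b hb; apply: h; rewrite mem_cat hb orbT.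
  by move=> b hb; apply: h; rewrite mem_cat hb.
- by rewrite IH1 ?IH2 // => a ha; apply: h; rewrite mem_cat ha ?orbT.
- by rewrite IH1 ?IH2 // => a ha; apply: h; rewrite mem_cat ha ?orbT.
by rewrite IH1 ?IH2 // => a ha; apply: h; rewrite mem_cat ha ?orbT.
Qed.

Definition enter x k s : state R := tick 1 (set_nat x [::] k s).

Lemma run_for x e c s : exec (For x e c) s =
  foldl (fun s' k => exec c (enter x k s')) (tick (1 + ncost e) s) (iota 0 (neval s e)).
Proof. by []. Qed.

Lemma run_for_ind x e c s n (P : nat -> state R -> Prop) :
  neval s e = n -> P 0%N (tick (1 + ncost e) s) ->
  (forall k s', (k < n)%N -> P k s' -> P k.+1 (exec c (enter x k s'))) ->
  P n (exec (For x e c) s).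
Proof.
rewrite run_for => -> P0 PS; move: (tick _ s) P0 => s0 P0.
suff h m : (m <= n)%N ->
    P m (foldl (fun s' k => exec c (enter x k s')) s0 (iota 0 m)) by apply: h.
elim: m => [|m IHm] // hm; rewrite -addn1 iotaD foldl_cat /= add0n addn1.
by apply: PS => //; apply: IHm; apply: ltnW.
Qed.

Lemma run_nframe b c s : b \notin nwrites c -> nmem (exec c s) b = nmem s b.
Proof.
elim: c s => //=.
- by move=> a ix e s; rewrite inE => /negbTE h; apply/funext => iy; rewrite h.
- move=> c1 IH1 c2 IH2 s; rewrite mem_cat negb_or => /andP[h1 h2].
  by rewrite IH2 // IH1.
- move=> bb c1 IH1 c2 IH2 s; rewrite mem_cat negb_or => /andP[h1 h2].
  by case: ifP => _; [rewrite IH1|rewrite IH2].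
move=> x e c IH s; rewrite inE negb_or => /andP[/negbTE hx hc].
apply: (@run_for_ind x e c s _ (fun _ s' => nmem s' b = nmem s b)) => // k s' _ <-.
by rewrite IH //=; apply/funext => iy; rewrite hx.
Qed.

Lemma set_mx_frame a m n (M : 'M[R]_(m, n)) s b :
  (b == a) = false -> rmem (set_mx a M s) b = rmem s b.
Proof.
move=> h; apply/funext => -[|i [|j [|]]] //=.
by case: insub => // i'; case: insub => // j'; rewrite h.
Qed.

Lemma run_rframe b c s : b \notin rwrites c -> rmem (exec c s) b = rmem s b.
Proof.
elim: c s => //=.
- by move=> a ix e s; rewrite inE => /negbTE h; apply/funext => iy; rewrite h.
- by move=> a ix s; rewrite inE => /negbTE h; apply/funext => iy; rewrite h.
- move=> a a' e s; rewrite inE => /negbTE h.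
  exact: (set_mx_frame _ (tick 0 s) h).
- move=> a a' a'' e s; rewrite !inE negb_or => /andP[/negbTE h /negbTE h'].
  exact: (etrans (set_mx_frame _ (set_mx _ _ (tick 0 s)) h')
                 (set_mx_frame _ (tick 0 s) h)).
- move=> c1 IH1 c2 IH2 s; rewrite mem_cat negb_or => /andP[h1 h2].
  by rewrite IH2 // IH1.
- move=> bb c1 IH1 c2 IH2 s; rewrite mem_cat negb_or => /andP[h1 h2].
  by case: ifP => _; [rewrite IH1|rewrite IH2].
move=> x e c IH s hc.
apply: (@run_for_ind x e c s _ (fun _ s' => rmem s' b = rmem s b)) => // k s' _ <-.
by rewrite IH.
Qed.

Lemma run_draws c s : no_draw c -> draws (exec c s) = draws s.
Proof.
elim: c s => //=.
- by move=> c1 IH1 c2 IH2 s /andP[h1 h2]; rewrite IH2 // IH1.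
- by move=> bb c1 IH1 c2 IH2 s /andP[h1 h2]; case: ifP => _; [rewrite IH1|rewrite IH2].
move=> x e c IH s hc.
apply: (@run_for_ind x e c s _ (fun _ s' => draws s' = draws s)) => // k s' _ <-.
by rewrite IH.
Qed.

(** Valid for every stream of draws: under [bounds_stable] the cells read by loop bounds keep
    agreeing with the static environment throughout the run, so each loop makes the predicted number
    of passes. *)
Lemma run_time c s nm : bounds_stable c ->
  (forall a, a \in bound_reads c -> agree_at s nm a) ->
  (clock (exec c s) <= clock s + time_bound nm c)%N.
Proof.
elim: c s nm => //=.
- by move=> a b e s nm _ h; rewrite (nval_agree h).
- by move=> a b b' e s nm _ h; rewrite (nval_agree h).
- move=> c1 IH1 c2 IH2 s nm /and3P[b1 b2 /allP st] h.
  rewrite addnA; apply: leq_trans (IH2 _ nm b2 _) _; last first.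
    by rewrite leq_add2r; apply: IH1 => // a ha; apply: h; rewrite mem_cat ha.
  by move=> a ha iy hy; rewrite run_nframe ?st // h // mem_cat ha orbT.
- move=> b c1 IH1 c2 IH2 s nm /andP[b1 b2] h.
  rewrite addnA; case: ifP => _.
    apply: leq_trans (IH1 _ nm b1 _) _; last by rewrite leq_add2l leq_maxl.
    by move=> a ha; apply: h; rewrite mem_cat ha.
  apply: leq_trans (IH2 _ nm b2 _) _; last by rewrite leq_add2l leq_maxr.
  by move=> a ha; apply: h; rewrite mem_cat ha orbT.
move=> x e c IH s nm /andP[bc /allP st] h.
have he : neval s e = nval nm e.
  by apply: nval_agree => a ha; apply: h; rewrite mem_cat ha.
set n := nval nm e in he *.
pose B k := (1 + time_bound (nupd nm x k) c)%N.
apply: (@leq_trans (clock s + (1 + ncost e) + \sum_(k < n) B k)); last by rewrite -addnA.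
have [] := @run_for_ind x e c s n (fun k s' =>
   (clock s' <= clock s + (1 + ncost e) + \sum_(k < k) B k)%N /\
   (forall a, a \in bound_reads c -> a != (x, true) -> agree_at s' nm a)) he _ _ => //.
  rewrite big_ord0 addn0; split=> // a ha ax.
  by apply: h; rewrite mem_cat mem_filter ax ha orbT.
move=> k s' _ [h1 h2]; split; last first.
  move=> a ha ax iy hy; have /andP[aw a2] := st a ha.
  rewrite run_nframe //= -(h2 a ha ax iy hy); case: eqP => //= axE.
  case: a ha ax hy aw a2 axE => a [] /= ha ax hy aw; first by rewrite -ax => _ ax'; rewrite ax' eqxx in ax.
  by move=> /eqP.
rewrite big_ord_recr /= addnA; apply: leq_trans (IH _ (nupd nm x k) bc _) _.
  move=> a ha iy hy; rewrite /enter /= /nupd; case: ifP => // axy.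
  apply: h2 => //; apply: contraFN axy => /eqP aE; rewrite aE /= in hy *.
  by case: iy hy; rewrite ?eqxx.
by rewrite /= /B addnA leq_add2r addn1 -addn1 leq_add2r.
Qed.

Definition same_off (ns rs : seq nat) s s' : Prop :=
  (forall b, b \notin ns -> nmem s' b = nmem s b) /\
  (forall b, b \notin rs -> rmem s' b = rmem s b).

Lemma same_off_refl ns rs s : same_off ns rs s s. Proof. by []. Qed.

Lemma same_off_trans ns rs s1 s2 s3 :
  same_off ns rs s1 s2 -> same_off ns rs s2 s3 -> same_off ns rs s1 s3.
Proof. by move=> [a b] [c d]; split=> x hx; [rewrite c ?a|rewrite d ?b]. Qed.

Lemma run_same_off c s : same_off (nwrites c) (rwrites c) s (exec c s).
Proof. by split=> b hb; [apply: run_nframe|apply: run_rframe]. Qed.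

(** The loop rule with the frame supplied in each pass: the step of an invariant may use that only
    the counter and the arrays written by the body have changed since the loop began. *)
Lemma run_for_frame_ind x e c s n (P : nat -> state R -> Prop) :
  neval s e = n -> P 0%N (tick (1 + ncost e) s) ->
  (forall k s', (k < n)%N -> same_off (x :: nwrites c) (rwrites c) s s' ->
     P k s' -> P k.+1 (exec c (enter x k s'))) ->
  P n (exec (For x e c) s).
Proof.
move=> he P0 PS.
pose P' k s' := same_off (x :: nwrites c) (rwrites c) s s' /\ P k s'.
suff [] : P' n (exec (For x e c) s) by [].
apply: (run_for_ind (P := P')) => // k s' kn [hs hP]; split; last exact: PS.
apply: same_off_trans hs _; split=> b hb; last by rewrite run_rframe.
move: hb; rewrite inE negb_or => /andP[/negbTE bx hb]; rewrite run_nframe //=.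
by apply/funext => iy; rewrite bx.
Qed.

Definition filled s s1 A m n (g : nat -> nat -> seq nat) (f : nat -> nat -> R) : Prop :=
  (forall a b, (a < m)%N -> (b < n)%N -> rmem s1 A (g a b) = f a b) /\
  (forall iy, (forall a' b', (a' < m)%N -> (b' < n)%N -> iy <> g a' b') ->
     rmem s1 A iy = rmem s A iy).

(** The body may read the array it writes, provided it uses only its own cell or cells outside the
    filled range; at its turn these still hold their initial contents because [g] is injective on
    the range. *)
Lemma fill2_ok x y e1 e2 A ix e s m n (g : nat -> nat -> seq nat) (f : nat -> nat -> R) :
  x != y -> neval s e1 = m ->
  (forall s', same_off [:: x; y] [:: A] s s' -> neval s' e2 = n) ->
  (forall a b a' b', g a b = g a' b' -> (a < m)%N -> (b < n)%N -> (a' < m)%N -> (b' < n)%N ->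
     a = a' /\ b = b') ->
  (forall a b s', (a < m)%N -> (b < n)%N -> same_off [:: x; y] [:: A] s s' ->
     nmem s' x [::] = a -> nmem s' y [::] = b ->
     rmem s' A (g a b) = rmem s A (g a b) ->
     (forall iy, (forall a' b', (a' < m)%N -> (b' < n)%N -> iy <> g a' b') ->
        rmem s' A iy = rmem s A iy) ->
     map (neval s') ix = g a b /\ reval s' e = f a b) ->
  filled s (exec (For x e1 (For y e2 (RSet A ix e))) s) A m n g f.
Proof.
move=> xy he1 he2 g_inj step; set s1 := exec _ s.
(* The predicate [d] tells which index pairs have been processed; the outer and the inner loop use
   different ones. *)
pose P (d : nat -> nat -> bool) s' :=
  (forall a b, (a < m)%N -> (b < n)%N ->
     rmem s' A (g a b) = if d a b then f a b else rmem s A (g a b)) /\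
  (forall iy, (forall a' b', (a' < m)%N -> (b' < n)%N -> iy <> g a' b') ->
     rmem s' A iy = rmem s A iy).
suff [h1 h2] : P (fun a b => a < m)%N s1.
  by split=> // a b ha hb; rewrite h1 // ha.
apply: (run_for_frame_ind (P := fun k => P (fun a _ => a < k)%N) he1) => //.
move=> a s2 am hs2 [i1 i2].
have hs3 : same_off [:: x; y] [:: A] s (enter x a s2).
  apply: same_off_trans hs2 _; split=> // b; rewrite /= !inE negb_or => /andP[/negbTE bx _].
  by apply/funext => iy; rewrite /= bx.
have [] := @run_for_frame_ind y e2 (RSet A ix e) (enter x a s2) n
   (fun k => P (fun a' b => (a' < a) || (a' == a) && (b < k))%N) (he2 _ hs3).
- split=> [a' b ha hb|iy hiy]; last exact: i2.
  by rewrite /= i1 // ltn0 andbF orbF.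
- move=> b s4 bn hs4 [j1 j2].
  have hs5 : same_off [:: x; y] [:: A] s (enter y b s4).
    apply: same_off_trans hs3 _; split=> c; rewrite /= !inE => hc.
      move: (hc); rewrite negb_or => /andP[_ /negbTE cy].
      apply/funext => iy; rewrite /= cy -/(nmem (enter x a s2) c iy) hs4.1 //.
      by rewrite inE cy.
    by rewrite /= hs4.2 // inE.
  have [] := step a b (enter y b s4) am bn hs5.
  + rewrite /= (negbTE xy) /= hs4.1 ?inE ?(negbTE xy) //=.
    by rewrite eqxx.
  + by rewrite /= eqxx.
  + by rewrite /= j1 // ltnn eqxx ltnn.
  + by move=> iy hiy; rewrite /= j2.
  move=> hix he; split=> [a' b' ha hb|iy hiy].
    rewrite [LHS]/= hix eqxx /=; have [gE|gN] := eqVneq (g a' b') (g a b).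
      by have [-> ->] := g_inj _ _ _ _ gE ha hb am bn; rewrite eqxx ltnSn orbT he.
    rewrite j1 //; case: (ltnP a' a) => //= _; case: (eqVneq a' a) => //= aE.
    case: (eqVneq b' b) => [bE|bE]; first by rewrite aE bE eqxx in gN.
    by rewrite [in RHS]ltnS [in RHS]leq_eqVlt (negbTE bE).
  rewrite [LHS]/= hix (_ : (iy == _) = false) ?andbF ?j2 //.
  by apply/eqP; apply: hiy.
move=> l1 l2; split=> // a' b ha hb; rewrite l1 // hb andbT.
by rewrite [in RHS]ltnS [in RHS]leq_eqVlt orbC.
Qed.

Lemma run_sum2 x y e1 e2 A e s m n (f : nat -> nat -> R) :
  x != y -> neval s e1 = m ->
  (forall s', same_off [:: x; y] [:: A] s s' -> neval s' e2 = n) ->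
  (forall a b s', (a < m)%N -> (b < n)%N -> same_off [:: x; y] [:: A] s s' ->
     nmem s' x [::] = a -> nmem s' y [::] = b -> reval s' e = f a b) ->
  rmem (exec (Seq (RSet A [::] (RNat (NConst 0)))
    (For x e1 (For y e2 (RSet A [::] (RAdd (RGet A [::]) e))))) s) A [::] =
  \sum_(a < m) \sum_(b < n) f a b.
Proof.
move=> xy he1 he2 step.
set s0 := exec (RSet A [::] (RNat (NConst 0))) s.
set loop := For x e1 _; rewrite -[exec _ _]/(exec loop s0).
have hs0 : same_off [:: x; y] [:: A] s s0.
  split=> // b; rewrite inE => /negbTE bA; apply/funext => iy.
  by rewrite /s0 /= bA.
have he1' : neval s0 e1 = m.
  by rewrite -he1 (nval_agree (nm := nmem s)) // -(nval_agree (s := s)).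
apply: (@run_for_frame_ind x e1 _ s0 m (fun k s' => rmem s' A [::] =
   \sum_(a < k) \sum_(b < n) f a b) he1').
  by rewrite big_ord0 /= eqxx.
move=> a s2 am hs2 i1.
have hs3 : same_off [:: x; y] [:: A] s (enter x a s2).
  apply: same_off_trans hs0 _; apply: same_off_trans hs2 _; split=> // b.
  rewrite /= !inE negb_or => /andP[/negbTE bx _].
  by apply/funext => iy; rewrite /= bx.
rewrite [RHS]big_ord_recr [RHS]/= -i1.
apply: (@run_for_frame_ind y e2 _ (enter x a s2) n (fun k s' => rmem s' A [::] =
   rmem s2 A [::] + \sum_(b < k) f a b) (he2 _ hs3)).
  by rewrite big_ord0 addr0.
move=> b s4 bn hs4 j1.
have hs5 : same_off [:: x; y] [:: A] s (enter y b s4).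
  apply: same_off_trans hs3 _; split=> c; rewrite /= !inE => hc.
    move: (hc); rewrite negb_or => /andP[_ /negbTE cy].
    apply/funext => iy; rewrite /= cy -/(nmem (enter x a s2) c iy) hs4.1 //.
    by rewrite inE cy.
  by rewrite /= hs4.2 // inE.
have := step a b (enter y b s4) am bn hs5; rewrite {1 2}/enter [X in X -> _]/=.
rewrite (negbTE xy) hs4.1 ?inE ?(negbTE xy) // => he.
rewrite big_ord_recr /= !eqxx /= addrA -j1 -he //=; by rewrite !eqxx.
Qed.

End Machine.

(** * The program *)

Section Program.

(* Integer arrays: 5 strides of the linear order, 6 powers of 2, 7 the values
   up_log 2 (I k), 12 the part of the linear index contributed by the modes already
   chosen, 13 and 14 position and candidate of the binary search.  Real arrays:
   3 [k; t; c; e] is the Gram matrix of the first t rows of factor k, 4 [m; c; e]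
   the Hadamard product of the Gram matrices of the modes below m other than j,
   6 the pseudoinverse of the design's Gram matrix, 7 the sum of the leverage
   scores, 8 and 9 the sketched normal equations, 10 the product of the factor rows
   already chosen, 11 the draw minus the cumulative weight already passed. *)
Local Notation vround := 20%N. Local Notation vj := 21%N. Local Notation vs := 22%N.
Local Notation vx := 23%N. Local Notation vl := 24%N. Local Notation va := 25%N.
Local Notation vc := 26%N. Local Notation ve := 27%N. Local Notation vk := 28%N.
Local Notation vo := 29%N.

Definition nv (x : nat) : nexp := NGet x [::].
Definition rv (x : nat) : rexp := RGet x [::].
Definition seqs (l : seq cmd) : cmd := foldr Seq Skip l.
Definition eN := nv 0. Definition eR := nv 1. Definition eJ := nv 2.
Definition eIt := nv 3.
Definition eDim (k : nexp) := NGet 4 [:: k].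
Definition eStride (k : nexp) := NGet 5 [:: k].
Definition eLog (k : nexp) := NGet 7 [:: k].
Definition rU (k a c : nexp) := RGet 1 [:: k; a; c].
Definition rP (k t c d : nexp) := RGet 3 [:: k; t; c; d].
Definition rH (m c d : nexp) := RGet 4 [:: m; c; d].

Definition sum2 (A x y : nat) (e1 e2 : nexp) (e : rexp) : cmd :=
  Seq (RSet A [::] (RNat (NConst 0)))
    (For x e1 (For y e2 (RSet A [::] (RAdd (RGet A [::]) e)))).
Definition fill2 (A x y : nat) (e1 e2 : nexp) (ix : seq nexp) (e : rexp) : cmd :=
  For x e1 (For y e2 (RSet A ix e)).

Definition eqn (e1 e2 : nexp) : bexp := BAnd (NLe e1 e2) (NLe e2 e1).

Definition strides_cmd : cmd :=
  seqs [:: NSet 8 [::] (NConst 1);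
    For vk eN (Seq (NSet 5 [:: nv vk] (nv 8))
                   (NSet 8 [::] (NMul (nv 8) (eDim (nv vk)))))].

(** With no logarithm on the machine, powers of two are doubled while below the dimension. The loop
    makes [I k] passes, a bound known in advance; passes after the last doubling do nothing. *)
Definition logs_cmd : cmd :=
  For vk eN (seqs [:: NSet 7 [:: nv vk] (NConst 0); NSet 8 [::] (NConst 1);
    For vx (eDim (nv vk))
      (If (NLe (NAdd (nv 8) (NConst 1)) (eDim (nv vk)))
        (seqs [:: NSet 6 [:: eLog (nv vk)] (nv 8);
                  NSet 7 [:: nv vk] (NAdd (eLog (nv vk)) (NConst 1));
                  NSet 8 [::] (NAdd (nv 8) (nv 8))])
        Skip)]).

(** The argument names the cell holding the mode: [vk] during initialization, [vj] after a solve.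
    Storing all prefixes costs the same [I_j r^2] as one full Gram matrix. *)
Definition grams_cmd (k : nat) : cmd :=
  Seq (fill2 3 vc ve eR eR [:: nv k; NConst 0; nv vc; nv ve] (RNat (NConst 0)))
    (For va (eDim (nv k))
      (fill2 3 vc ve eR eR [:: nv k; NAdd (nv va) (NConst 1); nv vc; nv ve]
        (RAdd (rP (nv k) (nv va) (nv vc) (nv ve))
              (RMul (rU (nv k) (nv va) (nv vc)) (rU (nv k) (nv va) (nv ve)))))).

Definition init_cmd : cmd :=
  seqs [:: strides_cmd; logs_cmd; For vk eN (grams_cmd vk)].

Definition hadamard_cmd : cmd :=
  Seq (fill2 4 vc ve eR eR [:: NConst 0; nv vc; nv ve] (RNat (NConst 1)))
    (For vx eN
      (If (eqn (nv vx) (nv vj))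
        (fill2 4 vc ve eR eR [:: NAdd (nv vx) (NConst 1); nv vc; nv ve]
          (rH (nv vx) (nv vc) (nv ve)))
        (fill2 4 vc ve eR eR [:: NAdd (nv vx) (NConst 1); nv vc; nv ve]
          (RMul (rH (nv vx) (nv vc) (nv ve))
                (rP (nv vx) (eDim (nv vx)) (nv vc) (nv ve)))))).

Definition setup_cmd : cmd :=
  seqs [:: hadamard_cmd;
    fill2 5 vc ve eR eR [:: nv vc; nv ve] (rH eN (nv vc) (nv ve));
    Pinv 6 5 eR;
    sum2 7 vc ve eR eR (RMul (RGet 6 [:: nv vc; nv ve]) (RGet 5 [:: nv vc; nv ve]));
    fill2 8 vc ve eR eR [:: nv vc; nv ve] (RNat (NConst 0));
    fill2 9 vc va eR (eDim (nv vj)) [:: nv vc; nv va] (RNat (NConst 0))].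

(** The loop counter runs upward while the modes are chosen from the last, most significant one
    downward. *)
Definition eMode : nexp := NSub (NSub eN (NConst 1)) (nv vx).

Definition rCum (t : nexp) : rexp :=
  RMul (RMul (RGet 6 [:: nv vc; nv ve]) (rH eMode (nv vc) (nv ve)))
    (RMul (RMul (RGet 10 [:: nv vc]) (RGet 10 [:: nv ve])) (rP eMode t (nv vc) (nv ve))).

(** The position is built from its highest binary digit down. The number of passes is looked up, not
    decided by comparisons of reals. For a candidate past the end of the mode the computed weight is
    meaningless, and the index test rejects it. *)
Definition search_cmd : cmd :=
  Seq (NSet 13 [::] (NConst 0))
    (For vl (eLog eMode)
      (seqs [:: NSet 14 [::] (NAdd (nv 13)
                 (NGet 6 [:: NSub (NSub (eLog eMode) (NConst 1)) (nv vl)]));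
        sum2 12 vc ve eR eR (rCum (nv 14));
        If (BAnd (NLe (NAdd (nv 14) (NConst 1)) (eDim eMode)) (RLe (rv 12) (rv 11)))
          (NSet 13 [::] (nv 14)) Skip])).

Definition descend_cmd : cmd :=
  For vx eN
    (If (eqn eMode (nv vj)) Skip
      (seqs [:: search_cmd;
        sum2 12 vc ve eR eR (rCum (nv 13));
        RSet 11 [::] (RSub (rv 11) (rv 12));
        fill2 10 vo vc (NConst 1) eR [:: nv vc]
          (RMul (RGet 10 [:: nv vc]) (rU eMode (nv 13) (nv vc)));
        NSet 12 [::] (NAdd (nv 12) (NMul (nv 13) (eStride eMode)))])).

(** Numbers 12 and 13 name both integer cells (offset, position) and real cells (leverage score,
    weight). The weight is total over [J] times score, that is [1/(J q)]. Only the mode-[j] fibre of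
    the tensor through the sampled row is read, at cost [r I_j]. *)
Definition sample_cmd : cmd :=
  seqs [:: fill2 10 vo vc (NConst 1) eR [:: nv vc] (RNat (NConst 1));
    Draw 11 [::];
    RSet 11 [::] (RMul (rv 11) (rv 7));
    NSet 12 [::] (NConst 0);
    descend_cmd;
    sum2 12 vc ve eR eR (RMul (RGet 6 [:: nv vc; nv ve])
      (RMul (RGet 10 [:: nv vc]) (RGet 10 [:: nv ve])));
    RSet 13 [::] (RDiv (rv 7) (RMul (RNat eJ) (rv 12)));
    fill2 8 vc ve eR eR [:: nv vc; nv ve] (RAdd (RGet 8 [:: nv vc; nv ve])
      (RMul (rv 13) (RMul (RGet 10 [:: nv vc]) (RGet 10 [:: nv ve]))));
    fill2 9 vc va eR (eDim (nv vj)) [:: nv vc; nv va]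
      (RAdd (RGet 9 [:: nv vc; nv va])
        (RMul (rv 13) (RMul (RGet 10 [:: nv vc])
          (RGet 0 [:: NAdd (nv 12) (NMul (nv va) (eStride (nv vj)))]))))].

Definition factor_cmd : cmd :=
  seqs [:: Pinv 14 8 eR;
    fill2 1 va vc (eDim (nv vj)) eR [:: nv vj; nv va; nv vc] (RNat (NConst 0));
    For vx eR (fill2 1 va vc (eDim (nv vj)) eR [:: nv vj; nv va; nv vc]
      (RAdd (rU (nv vj) (nv va) (nv vc))
        (RMul (RGet 14 [:: nv vc; nv vx]) (RGet 9 [:: nv vx; nv va]))));
    fill2 2 vo vc (NConst 1) eR [:: nv vc] (RNat (NConst 0));
    For va (eDim (nv vj)) (fill2 2 vo vc (NConst 1) eR [:: nv vc]
      (RAdd (RGet 2 [:: nv vc])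
        (RMul (rU (nv vj) (nv va) (nv vc)) (rU (nv vj) (nv va) (nv vc)))));
    fill2 2 vo vc (NConst 1) eR [:: nv vc] (RSqrt (RGet 2 [:: nv vc]));
    fill2 1 va vc (eDim (nv vj)) eR [:: nv vj; nv va; nv vc]
      (RDiv (rU (nv vj) (nv va) (nv vc)) (RGet 2 [:: nv vc]));
    grams_cmd vj].

Definition solve_cmd : cmd :=
  seqs [:: setup_cmd; For vs eJ sample_cmd; factor_cmd].

Definition als_cmd : cmd :=
  Seq init_cmd (For vround eIt (For vj eN solve_cmd)).

End Program.

(** * Running time of the program *)

Section TimeBounds.
Local Open Scope nat_scope.
Variables (N r J it : nat) (d L : nat -> nat).
Hypotheses (N_gt0 : 0 < N) (r_gt0 : 0 < r) (J_gt0 : 0 < J) (it_gt0 : 0 < it).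
Hypothesis d_gt0 : forall k, k < N -> 0 < d k.

Definition env_ok (nm : nenv) : Prop :=
  [/\ [/\ nm 0 [::] = N, nm 1 [::] = r, nm 2 [::] = J & nm 3 [::] = it],
      forall k, k < N -> nm 4 [:: k] = d k
    & forall k, k < N -> nm 7 [:: k] = L k].

Lemma env_ok_upd nm x k : 7 < x -> env_ok nm -> env_ok (nupd nm x k).
Proof.
move=> x7; have h b : b <= 7 -> nupd nm x k b = nm b.
  by move=> b7; apply/funext => iy; rewrite /nupd ltn_eqF // (leq_ltn_trans b7).
by move=> [[? ? ? ?] ? ?]; split; [split|..]; rewrite ?h //; move=> a ha; rewrite h //; auto.
Qed.

Lemma leq_mul_size m n : 0 < m -> 0 < n -> m.+1 * n.+1 <= 4 * (m * n).
Proof. nia. Qed.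

(** The loop headers are absorbed by [(m + 1)(n + 1) <= 4 m n], the origin of the factor 4. *)
Lemma time_fill2 nm A x y e1 e2 ix e m n K :
  nval nm e1 = m -> (forall k, nval (nupd nm x k) e2 = n) -> 0 < m -> 0 < n ->
  4 * (5 + ncost e1 + ncost e2 + ixcost ix + rcost e) <= K ->
  time_bound nm (fill2 A x y e1 e2 ix e) <= K * (m * n).
Proof.
move=> h1 h2 m0 n0 hK.
apply: (@leq_trans ((5 + ncost e1 + ncost e2 + ixcost ix + rcost e) * (m.+1 * n.+1))); last first.
  have := leq_mul_size m0 n0; move: hK; nia.
rewrite /= h1; under eq_bigr do rewrite h2 sum_nat_const card_ord.
rewrite sum_nat_const card_ord; nia.
Qed.

Lemma time_sum2 nm A x y e1 e2 e m n K :
  nval nm e1 = m -> (forall k, nval (nupd nm x k) e2 = n) -> 0 < m -> 0 < n ->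
  4 * (12 + ncost e1 + ncost e2 + rcost e) <= K ->
  time_bound nm (sum2 A x y e1 e2 e) <= K * (m * n).
Proof.
move=> h1 h2 m0 n0 hK.
apply: (@leq_trans ((12 + ncost e1 + ncost e2 + rcost e) * (m.+1 * n.+1))); last first.
  have := leq_mul_size m0 n0; move: hK; nia.
rewrite /= h1; under eq_bigr do rewrite h2 sum_nat_const card_ord.
rewrite sum_nat_const card_ord /ixcost /=; nia.
Qed.

Lemma time_for nm x e c m B :
  nval nm e = m -> (forall k, k < m -> time_bound (nupd nm x k) c <= B) ->
  time_bound nm (For x e c) <= 1 + ncost e + m * (1 + B).
Proof.
move=> hm hB; rewrite /= hm leq_add2l -[m in m * _]card_ord -sum_nat_const.
by apply: leq_sum => k _; rewrite leq_add2l hB.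
Qed.

Lemma time_for_sum nm x e c m (B : nat -> nat) :
  nval nm e = m -> (forall k, k < m -> time_bound (nupd nm x k) c <= B k) ->
  time_bound nm (For x e c) <= 1 + ncost e + m + \sum_(k < m) B k.
Proof.
move=> hm hB; rewrite /= hm big_split /= sum1_card card_ord addnA leq_add2l.
by apply: leq_sum => k _; apply: hB.
Qed.

Lemma time_seq nm c1 c2 :
  time_bound nm (Seq c1 c2) = time_bound nm c1 + time_bound nm c2.
Proof. by []. Qed.

Lemma time_if nm b c1 c2 : time_bound nm (If b c1 c2) =
  1 + bcost b + maxn (time_bound nm c1) (time_bound nm c2).
Proof. by []. Qed.

Lemma time_seqs_cons nm c l :
  time_bound nm (seqs (c :: l)) = time_bound nm c + time_bound nm (seqs l).
Proof. by []. Qed.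

Lemma time_seqs_nil nm : time_bound nm (seqs [::]) = 1. Proof. by []. Qed.

Lemma time_grams nm k : env_ok nm -> k \in [:: 21; 28] -> nm k [::] < N ->
  time_bound nm (grams_cmd k) <= 2000 * (d (nm k [::]) * (r * r)).
Proof.
move=> ok hk kN; have [[_ hr _ _] hd _] := ok.
have dk := d_gt0 kN; have r2 : 0 < r * r by rewrite muln_gt0 r_gt0.
have h1 : time_bound nm (fill2 3 26 27 eR eR [:: nv k; NConst 0; nv 26; nv 27]
    (RNat (NConst 0))) <= 400 * (r * r).
  by apply: time_fill2.
have h2 : time_bound nm (For 25 (eDim (nv k))
      (fill2 3 26 27 eR eR [:: nv k; NAdd (nv 25) (NConst 1); nv 26; nv 27]
        (RAdd (rP (nv k) (nv 25) (nv 26) (nv 27))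
              (RMul (rU (nv k) (nv 25) (nv 26)) (rU (nv k) (nv 25) (nv 27)))))) <=
    1 + ncost (eDim (nv k)) + d (nm k [::]) * (1 + 400 * (r * r)).
  by apply: time_for => [|a _]; [apply: hd | apply: time_fill2].
rewrite /grams_cmd time_seq; apply: leq_trans (leq_add h1 h2) _; rewrite [ncost _]/=; nia.
Qed.

Lemma time_hadamard nm : env_ok nm ->
  time_bound nm hadamard_cmd <= 2000 * (N * (r * r)).
Proof.
move=> ok; have [[hN hr _ _] hd _] := ok.
have r2 : 0 < r * r by rewrite muln_gt0 r_gt0.
rewrite /hadamard_cmd time_seq; apply: leq_trans (leq_add (_ : _ <= 400 * (r * r))
  (_ : _ <= 1 + ncost eN + N * (1 + 500 * (r * r)))) _.
- by apply: time_fill2.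
- apply: time_for => // x xN.
  rewrite time_if; apply: (@leq_trans (20 + 400 * (r * r))); last by nia.
  by apply: leq_add => //; rewrite geq_max; apply/andP; split; apply: time_fill2.
by rewrite [ncost _]/=; nia.
Qed.

Lemma time_pinv nm a b : env_ok nm -> time_bound nm (Pinv a b eR) <= 4 * (r * (r * r)).
Proof.
move=> [[_ hr _ _] _ _]; rewrite /= hr !expnS expn0 muln1 /ixcost /=.
have : 0 < r * (r * r) by rewrite !muln_gt0 r_gt0.
lia.
Qed.

Lemma time_setup nm : env_ok nm -> nm 21 [::] < N ->
  time_bound nm setup_cmd <= 5000 * (N * (r * (r * r)) + d (nm 21 [::]) * (r * r)).
Proof.
move=> ok jN; have [[hN hr _ _] hd _] := ok; have dj := d_gt0 jN.
have r2 : 0 < r * r by rewrite muln_gt0 r_gt0.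
rewrite /setup_cmd !time_seqs_cons time_seqs_nil.
set D := d _ in dj *.
apply: leq_trans (leq_add (time_hadamard ok) (leq_add (_ : _ <= 400 * (r * r))
  (leq_add (time_pinv 6 5 ok) (leq_add (_ : _ <= 400 * (r * r)) (leq_add (_ : _ <= 400 * (r * r))
  (leq_add (_ : _ <= 400 * (r * D)) (leqnn 1))))))) _.
- by apply: time_fill2.
- by apply: time_sum2.
- by apply: time_fill2.
- by apply: time_fill2 => // k; apply: hd.
have a1 : r * r <= r * (r * r) by rewrite leq_pmull.
have a2 : r * (r * r) <= N * (r * (r * r)) by rewrite leq_pmull.
have a3 : N * (r * r) <= N * (r * (r * r)) by rewrite leq_pmul2l.
have a4 : r * D <= D * (r * r) by rewrite mulnC leq_pmul2l // leq_pmull.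
have a5 : 0 < r * r by [].
lia.
Qed.

Lemma time_search nm : env_ok nm -> nm 23 [::] < N ->
  time_bound nm search_cmd <= 1000 * ((L (N - 1 - nm 23 [::])).+1 * (r * r)).
Proof.
move=> ok xN; have [[hN hr _ _] hd hL] := ok.
have r2 : 0 < r * r by rewrite muln_gt0 r_gt0.
rewrite /search_cmd time_seq; apply: leq_trans (leq_add (_ : _ <= 10)
  (_ : _ <= 1 + ncost (eLog eMode) + L (N - 1 - nm 23 [::]) * (1 + 800 * (r * r)))) _.
- by [].
- apply: time_for => [|l lL].
    by rewrite /= hN hL // -subnDA add1n ltn_subrL.
  rewrite !time_seqs_cons time_seqs_nil.
  apply: leq_trans (leq_add (_ : _ <= 50) (leq_add (_ : _ <= 600 * (r * r))
    (leq_add (_ : _ <= 50) (leqnn _)))) _; last by nia.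
  + by [].
  + by apply: time_sum2.
  by [].
by rewrite [ncost _]/=; nia.
Qed.

Lemma time_descend nm : env_ok nm ->
  time_bound nm descend_cmd <= 4000 * (\sum_(m < N) (L m).+1 * (r * r)).
Proof.
move=> ok; have [[hN hr _ _] hd hL] := ok.
have r2 : 0 < r * r by rewrite muln_gt0 r_gt0.
have rr : r <= r * r by rewrite leq_pmulr.
apply: leq_trans (_ : 1 + ncost eN + N + \sum_(x < N) 3000 * ((L (N - 1 - x)).+1 * (r * r)) <= _).
  apply: (time_for_sum (B := fun x => 3000 * ((L (N - 1 - x)).+1 * (r * r)))) => // x xN.
  set nm' := nupd nm 23 x.
  have ok' : env_ok nm' by apply: env_ok_upd.
  have hs := @time_search nm' ok' xN; rewrite [nm' 23 _]/= in hs.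
  rewrite time_if !time_seqs_cons time_seqs_nil.
  have h2 : time_bound nm' (sum2 12 26 27 eR eR (rCum (nv 13))) <= 600 * (r * r).
    by apply: time_sum2.
  have h3 : time_bound nm' (RSet 11 [::] (RSub (rv 11) (rv 12))) <= 20 by [].
  have h4 : time_bound nm' (fill2 10 29 26 (NConst 1) eR [:: nv 26]
     (RMul (RGet 10 [:: nv 26]) (rU eMode (nv 13) (nv 26)))) <= 400 * (1 * r).
    by apply: time_fill2.
  have h5 : time_bound nm' (NSet 12 [::] (NAdd (nv 12) (NMul (nv 13) (eStride eMode)))) <= 50.
    by [].
  move: hs h2 h3 h4 h5; set t1 := time_bound _ _; set t2 := time_bound _ _.
  set t3 := time_bound _ _; set t4 := time_bound _ _; set t5 := time_bound _ _.
  set l := L _ => h1 h2 h3 h4 h5; rewrite [bcost _]/=.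
  have l2 : l * (r * r) + r * r = l.+1 * (r * r) by rewrite mulSn addnC.
  have : 6 + (t1 + (t2 + (t3 + (t4 + (t5 + 1))))) <= 2500 * (l.+1 * (r * r)) by lia.
  by case: (leqP 1 (t1 + (t2 + (t3 + (t4 + (t5 + 1)))))); lia.
rewrite (reindex_inj rev_ord_inj) /= -big_distrr /=.
have -> : \sum_(x < N) (L (N - 1 - (N - x.+1))).+1 * (r * r) =
          \sum_(m < N) (L m).+1 * (r * r).
  apply: eq_bigr => x _; congr ((L _).+1 * _); have := ltn_ord x; lia.
have : N <= \sum_(m < N) (L m).+1 * (r * r).
  rewrite -[X in X <= _]card_ord -sum1_card; apply: leq_sum => m _.
  by rewrite muln_gt0.
move: (\sum_(m < N) _) N_gt0 => S; lia.
Qed.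

Lemma time_sample nm : env_ok nm -> nm 21 [::] < N ->
  time_bound nm sample_cmd <=
  (60 * 100) * (\sum_(m < N) (L m).+1 * (r * r) + r * d (nm 21 [::])).
Proof.
move=> ok jN; have [[hN hr _ _] hd hL] := ok; have dj := d_gt0 jN.
have r2 : 0 < r * r by rewrite muln_gt0 r_gt0.
have rr : r <= r * r by rewrite leq_pmulr.
have rN : r * r <= \sum_(m < N) (L m).+1 * (r * r).
  apply: leq_trans (_ : (L (Ordinal N_gt0)).+1 * (r * r) <= _); first by rewrite leq_pmull.
  by rewrite (bigD1 (Ordinal N_gt0)) //= leq_addr.
rewrite /sample_cmd !time_seqs_cons time_seqs_nil.
apply: leq_trans (leq_add (_ : _ <= 400 * (1 * r)) (leq_add (_ : _ <= 10) (leq_add (_ : _ <= 10)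
  (leq_add (_ : _ <= 10) (leq_add (time_descend ok) (leq_add (_ : _ <= 600 * (r * r))
  (leq_add (_ : _ <= 20) (leq_add (_ : _ <= 400 * (r * r))
  (leq_add (_ : _ <= 400 * (r * d (nm 21 [::]))) (leqnn 1)))))))))) _ => //.
- by apply: time_fill2.
- by apply: time_sum2.
- by apply: time_fill2.
- by apply: time_fill2 => // k; apply: hd.
have a4 : r <= r * d (nm 21 [::]) by rewrite leq_pmulr.
move: (\sum_(m < N) _) (d _) rN dj a4 => S D; lia.
Qed.

Lemma time_factor nm : env_ok nm -> nm 21 [::] < N ->
  time_bound nm factor_cmd <=
  (80 * 100) * (r * (r * r) + d (nm 21 [::]) * (r * r)).
Proof.
move=> ok jN; have [[hN hr _ _] hd hL] := ok; have dj := d_gt0 jN.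
have r2 : 0 < r * r by rewrite muln_gt0 r_gt0.
have rr : r <= r * r by rewrite leq_pmulr.
have hdj := hd _ jN; have hg := @time_grams nm 21 ok isT jN.
rewrite /factor_cmd !time_seqs_cons time_seqs_nil.
have h1 := time_pinv 14 8 ok.
have fill1 e : rcost e <= 80 -> time_bound nm (fill2 1 25 26 (eDim (nv 21)) eR [:: nv 21; nv 25; nv 26] e)
  <= 400 * (d (nm 21 [::]) * r).
  by move=> he; apply: time_fill2 => //; move: he; rewrite /ixcost /=; lia.
have fill2' nm' e : env_ok nm' -> rcost e <= 80 ->
  time_bound nm' (fill2 2 29 26 (NConst 1) eR [:: nv 26] e) <= 400 * (1 * r).
  move=> [[_ hr' _ _] _ _] he; apply: time_fill2 => //; move: he; rewrite /ixcost /=; lia.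
have h2 := fill1 (RNat (NConst 0)) isT.
have h3 : time_bound nm (For 23 eR (fill2 1 25 26 (eDim (nv 21)) eR [:: nv 21; nv 25; nv 26]
      (RAdd (rU (nv 21) (nv 25) (nv 26))
        (RMul (RGet 14 [:: nv 26; nv 23]) (RGet 9 [:: nv 23; nv 25]))))) <=
   1 + ncost eR + r * (1 + 400 * (d (nm 21 [::]) * r)).
  by apply: time_for => // x _; apply: time_fill2.
have h4 := fill2' nm (RNat (NConst 0)) ok isT.
have h5 : time_bound nm (For 25 (eDim (nv 21)) (fill2 2 29 26 (NConst 1) eR [:: nv 26]
      (RAdd (RGet 2 [:: nv 26])
        (RMul (rU (nv 21) (nv 25) (nv 26)) (rU (nv 21) (nv 25) (nv 26)))))) <=
   1 + ncost (eDim (nv 21)) + d (nm 21 [::]) * (1 + 400 * (1 * r)).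
  by apply: time_for => // x _; apply: fill2' => //; apply: env_ok_upd.
have h6 := fill2' nm (RSqrt (RGet 2 [:: nv 26])) ok isT.
have h7 := fill1 (RDiv (rU (nv 21) (nv 25) (nv 26)) (RGet 2 [:: nv 26])) isT.
move: h1 h2 h3 h4 h5 h6 h7 hg.
move: (time_bound _ _) (time_bound _ _) (time_bound _ _) (time_bound _ _) => t1 t2 t3 t4.
move: (time_bound _ _) (time_bound _ _) (time_bound _ _) (time_bound _ _) => t5 t6 t7 t8.
rewrite [ncost eR]/= [ncost (eDim _)]/=; move: (d _) dj => D dj.
have a1 : r <= D * (r * r) by rewrite (leq_trans rr) // leq_pmull.
have a2 : D * r <= D * (r * r) by rewrite leq_pmul2l.
have a3 : r * (D * r) = D * (r * r) by rewrite mulnCA.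
have a4 : D <= D * (r * r) by rewrite leq_pmulr.
clear -a1 a2 a4 dj; lia.
Qed.

(** In this order: Hadamard products and pseudoinverses; [J] descents through all modes; [J] updates
    of the right-hand side; the new factor with its norms and prefix Gram matrices. *)
Definition solve_time (j : nat) : nat :=
  N * (r * (r * r)) + J * (\sum_(m < N) (L m).+1 * (r * r)) + J * (r * d j) + d j * (r * r).

Lemma time_solve nm : env_ok nm -> nm 21 [::] < N ->
  time_bound nm solve_cmd <= (200 * 100) * solve_time (nm 21 [::]).
Proof.
move=> ok jN; have [[_ _ hJ _] _ _] := ok.
have h1 := time_setup ok jN; have h3 := time_factor ok jN.
have h2 : time_bound nm (For 22 eJ sample_cmd) <= 1 + ncost eJ + J * (1 +
   (60 * 100) * (\sum_(m < N) (L m).+1 * (r * r) + r * d (nm 21 [::]))).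
  apply: time_for => // s _.
  by have := @time_sample (nupd nm 22 s) (env_ok_upd _ _ ok) jN; apply.
have -> : time_bound nm solve_cmd = time_bound nm setup_cmd +
  (time_bound nm (For 22 eJ sample_cmd) + (time_bound nm factor_cmd + 1)) by [].
rewrite /solve_time.
have a1 : r * (r * r) <= N * (r * (r * r)) by rewrite leq_pmull.
have a2 : 0 < r * (r * r) by rewrite !muln_gt0 r_gt0.
have a3 : J <= J * (r * d (nm 21 [::])) by rewrite leq_pmulr // muln_gt0 r_gt0 d_gt0.
move: h1 h2 h3; rewrite [ncost _]/=.
move: (time_bound _ _) (time_bound _ _) (time_bound _ _) => t1 t2 t3.
move: (\sum_(m < N) _) (d _) a3 => S D a3; clear -a1 a2 a3; lia.
Qed.

Lemma time_init nm : env_ok nm ->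
  time_bound nm init_cmd <= 4000 * \sum_(j < N) d j * (r * r).
Proof.
move=> ok; have [[hN hr _ _] hd _] := ok.
have r2 : 0 < r * r by rewrite muln_gt0 r_gt0.
have -> : time_bound nm init_cmd = time_bound nm strides_cmd +
  (time_bound nm logs_cmd + (time_bound nm (For 28 eN (grams_cmd 28)) + 1)) by [].
have h1 : time_bound nm strides_cmd <= 20 + N * 40.
  rewrite /strides_cmd !time_seqs_cons time_seqs_nil.
  have := @time_for nm 28 eN (Seq (NSet 5 [:: nv 28] (nv 8))
    (NSet 8 [::] (NMul (nv 8) (eDim (nv 28))))) N 39 hN (fun _ _ => isT).
  have -> : time_bound nm (NSet 8 [::] (NConst 1)) = 2 by [].
  by rewrite [ncost _]/=; move: (time_bound _ _) => t; lia.
have h2 : time_bound nm logs_cmd <= 1 + ncost eN + N + \sum_(k < N) 200 * d k.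
  apply: (time_for_sum (B := fun k => 200 * d k)) => // k kN.
  rewrite !time_seqs_cons time_seqs_nil.
  set body := If _ _ _.
  have := @time_for (nupd nm 28 k) 23 (eDim (nv 28)) body (d k) 100 (hd _ kN) (fun _ _ => isT).
  have -> : time_bound (nupd nm 28 k) (NSet 7 [:: nv 28] (NConst 0)) = 3 by [].
  have -> : time_bound (nupd nm 28 k) (NSet 8 [::] (NConst 1)) = 2 by [].
  rewrite [ncost _]/=; by have := d_gt0 kN; move: (time_bound _ _) => t; lia.
have h3 : time_bound nm (For 28 eN (grams_cmd 28)) <=
   1 + ncost eN + N + \sum_(k < N) 2000 * (d k * (r * r)).
  apply: (time_for_sum (B := fun k => 2000 * (d k * (r * r)))) => // k kN.
  exact: (@time_grams (nupd nm 28 k) 28 (env_ok_upd _ _ ok) isT kN).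
have s1 : N <= \sum_(j < N) d j * (r * r).
  rewrite -[X in X <= _]card_ord -sum1_card; apply: leq_sum => m _.
  by rewrite muln_gt0 d_gt0.
have s2 : \sum_(j < N) d j <= \sum_(j < N) d j * (r * r).
  by apply: leq_sum => m _; rewrite leq_pmulr.
have e2 : \sum_(k < N) 200 * d k = 200 * \sum_(k < N) d k by rewrite big_distrr.
have e3 : \sum_(k < N) 2000 * (d k * (r * r)) = 2000 * \sum_(k < N) d k * (r * r).
  by rewrite big_distrr.
move: h1 h2 h3; rewrite e2 e3 [ncost _]/=.
move: (time_bound _ _) (time_bound _ _) (time_bound _ _) => t1 t2 t3.
move: s1 s2; move: (\sum_(j < N) d j) (\sum_(j < N) d j * _) => A B; lia.
Qed.

Lemma time_main nm : env_ok nm ->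
  time_bound nm (For 20 eIt (For 21 eN solve_cmd)) <=
  (500 * 100) * (it * \sum_(j < N) solve_time j).
Proof.
move=> ok; have [[hN hr _ hit] hd _] := ok.
have s1 : N <= \sum_(j < N) solve_time j.
  rewrite -[X in X <= _]card_ord -sum1_card; apply: leq_sum => m _.
  by rewrite /solve_time -!addnA addn_gt0 !muln_gt0 N_gt0 r_gt0.
have hB k : time_bound (nupd nm 20 k) (For 21 eN solve_cmd) <=
    1 + ncost eN + N + \sum_(j < N) 200 * 100 * solve_time j.
  apply: (time_for_sum (B := fun j => 200 * 100 * solve_time j)) => // j jN.
  have ok' : env_ok (nupd (nupd nm 20 k) 21 j) by do 2 apply: env_ok_upd => //.
  exact: (time_solve ok' jN).
have := @time_for nm 20 eIt (For 21 eN solve_cmd) it _ hit (fun k _ => hB k).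
have -> : \sum_(j < N) 200 * 100 * solve_time j = 200 * 100 * \sum_(j < N) solve_time j.
  by rewrite big_distrr.
move: (time_bound _ _) (\sum_(j < N) _) s1 => t S s1; rewrite [ncost _]/= [ncost _]/= => h.
apply: leq_trans h _; have : it * N <= it * S by rewrite leq_pmul2l.
have : it <= it * N by rewrite leq_pmulr.
clear -it_gt0; lia.
Qed.

End TimeBounds.

(** * Rows of Khatri-Rao products *)

Lemma big_ltS (V : Type) (idx : V) (op : Monoid.com_law idx) m (F : 'I_m -> V) (t : 'I_m) :
  \big[op/idx]_(k < m | (k < t.+1)%N) F k = op (\big[op/idx]_(k < m | (k < t)%N) F k) (F t).
Proof.
rewrite (bigD1 t) ?ltnS //= Monoid.mulmC; congr (op _ _).
by apply: eq_bigl => k; rewrite ltnS -(inj_eq val_inj) /= andbC -ltn_neqAle.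
Qed.

Section KhatriRaoRows.
Variables (R : realType) (N : nat) (I : 'I_N -> nat) (r : nat).
Implicit Types (U : factors R I r) (j k : 'I_N) (i : mindex I) (s : seq 'I_N).

Definition gram_prefix U (k : 'I_N) t (c e : 'I_r) : R :=
  \sum_(a < I k | (a < t)%N) U k a c * U k a e.

Lemma gram_prefix0 U k c e : gram_prefix U k 0 c e = 0.
Proof. by rewrite /gram_prefix big_pred0. Qed.

Lemma gram_prefixS U k (a : 'I_(I k)) c e :
  gram_prefix U k a.+1 c e = gram_prefix U k a c e + U k a c * U k a e.
Proof. exact: big_ltS. Qed.

Definition hadam U (j : 'I_N) (m : nat) (c e : 'I_r) : R :=
  \prod_(k < N | (k < m)%N && (k != j)) gram_prefix U k (I k) c e.

Lemma hadam0 U j c e : hadam U j 0 c e = 1.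
Proof. by rewrite /hadam big_pred0. Qed.

Lemma hadamS U j (m : 'I_N) c e : hadam U j m.+1 c e =
  if m == j then hadam U j m c e else hadam U j m c e * gram_prefix U m (I m) c e.
Proof.
have ltE (k : 'I_N) : (k < m.+1)%N = (k == m) || (k < m)%N.
  by rewrite ltnS leq_eqVlt.
rewrite /hadam; case: ifP => mj.
  apply: eq_bigl => k; rewrite ltE; case: eqP => //= ->.
  by rewrite mj ltnn.
rewrite (bigD1 m) ?ltnSn ?mj //= mulrC; congr (_ * _); apply: eq_bigl => k.
rewrite ltE; case: eqP => [->|_] /=; rewrite ?andbT //.
by rewrite ltnn andbF.
Qed.

(** The modes still to be chosen once the descent has dealt with all modes from [M] upward; they
    form a tail of [other_modes j]. *)
Definition modes_lt j (M : nat) : seq 'I_N :=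
  rev [seq k : 'I_N <- enum 'I_N | (k < M)%N && (k != j)].

Lemma other_modesE j : other_modes j = modes_lt j N.
Proof. by congr rev; apply: eq_filter => k; rewrite ltn_ord. Qed.

Lemma val_modes_lt j M : (M <= N)%N ->
  map val (modes_lt j M) = rev [seq k <- iota 0 M | k != val j].
Proof.
move=> MN; rewrite map_rev; congr rev.
transitivity [seq k <- iota 0 N | (k < M)%N && (k != val j)].
  by rewrite -val_enum_ord filter_map.
have -> : iota 0 N = iota 0 (M + (N - M)) by rewrite subnKC.
rewrite iotaD filter_cat add0n [X in _ ++ X](_ : _ = [::]) ?cats0.
  by apply: eq_in_filter => k; rewrite mem_iota add0n /= => ->.
apply/eqP; rewrite -(negbK (_ == _)) -has_filter; apply/hasPn => k.
by rewrite mem_iota => /andP[Mk _]; rewrite ltnNge Mk.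
Qed.

Lemma modes_lt0 j : modes_lt j 0 = [::].
Proof. by apply: (inj_map val_inj); rewrite val_modes_lt. Qed.

Lemma modes_ltS j (m : 'I_N) :
  modes_lt j m.+1 = if m == j then modes_lt j m else m :: modes_lt j m.
Proof.
apply: (inj_map val_inj); rewrite val_modes_lt ?ltn_ord //.
rewrite -addn1 iotaD filter_cat rev_cat /= add0n.
rewrite (inj_eq val_inj); case: eqP => _ /=; rewrite val_modes_lt // ltnW //.
Qed.

Fixpoint row_index s i : nat :=
  match s with
  | [::] => 0
  | k :: s' => (i k * kr_rows I s' + row_index s' i)%N
  end.

Lemma row_index_lt s i : (row_index s i < kr_rows I s)%N.
Proof.
elim: s => //= k s IH; apply: (@leq_trans (i k * kr_rows I s + kr_rows I s)).
  by rewrite -addnS leq_add2l.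
by rewrite -mulSnr leq_mul2r ltn_ord orbT.
Qed.

Definition row_ord s i : 'I_(kr_rows I s) := Ordinal (row_index_lt s i).

Lemma row_ord_cons k s i : row_ord (k :: s) i = mxtens_index (i k, row_ord s i).
Proof. exact: val_inj. Qed.

Lemma kr_product_row U s i c :
  kr_product U s (row_ord s i) c = \prod_(k <- s) U k (i k) c.
Proof.
elim: s => [|k s IH]; first by rewrite big_nil mxE.
by rewrite big_cons row_ord_cons /= mxE mxtens_indexK /= IH.
Qed.

Lemma sum_kr_rows k s (F : 'I_(kr_rows I (k :: s)) -> R) :
  \sum_u F u = \sum_a \sum_(u : 'I_(kr_rows I s)) F (mxtens_index (a, u)).
Proof.
rewrite pair_bigA /= (reindex (fun p : 'I_(I k) * 'I_(kr_rows I s) => mxtens_index p)).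
  by apply: eq_bigr => -[a u].
by exists (@mxtens_unindex _ _) => p _; rewrite ?mxtens_indexK ?mxtens_unindexK.
Qed.

(** Lexicographic order: an earlier row either has a smaller leading index, with its tail free, or
    the same leading index and an earlier tail. *)
Lemma sum_kr_rows_lt k s i (F : 'I_(kr_rows I (k :: s)) -> R) :
  \sum_(u : 'I_(kr_rows I (k :: s)) | (u < row_index (k :: s) i)%N) F u =
  \sum_(a < I k | (a < i k)%N) \sum_(u : 'I_(kr_rows I s)) F (mxtens_index (a, u)) +
  \sum_(u : 'I_(kr_rows I s) | (u < row_index s i)%N) F (mxtens_index (i k, u)).
Proof.
rewrite big_mkcond sum_kr_rows (bigID (fun a : 'I_(I k) => (a < i k)%N)) /=; congr (_ + _).
  apply: eq_bigr => a ai; apply: eq_bigr => u _; rewrite ifT //=.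
  apply: leq_trans (_ : a * kr_rows I s + kr_rows I s <= _)%N; first by rewrite ltn_add2l.
  by rewrite -mulSnr (leq_trans (leq_mul ai (leqnn _))) // leq_addr.
rewrite (bigD1 (i k)) ?ltnn //= [X in _ + X]big1 ?addr0.
  rewrite [RHS]big_mkcond; apply: eq_bigr => u _ /=.
  by rewrite ltn_add2l.
move=> a /andP[ai aN]; apply: big1 => u _; rewrite ifF //=; apply/negbTE.
rewrite -leqNgt; have {}ai : (i k < a)%N.
  by rewrite ltn_neqAle leqNgt ai andbT eq_sym; apply: contra aN => /eqP h; apply/eqP/val_inj.
apply: leq_trans (_ : a * kr_rows I s <= _)%N; last by rewrite leq_addr.
apply: leq_trans (leq_mul ai (leqnn _)); rewrite mulSnr leq_add2l.
exact/ltnW/row_index_lt.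
Qed.

Lemma kr_gram U s c e :
  \sum_u kr_product U s u c * kr_product U s u e =
  \prod_(k <- s) gram_prefix U k (I k) c e.
Proof.
elim: s => [|k s IH]; first by rewrite big_nil big_ord1 !mxE mulr1.
rewrite big_cons -IH sum_kr_rows big_distrl /=.
rewrite /gram_prefix; under [in RHS]eq_bigl do rewrite ltn_ord.
apply: eq_bigr => a _; rewrite big_distrr; apply: eq_bigr => u _ /=.
by rewrite !mxE mxtens_indexK /= mulrACA.
Qed.

(** A row determines a multi-index only on [s]; agreement with [i] elsewhere lets the free mode be
    prescribed. *)
Lemma row_ord_surj s (u : 'I_(kr_rows I s)) i : uniq s ->
  exists i' : mindex I, row_ord s i' = u /\ forall k, k \notin s -> i' k = i k.
Proof.
elim: s u => [|k s IH] u /=; first by exists i; split=> //; apply: val_inj; case: u => -[].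
move=> /andP[ks us]; case: (mxtens_unindex u) (mxtens_unindexK u) => a u' uE.
have [i' [i1 i2]] := IH u' us.
pose i'' : mindex I := [ffun k' => eqtype.dfwith (fun k => i' k : 'I_(I k)) a k'].
have i3 k' : k' != k -> i'' k' = i' k'.
  by move=> kk; rewrite ffunE eqtype.dfwith_out // eq_sym.
have i4 : i'' k = a by rewrite ffunE eqtype.dfwith_in.
exists i''; split; last first.
  move=> k'; rewrite inE negb_or => /andP[kk ks']; rewrite i3 // i2 //.
rewrite row_ord_cons -uE i4; congr (mxtens_index (_, _)); rewrite -i1.
apply: val_inj => /=.
have : forall s', {subset s' <= s} -> row_index s' i'' = row_index s' i'.
  elim=> //= k' s' IH' sub; rewrite IH' ?i3 //.
    by apply: contraNneq ks => <-; apply: sub; rewrite inE eqxx.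
  by move=> x xs; apply: sub; rewrite inE xs orbT.
by apply.
Qed.

Lemma row_ord_inj s i i' : row_ord s i = row_ord s i' -> {in s, forall k, i k = i' k}.
Proof.
elim: s => [|k s IH] //; rewrite !row_ord_cons => /(can_inj (@mxtens_indexK _ _)) [ik is_].
have {}IH : {in s, forall k, i k = i' k} by apply: IH; apply: val_inj.
by move=> k'; rewrite inE => /orP[/eqP->|] //; apply: IH.
Qed.

Lemma ltn_ordS (m M : 'I_N) : (m < M.+1)%N = (m == M) || (m < M)%N.
Proof. by rewrite ltnS leq_eqVlt -(inj_eq val_inj). Qed.

Lemma modes_lt_kr_rows j M : (M <= N)%N ->
  kr_rows I (modes_lt j M) = (\prod_(m < N | (m < M) && (m != j)) I m)%N.
Proof.
elim: M => [|M IH] MN; first by rewrite modes_lt0 big_pred0.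
rewrite (modes_ltS j (Ordinal MN)); case: ifP => mj.
  rewrite IH 1?ltnW //; apply: eq_bigl => m; rewrite (ltn_ordS m (Ordinal MN)).
  by case: (eqVneq m (Ordinal MN)) => [->|//]; rewrite mj !andbF.
rewrite /= IH 1?ltnW // [RHS](bigD1 (Ordinal MN)) /= ?ltnSn ?mj //; congr (_ * _)%N.
apply: eq_bigl => m; rewrite (ltn_ordS m (Ordinal MN)).
by case: (eqVneq m (Ordinal MN)) => [->|] /=; rewrite ?ltnn ?andbF ?andbT.
Qed.

Lemma row_index_modes_lt j M i : (M <= N)%N -> row_index (modes_lt j M) i =
  (\sum_(k < N | (k < M) && (k != j)) i k * \prod_(m < N | (m < k) && (m != j)) I m)%N.
Proof.
elim: M => [|M IH] MN; first by rewrite modes_lt0 big_pred0.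
rewrite (modes_ltS j (Ordinal MN)); case: ifP => mj.
  rewrite IH 1?ltnW //; apply: eq_bigl => m; rewrite (ltn_ordS m (Ordinal MN)).
  by case: (eqVneq m (Ordinal MN)) => [->|//]; rewrite mj !andbF.
rewrite /= IH 1?ltnW // [RHS](bigD1 (Ordinal MN)) /= ?ltnSn ?mj //; congr (_ * _ + _)%N.
  by rewrite modes_lt_kr_rows // ltnW.
apply: eq_bigl => m; rewrite (ltn_ordS m (Ordinal MN)).
by case: (eqVneq m (Ordinal MN)) => [->|] /=; rewrite ?ltnn ?andbF ?andbT.
Qed.

(** With the last mode most significant, the row position in the Khatri-Rao product is the
    mixed-radix number that indexes the columns of the matricization. *)
Lemma column_indexE j i : column_index j i = row_index (other_modes j) i.
Proof.
rewrite other_modesE row_index_modes_lt //; apply: eq_bigl => k.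
by rewrite ltn_ord.
Qed.

Lemma mem_other_modes j k : (k \in other_modes j) = (k != j).
Proof. by rewrite mem_rev mem_filter mem_enum andbT. Qed.

(** Whatever [pick] returns is the given multi-index: its entry [j] is prescribed, and equal column
    indices fix the others by [row_ord_inj]. *)
Lemma matricizeE (T : tensor R I) j i :
  matricize T j (i j) (row_ord (other_modes j) i) = T i.
Proof.
rewrite mxE; case: pickP => [i' /andP[/eqP ij /eqP ci]|/(_ i)]; last first.
  by rewrite column_indexE !eqxx.
congr (T _); apply/ffunP => k; have [->//|kj] := eqVneq k j.
apply: (@row_ord_inj (other_modes j)); last by rewrite mem_other_modes.
by apply: val_inj; rewrite /= -column_indexE ci.
Qed.

Definition stride (k : nat) : nat := \prod_(m < N | (m < k)%N) I m.

Lemma strideS k : stride k.+1 = (stride k * I k)%N.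
Proof. exact: big_ltS. Qed.

Lemma linear_indexE j i : linear_index i =
  (\sum_(k <- other_modes j) i k * stride k + i j * stride j)%N.
Proof.
rewrite /linear_index (bigD1 j) //= addnC; congr (_ + _)%N.
rewrite /other_modes (perm_big _ (permEl (perm_rev _))) /= big_filter.
by rewrite big_enum_cond.
Qed.

Section QuadraticRowForm.
Variables (U : factors R I r) (P : 'M[R]_r).
Hypothesis psdP : forall v : 'I_r -> R, 0 <= \sum_c \sum_e P c e * (v c * v e).
Implicit Types h : 'I_r -> R.

Definition row_form h s (u : 'I_(kr_rows I s)) : R :=
  \sum_c \sum_e P c e * ((h c * kr_product U s u c) * (h e * kr_product U s u e)).

Definition row_prefix h s n : R := \sum_(u : 'I_(kr_rows I s) | (u < n)%N) row_form h u.

Definition kr_gram_entry s c e : R := \prod_(k <- s) gram_prefix U k (I k) c e.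

(** The weight of all rows with leading index below [t] (see [cum_formE]), in the closed form that
    takes [O(r^2)] operations from the tables. The vector [h] is the product of the factor rows
    already chosen. *)
Definition cum_form h k s t : R := \sum_c \sum_e
  P c e * kr_gram_entry s c e * (h c * h e * gram_prefix U k t c e).

Definition scale_row h k (a : 'I_(I k)) : 'I_r -> R := fun c => h c * U k a c.

Lemma row_form_ge0 h s (u : 'I_(kr_rows I s)) : 0 <= row_form h u.
Proof. exact: psdP. Qed.

Lemma row_total h s : \sum_u row_form h (s := s) u =
  \sum_c \sum_e P c e * kr_gram_entry s c e * (h c * h e).
Proof.
rewrite exchange_big; apply: eq_bigr => c _; rewrite exchange_big; apply: eq_bigr => e _.
rewrite /kr_gram_entry -kr_gram mulrAC big_distrr /=; apply: eq_bigr => u _; ring.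
Qed.

Lemma row_form_mxtens h k s a (u : 'I_(kr_rows I s)) :
  row_form h (s := k :: s) (mxtens_index (a, u)) = row_form (scale_row h a) u.
Proof.
by apply: eq_bigr => c _; apply: eq_bigr => e _; rewrite /= !mxE mxtens_indexK /scale_row /= !mulrA.
Qed.

Lemma cum_formE h k s t : cum_form h k s t =
  \sum_(a < I k | (a < t)%N) \sum_u row_form (scale_row h a) (s := s) u.
Proof.
under eq_bigr do rewrite row_total.
rewrite exchange_big; apply: eq_bigr => c _; rewrite exchange_big; apply: eq_bigr => e _.
rewrite /gram_prefix !big_distrr /=; apply: eq_bigr => a _; rewrite /scale_row; ring.
Qed.

Lemma cum_form_le h k s t t' : (t <= t')%N -> cum_form h k s t <= cum_form h k s t'.
Proof.
move=> tt; rewrite !cum_formE big_mkcond [X in _ <= X]big_mkcond; apply: ler_sum => a _.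
case: ifP => [at_|_]; first by rewrite (leq_trans at_).
by case: ifP => // _; apply: sumr_ge0 => u _; apply: row_form_ge0.
Qed.

(** This recursion makes the inversion possible mode by mode: what is left after the leading mode is
    a cumulative weight of the same kind, at the rescaled vector. *)
Lemma row_prefix_cons h k s i : row_prefix h (k :: s) (row_index (k :: s) i) =
  cum_form h k s (i k) + row_prefix (scale_row h (i k)) s (row_index s i).
Proof.
rewrite /row_prefix sum_kr_rows_lt cum_formE; congr (_ + _).
  by apply: eq_bigr => a _; apply: eq_bigr => u _; rewrite row_form_mxtens.
by apply: eq_bigr => u _; rewrite row_form_mxtens.
Qed.

Lemma row_form_cons h k s i :
  row_form h (row_ord (k :: s) i) = row_form (scale_row h (i k)) (row_ord s i).
Proof. by rewrite row_ord_cons row_form_mxtens. Qed.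

Definition in_row h s i (tau : R) : Prop :=
  row_prefix h s (row_index s i) <= tau <
  row_prefix h s (row_index s i) + row_form h (row_ord s i).

Lemma row_prefix_step_le h s i :
  row_prefix h s (row_index s i) + row_form h (row_ord s i) <= \sum_u row_form h (s := s) u.
Proof.
rewrite addrC [X in _ <= X](bigD1 (row_ord s i)) //= lerD2l /row_prefix.
rewrite big_mkcond [X in _ <= X]big_mkcond; apply: ler_sum => u _.
case: ifP => [ui|_]; last by case: ifP => // _; apply: row_form_ge0.
by rewrite ifT //; apply: contraTneq ui => ->; rewrite ltnn.
Qed.

(** The cell of a row lies inside the block of rows sharing its leading index, because within the
    tail its end does not exceed the tail total. The draw thus fixes the leading index and, reduced
    by the weight passed, lies in the cell of the tail. *)
Lemma in_row_cons h k s i tau : in_row h (k :: s) i tau ->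
  cum_form h k s (i k) <= tau < cum_form h k s (i k).+1 /\
  in_row (scale_row h (i k)) s i (tau - cum_form h k s (i k)).
Proof.
rewrite /in_row row_prefix_cons row_form_cons => /andP[h1 h2].
have p0 : 0 <= row_prefix (scale_row h (i k)) s (row_index s i).
  by apply: sumr_ge0 => u _; apply: row_form_ge0.
have cS : cum_form h k s (i k).+1 = cum_form h k s (i k) +
    \sum_u row_form (scale_row h (i k)) (s := s) u.
  by rewrite !cum_formE big_ltS.
have := row_prefix_step_le (scale_row h (i k)) s i; rewrite cS => h3.
split; apply/andP; split; lra.
Qed.

End QuadraticRowForm.

Lemma design_gram U j : (design U j)^T *m design U j =
  \matrix_(c, e) kr_gram_entry U (other_modes j) c e.
Proof.
apply/matrixP => c e; rewrite !mxE /kr_gram_entry -kr_gram.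
by apply: eq_bigr => u _; rewrite !mxE.
Qed.

Lemma kr_gram_entry_modes_lt U j M c e : (M <= N)%N ->
  kr_gram_entry U (modes_lt j M) c e = hadam U j M c e.
Proof.
elim: M => [|M IH] MN; first by rewrite modes_lt0 hadam0 /kr_gram_entry big_nil.
have := hadamS U j (Ordinal MN) c e; rewrite /= => ->.
rewrite (modes_ltS j (Ordinal MN)); case: ifP => _; first by rewrite IH // ltnW.
by rewrite /kr_gram_entry big_cons mulrC -IH // ltnW.
Qed.

(** The second Penrose condition writes the pseudoinverse as [(A Z)^T (A Z)]. Nonnegativity at
    arbitrary vectors makes the cumulative weights monotone in the index, as the binary search
    requires. *)
Lemma pinv_gram_form_ge0 m (A : 'M[R]_(m, r)) (v : 'I_r -> R) :
  0 <= \sum_c \sum_e pinv (A^T *m A) c e * (v c * v e).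
Proof.
set Z := pinv _; have [_ Z2 _ _] := pinvP (A^T *m A); rewrite -/Z in Z2.
have sZ : Z^T = Z by apply: pinv_sym; apply: trmx_gram.
pose x : 'cV[R]_r := \col_c v c.
have -> : \sum_c \sum_e Z c e * (v c * v e) = qf Z x.
  rewrite /qf trace_mx11 mxE exchange_big; apply: eq_bigr => e _.
  by rewrite !mxE big_distrl; apply: eq_bigr => c _; rewrite !mxE /=; ring.
rewrite -Z2 -{1}sZ; have -> : Z^T *m (A^T *m A) *m Z = (A *m Z)^T *m (A *m Z).
  by rewrite trmx_mul !mulmxA.
by rewrite /qf mulmxA -mulmxA -trmx_mul sqn_ge0.
Qed.

Lemma leverage_row_form U j (u : 'I_(rows_but I j)) : leverage (design U j) u =
  row_form U (pinv ((design U j)^T *m design U j)) (fun _ => 1) u.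
Proof.
rewrite /leverage /row_form mxE exchange_big; apply: eq_bigr => e _.
rewrite !mxE big_distrl; apply: eq_bigr => c _; rewrite !mxE !mul1r /=; ring.
Qed.

End KhatriRaoRows.

(** * Correctness of the program *)

Section Correctness.
Variables (R : realType) (eig : eig_routine R) (us : nat -> R).
Variables (N : nat) (I : 'I_N -> nat) (r : nat) (T : tensor R I) (J it : nat).
Hypotheses (N_gt0 : (0 < N)%N) (I_gt0 : forall k, (0 < I k)%N).
Notation exec := (run eig us).
Implicit Types (s : state R) (U : factors R I r).

Lemma run_seq c1 c2 s : exec (Seq c1 c2) s = exec c2 (exec c1 s).
Proof. by []. Qed.

Lemma run_seqs_cons c l s : exec (seqs (c :: l)) s = exec (seqs l) (exec c s).
Proof. by []. Qed.

Lemma run_seqs_nil s : exec (seqs [::]) s = tick 1 s.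
Proof. by []. Qed.

Lemma run_if b c1 c2 s : exec (If b c1 c2) s =
  if beval s b then exec c1 (tick (1 + bcost b) s) else exec c2 (tick (1 + bcost b) s).
Proof. by []. Qed.

Lemma beval_eqn e1 e2 s : beval s (eqn e1 e2) = (neval s e1 == neval s e2).
Proof. by rewrite /= eqn_leq. Qed.

Lemma nmem_tick k s : nmem (tick k s) = nmem s. Proof. by []. Qed.

Lemma rmem_tick k s : rmem (tick k s) = rmem s. Proof. by []. Qed.

Lemma same_off_sub ns rs ns' rs' s s' : same_off ns rs s s' ->
  all (mem ns') ns -> all (mem rs') rs -> same_off ns' rs' s s'.
Proof.
move=> [h1 h2] /allP n1 /allP r1; split=> b hb; [apply: h1|apply: h2].
  by apply: contra hb => /n1.
by apply: contra hb => /r1.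
Qed.

Lemma same_enter ns rs s s' x k : same_off ns rs s s' -> x \in ns ->
  same_off ns rs s (enter x k s').
Proof.
move=> h xn; apply: (same_off_trans h); split=> // b hb; apply/funext => iy /=.
by case: eqP => //= bx; rewrite bx xn in hb.
Qed.

Lemma fill2_same A x y e1 e2 ix e s :
  same_off [:: x; y] [:: A] s (exec (fill2 A x y e1 e2 ix e) s).
Proof. exact: (run_same_off eig us (fill2 A x y e1 e2 ix e) s). Qed.

Lemma sum2_same A x y e1 e2 e s :
  same_off [:: x; y] [:: A] s (exec (sum2 A x y e1 e2 e) s).
Proof.
have [h1 h2] := run_same_off eig us (sum2 A x y e1 e2 e) s.
by split=> // b hb; apply: h2; move: hb; rewrite /= !inE orbb.
Qed.

Definition params s : Prop :=
  [/\ [/\ nmem s 0 [::] = N, nmem s 1 [::] = r, nmem s 2 [::] = J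
        & nmem s 3 [::] = it],
      forall k : 'I_N, nmem s 4 [:: val k] = I k
    & forall i : mindex I, rmem s 0 [:: linear_index i] = T i].

Definition tables s : Prop :=
  forall k : 'I_N, [/\ nmem s 5 [:: val k] = stride I k,
    nmem s 7 [:: val k] = up_log 2 (I k)
  & forall l, (l < up_log 2 (I k))%N -> nmem s 6 [:: l] = (2 ^ l)%N].

Definition grams U s : Prop :=
  forall (k : 'I_N) t c e, (t <= I k)%N ->
    rmem s 3 [:: val k; t; val c; val e] = gram_prefix U k t c e.

Lemma params_same ns rs s s' : same_off ns rs s s' ->
  all (fun b => 4 < b)%N ns -> 0%N \notin rs -> params s -> params s'.
Proof.
move=> [hn hr] /allP ns4 rs0 [[h0 h1 h2 h3] h4 h5].
have hb b : (b <= 4)%N -> nmem s' b = nmem s b.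
  by move=> b4; apply: hn; apply/negP => /ns4; rewrite ltnNge b4.
by split; [rewrite !hb|rewrite hb|rewrite hr].
Qed.

Lemma params_run c s : all (fun b => 4 < b)%N (nwrites c) -> 0%N \notin rwrites c ->
  params s -> params (exec c s).
Proof. by move=> h1 h2; apply: params_same (run_same_off eig us c s) _ _. Qed.

Lemma tables_same ns rs s s' : same_off ns rs s s' ->
  all (fun b => 7 < b)%N ns -> tables s -> tables s'.
Proof.
move=> [hn hr] /allP ns4 h k; have [h5 h7 h6] := h k.
have hb b : (b <= 7)%N -> nmem s' b = nmem s b.
  by move=> b4; apply: hn; apply/negP => /ns4; rewrite ltnNge b4.
by split; rewrite ?hb // => l hl; rewrite hb // h6.
Qed.

Lemma tables_run c s : all (fun b => 7 < b)%N (nwrites c) -> tables s -> tables (exec c s).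
Proof. by move=> h1; apply: tables_same (run_same_off eig us c s) _. Qed.

(** * Tables computed before the first solve *)

Lemma strides_cmd_ok s : params s -> forall k : 'I_N,
  nmem (exec strides_cmd s) 5 [:: val k] = stride I k.
Proof.
move=> hp; set s1 := exec (NSet 8 [::] (NConst 1)) s.
have hp1 : params s1 by apply: params_run.
have [[hN _ _ _] _ _] := hp1.
suff h : nmem (exec (For 28 eN (Seq (NSet 5 [:: nv 28] (nv 8))
    (NSet 8 [::] (NMul (nv 8) (eDim (nv 28)))))) s1) 8 [::] = stride I N /\
    forall k : 'I_N, (k < N)%N -> nmem (exec (For 28 eN (Seq (NSet 5 [:: nv 28] (nv 8))
    (NSet 8 [::] (NMul (nv 8) (eDim (nv 28)))))) s1) 5 [:: val k] = stride I k.
  by move=> k; rewrite -h.2.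
apply: (@run_for_frame_ind R eig us 28 eN _ s1 N (fun n s' => nmem s' 8 [::] = stride I n /\
  forall k : 'I_N, (k < n)%N -> nmem s' 5 [:: val k] = stride I k)) => //.
  by split=> //=; rewrite /stride big_pred0.
move=> n s' nN hs [h8 h5]; have [_ hd _] := params_same hs isT isT hp1.
split=> [|k]; rewrite /= ?h8; first by rewrite (hd (Ordinal nN)) (strideS I (Ordinal nN)).
rewrite ltnS leq_eqVlt => /orP[/eqP->|kn]; first by rewrite eqxx.
by rewrite eqseq_cons andbT (ltn_eqF kn) h5.
Qed.

Lemma logs_cmd_ok s : params s -> forall k : 'I_N,
  nmem (exec logs_cmd s) 7 [:: val k] = up_log 2 (I k) /\
  forall l, (l < up_log 2 (I k))%N -> nmem (exec logs_cmd s) 6 [:: l] = (2 ^ l)%N.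
Proof.
move=> hp; have [[hN _ _ _] _ _] := hp.
suff h : forall k : 'I_N, (k < N)%N ->
    nmem (exec logs_cmd s) 7 [:: val k] = up_log 2 (I k) /\
    forall l, (l < up_log 2 (I k))%N -> nmem (exec logs_cmd s) 6 [:: l] = (2 ^ l)%N.
  by move=> k; apply: h.
apply: (@run_for_frame_ind R eig us 28 eN _ s N (fun n s' => forall k : 'I_N, (k < n)%N ->
    nmem s' 7 [:: val k] = up_log 2 (I k) /\
    forall l, (l < up_log 2 (I k))%N -> nmem s' 6 [:: l] = (2 ^ l)%N)) => //.
move=> n s' nN hs IH; set k0 := Ordinal nN.
set s1 := exec (NSet 8 [::] (NConst 1)) (exec (NSet 7 [:: nv 28] (NConst 0)) (enter 28 n s')).
set body := If _ _ _; rewrite !run_seqs_cons run_seqs_nil -/s1 nmem_tick.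
have hp1 : params s1.
  have hp' := params_same hs isT isT hp.
  by do 2 (apply: params_run => //); have [[? ? ? ?] ? ?] := hp'; split.
have hD : neval s1 (eDim (nv 28)) = I k0 by have [_ hd _] := hp1; rewrite -hd.
(* Either all passes so far have doubled, or the power has reached the dimension. Array 6 is shared
   by all modes, which is harmless since its entries do not depend on the mode. *)
pose Q t s2 := exists l, [/\ (l <= up_log 2 (I k0))%N, (l = t \/ (I k0 <= 2 ^ l)%N),
  nmem s2 8 [::] = (2 ^ l)%N, nmem s2 7 [:: n] = l &
  (forall l', (l' < l)%N -> nmem s2 6 [:: l'] = (2 ^ l')%N) /\
  (forall k : 'I_N, (k < n)%N ->
    nmem s2 7 [:: val k] = up_log 2 (I k) /\
    forall l, (l < up_log 2 (I k))%N -> nmem s2 6 [:: l] = (2 ^ l)%N)].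
have [l [l1 l2 l3 l4 [l5 l6]]] : Q (I k0) (exec (For 23 (eDim (nv 28)) body) s1).
  apply: (run_for_frame_ind hD) => //.
    exists 0%N; split=> //; first by left.
      by rewrite /= eqxx.
    split=> // k kn; have [i1 i2] := IH k kn; split; last by [].
    by rewrite /= eqseq_cons andbT (ltn_eqF kn) i1.
  move=> t s2 tI hs2 [l [l1 l2 l3 l4 [l5 l6]]].
  have [_ hd _] := params_same hs2 isT isT hp1.
  have v28 : nmem s2 28 [::] = n by rewrite hs2.1.
  rewrite /body /= v28 l3 l4 (hd k0).
  case: ifP => [lt|/negbT ge]; last first.
    exists l; split=> //; right; move: ge; rewrite -ltnNge addn1 ltnS //.
  exists l.+1; split=> //=.
  - rewrite ltnNge; apply/negP => le; move: lt; rewrite addn1 ltnNge.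
    by rewrite (leq_trans (up_logP (I k0) (isT : 1 < 2)%N)) // leq_exp2l.
  - case: l2 => [->|]; first by left.
    by move=> ge; move: lt; rewrite addn1 ltnNge ge.
  - by rewrite addnn -mul2n expnS.
  - by rewrite eqxx addn1.
  split=> [l'|k kn].
    rewrite ltnS leq_eqVlt => /orP[/eqP->|ll]; first by rewrite eqxx.
    by rewrite eqseq_cons andbT (ltn_eqF ll) l5.
  have [i1 i2] := l6 k kn; rewrite eqseq_cons andbT (ltn_eqF kn); split=> // l' ll'.
  by rewrite eqseq_cons andbT; case: eqP => [->|_] //; apply: i2.
(* If every pass doubled, then [l] is the dimension itself, which is less than [2 ^ l]; in both
   cases the power covers the dimension. *)
have lE : l = up_log 2 (I k0).
  apply/eqP; rewrite eqn_leq l1 /=; apply: up_log_min => //.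
  by case: l2 => // ->; apply: ltnW; apply: ltn_expl.
move=> k; rewrite ltnS leq_eqVlt => /orP[/eqP kn|kn]; last exact: l6.
have -> : k = k0 by apply: val_inj.
by rewrite l4 lE; split=> // l' ll'; rewrite l5 // lE.
Qed.

Lemma eqR_ok s s' ns rs : same_off ns rs s s' -> 1%N \notin ns -> params s ->
  neval s' eR = r.
Proof. by move=> [hn _] h [[_ hr _ _] _ _]; rewrite /= hn. Qed.

(** The default [N] of [head] is no mode, so the second clause protects the tables of all other
    modes as well as malformed index lists. *)
Lemma grams_cmd_ok kv U (k : 'I_N) s : kv \in [:: 21%N; 28%N] ->
  params s -> nmem s kv [::] = k ->
  (forall a c, rmem s 1 [:: val k; val a; val c] = U k a c) ->
  (forall t c e, (t <= I k)%N ->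
    rmem (exec (grams_cmd kv) s) 3 [:: val k; t; val c; val e] = gram_prefix U k t c e) /\
  (forall iy, head N iy != k -> rmem (exec (grams_cmd kv) s) 3 iy = rmem s 3 iy).
Proof.
move=> hkv hp hk hU; rewrite /grams_cmd run_seq; set s1 := exec (fill2 _ _ _ _ _ _ _) s.
have [[_ hr _ _] _ _] := hp.
have kvN b : b \in [:: 25%N; 26%N; 27%N] -> (kv == b) = false.
  by move: hkv; rewrite !inE => /orP[] /eqP -> /or3P[] /eqP ->.
have [f1 f2] : filled s s1 3 r r (fun a b => [:: val k; 0%N; a; b]) (fun _ _ => 0).
  apply: fill2_ok => //.
  - by move=> s' hs; apply: eqR_ok hs _ hp.
  - by move=> a b a' b' [-> ->].
  move=> a b s' _ _ hs hx hy _ _; rewrite /= hx hy hs.1 ?hk //.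
  by rewrite !inE !kvN.
have same1 : same_off [:: 26; 27] [:: 3] s s1.
  exact: fill2_same.
pose Q t s2 :=
  (forall t' (c e : 'I_r), (t' <= t)%N ->
     rmem s2 3 [:: val k; t'; val c; val e] = gram_prefix U k t' c e) /\
  (forall iy, head N iy != k -> rmem s2 3 iy = rmem s 3 iy).
have hp1 : params s1 by apply: params_same same1 _ _ hp.
have hk1 : nmem s1 kv [::] = k by rewrite same1.1 // !inE !kvN.
have hD : neval s1 (eDim (nv kv)) = I k by have [_ hd _] := hp1; rewrite /= hk1 hd.
apply: (run_for_frame_ind (P := Q) hD).
  split=> [t' c e|iy hiy]; last first.
    by apply: f2 => a b _ _ iyE; rewrite iyE eqxx in hiy.
  by rewrite leqn0 => /eqP ->; rewrite gram_prefix0; apply: f1; apply: ltn_ord.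
move=> t s2 tI hs2 [q1 q2]; set s3 := enter 25 t s2.
have hs3 : same_off [:: 25; 26; 27] [:: 3] s1 s3.
  by apply: same_enter => //; apply: (same_off_sub hs2).
have hp3 : params s3 by apply: params_same hs3 _ _ hp1.
have hk3 : nmem s3 kv [::] = k by rewrite hs3.1 // !inE !kvN.
have [[_ hr3 _ _] _ _] := hp3.
have U3 a b c : rmem s3 1 [:: a; b; c] = rmem s 1 [:: a; b; c].
  by rewrite hs3.2 // same1.2.
have v25 : nmem s3 25 [::] = t by [].
have [g1 g2] : filled s3 (exec (fill2 3 26 27 eR eR
      [:: nv kv; NAdd (nv 25) (NConst 1); nv 26; nv 27]
      (RAdd (rP (nv kv) (nv 25) (nv 26) (nv 27))
        (RMul (rU (nv kv) (nv 25) (nv 26)) (rU (nv kv) (nv 25) (nv 27))))) s3) 3 r r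
    (fun a b => [:: val k; t.+1; a; b])
    (fun a b => rmem s3 3 [:: val k; t; a; b] +
       rmem s3 1 [:: val k; t; a] * rmem s3 1 [:: val k; t; b]).
  apply: fill2_ok => //.
  - by move=> s' hs; apply: eqR_ok hs _ hp3.
  - by move=> a b a' b' [-> ->].
  move=> a b s' _ _ hs hx hy _ hoff; rewrite /= hx hy (hs.1 kv) ?inE ?kvN // hk3.
  rewrite (hs.1 25%N) // v25 (hs.2 1%N) // addn1; split=> //; congr (_ + _).
  by apply: hoff => a' b' _ _ [] /n_Sn.
split=> [t' c e|iy hiy]; last first.
  rewrite g2 => [|a b _ _ iyE]; first exact: q2.
  by rewrite iyE eqxx in hiy.
rewrite leq_eqVlt ltnS => /orP[/eqP->|tt]; last first.
  rewrite g2 ?q1 // => a b _ _ [] tE _ _; move: tt; rewrite tE ltnn //.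
by rewrite g1 ?ltn_ord // -[t]/(val (Ordinal tI)) gram_prefixS -q1 // !U3 -!hU.
Qed.

Definition ready U s : Prop := [/\ params s, tables s, stores_factors U s & grams U s].

Lemma init_cmd_ok U s : params s -> stores_factors U s -> ready U (exec init_cmd s).
Proof.
move=> hp hU; rewrite /init_cmd !run_seqs_cons run_seqs_nil.
set s1 := exec strides_cmd s; set s2 := exec logs_cmd s1.
have hp1 : params s1 by apply: params_run.
have hp2 : params s2 by apply: params_run.
have ht2 : tables s2.
  move=> k; have [h7 h6] := logs_cmd_ok hp1 k; split=> //.
  by rewrite /s2 run_nframe // (strides_cmd_ok hp k).
have hU2 : stores_factors U s2 by move=> k a c; rewrite /s2 run_rframe // run_rframe.
have [[hN _ _ _] _ _] := hp2.
suff h : forall (k : 'I_N), (k < N)%N -> forall t c e, (t <= I k)%N ->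
    rmem (exec (For 28 eN (grams_cmd 28)) s2) 3 [:: val k; t; val c; val e] =
    gram_prefix U k t c e.
  split; [exact: (params_run _ _ hp2)|exact: (tables_run _ ht2)| |].
    by move=> k a c; rewrite rmem_tick run_rframe // hU2.
  by move=> k t c e tk; rewrite rmem_tick h.
apply: (@run_for_frame_ind R eig us 28 eN _ s2 N (fun n s' => forall (k : 'I_N), (k < n)%N ->
    forall t c e, (t <= I k)%N ->
    rmem s' 3 [:: val k; t; val c; val e] = gram_prefix U k t c e)) => //.
move=> n s' nN hs IH.
have hp' : params (enter 28 n s').
  by have [[? ? ? ?] ? ?] := params_same hs isT isT hp2; split.
have [] := @grams_cmd_ok 28%N U (Ordinal nN) (enter 28 n s') isT hp' erefl.
  by move=> a c; rewrite -hU2 /= hs.2.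
move=> g1 g2 k; rewrite ltnS leq_eqVlt => /orP[/eqP kn|kn] t c e tk.
  have kE : k = Ordinal nN by apply: val_inj.
  by move: tk; rewrite kE => tk; apply: g1.
by rewrite g2 ?IH //= neq_ltn kn.
Qed.

Lemma hadamard_cmd_ok U (j : 'I_N) s : ready U s -> nmem s 21 [::] = j ->
  forall m c e, (m <= N)%N ->
    rmem (exec hadamard_cmd s) 4 [:: m; val c; val e] = hadam U j m c e.
Proof.
move=> [hp ht hU hG] hj; have [[hN hr _ _] hd _] := hp.
rewrite /hadamard_cmd run_seq; set s1 := exec (fill2 _ _ _ _ _ _ _) s.
have [f1 f2] : filled s s1 4 r r (fun a b => [:: 0%N; a; b]) (fun _ _ => 1).
  apply: fill2_ok => //.
  - by move=> s' hs; apply: eqR_ok hs _ hp.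
  - by move=> a b a' b' [-> ->].
  by move=> a b s' _ _ hs hx hy _ _; rewrite /= hx hy.
have same1 : same_off [:: 26; 27] [:: 4] s s1 by exact: fill2_same.
have hp1 : params s1 := params_same same1 isT isT hp.
have [[hN1 _ _ _] _ _] := hp1.
have h21 : nmem s1 21 [::] = j by rewrite same1.1.
set loop := For 23 _ _.
suff h : forall m c e, (m <= N)%N ->
   rmem (exec loop s1) 4 [:: m; val c; val e] = hadam U j m c e by [].
apply: (@run_for_frame_ind R eig us 23 eN _ s1 N (fun n s' => forall m (c e : 'I_r), (m <= n)%N ->
   rmem s' 4 [:: m; val c; val e] = hadam U j m c e) hN1).
  by move=> m c e; rewrite leqn0 => /eqP ->; rewrite hadam0; apply: f1; apply: ltn_ord.
move=> n s2 nN hs2 IH; set s3 := enter 23 n s2; set m := Ordinal nN.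
have hs3 : same_off [:: 23; 26; 27] [:: 4] s1 s3.
  by apply: same_enter => //; apply: (same_off_sub hs2).
have hp3 : params s3 := params_same hs3 isT isT hp1.
have [[hN3 hr3 _ _] hd3 _] := hp3.
have v21 : nmem s3 21 [::] = j by rewrite hs3.1.
have v23 : nmem s3 23 [::] = m by [].
have r3 : rmem s3 = rmem s2 by [].
clearbody s3.
have G3 c e : rmem s3 3 [:: n; I m; val c; val e] = gram_prefix U m (I m) c e.
  by rewrite hs3.2 // same1.2 // -(hG m).
have key s4 : filled s3 s4 4 r r (fun a b => [:: n.+1; a; b])
   (fun a b => if m == j then rmem s3 4 [:: n; a; b]
      else rmem s3 4 [:: n; a; b] * rmem s3 3 [:: n; I m; a; b]) ->
   forall k (c e : 'I_r), (k <= n.+1)%N -> rmem s4 4 [:: k; val c; val e] = hadam U j k c e.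
  move=> [g1 g2] k c e; rewrite leq_eqVlt ltnS => /orP[/eqP->|kn].
    by rewrite g1 ?ltn_ord // -[n]/(val m) hadamS G3 r3 IH.
  by rewrite g2 ?r3 ?IH // => a b _ _ [] kE; move: kn; rewrite kE ltnn.
have inj a b a' b' : [:: n.+1; a; b] = [:: n.+1; a'; b'] -> (a < r)%N -> (b < r)%N ->
    (a' < r)%N -> (b' < r)%N -> a = a' /\ b = b' by move=> [-> ->].
apply: key; rewrite run_if beval_eqn.
have -> : (neval s3 (nv 23) == neval s3 (nv 21)) = (m == j) by rewrite /= v21 v23.
set s5 := tick _ s3.
have [n5 r5] : nmem s5 = nmem s3 /\ rmem s5 = rmem s3 by [].
rewrite /filled -r5; clearbody s5; case: ifP => mj.
  apply: (@fill2_ok R eig us 26 27 eR eR 4 _ _ s5) => //.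
  - by rewrite /= n5.
  - by move=> s' hs; rewrite /= (hs.1 1%N) // n5.
  move=> a b s' _ _ hs hx hy _ hoff; rewrite /= hx hy (hs.1 23%N) // n5 v23 /= addn1.
  by split=> //; apply: hoff => a' b' _ _ [] /n_Sn.
apply: (@fill2_ok R eig us 26 27 eR eR 4 _ _ s5) => //.
- by rewrite /= n5.
- by move=> s' hs; rewrite /= (hs.1 1%N) // n5.
move=> a b s' _ _ hs hx hy _ hoff.
rewrite /= hx hy (hs.1 23%N) // n5 v23 /= addn1.
rewrite (hs.1 4%N) // (hs.2 3%N) // n5 (hd3 m); split=> //.
by congr (_ * _); apply: hoff => a' b' _ _ [] /n_Sn.
Qed.

Lemma stores_same U ns rs s s' : same_off ns rs s s' -> 1%N \notin rs ->
  stores_factors U s -> stores_factors U s'.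
Proof. by move=> [_ h] h1 hU k a c; rewrite h. Qed.

Lemma ready_same U ns rs s s' : same_off ns rs s s' ->
  all (fun b => 7 < b)%N ns -> all (fun b => b \notin [:: 0; 1; 3]%N) rs ->
  ready U s -> ready U s'.
Proof.
move=> h h1 /allP h2 [hp ht hU hG].
have n0 b : b \in [:: 0; 1; 3]%N -> b \notin rs.
  by move=> hb; apply/negP => /h2; rewrite hb.
split.
- apply: (params_same h) => //; last exact: n0.
  by apply: sub_all h1 => b; apply: ltn_trans.
- exact: (tables_same h).
- by apply: (stores_same h) => //; apply: n0.
by move=> k t c e tk; rewrite h.2 ?hG // n0.
Qed.

Lemma run_pinv_ok d a ee s n : neval s ee = n -> forall c e : 'I_n,
  rmem (exec (Pinv d a ee) s) d [:: val c; val e] = pinv (get_mx a n n s) c e.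
Proof. by move=> <- c e; rewrite /= !valK eqxx. Qed.

Definition gram_pinv U (j : 'I_N) : 'M[R]_r := pinv ((design U j)^T *m design U j).

Definition rank_weight U (j : 'I_N) : R := \sum_u leverage (design U j) u.

Definition solver_ready U (j : 'I_N) s : Prop :=
  [/\ ready U s, nmem s 21 [::] = j,
      forall m c e, (m <= N)%N -> rmem s 4 [:: m; val c; val e] = hadam U j m c e,
      forall c e, rmem s 6 [:: val c; val e] = gram_pinv U j c e
    & rmem s 7 [::] = rank_weight U j].

Lemma design_gram_hadam U j : (design U j)^T *m design U j =
  \matrix_(c, e) hadam U j N c e.
Proof.
rewrite design_gram; apply/matrixP => c e; rewrite !mxE.
by rewrite -kr_gram_entry_modes_lt // other_modesE.
Qed.

Lemma rank_weightE U j : rank_weight U j =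
  \sum_c \sum_e gram_pinv U j c e * hadam U j N c e.
Proof.
rewrite /rank_weight; under eq_bigr do rewrite leverage_row_form.
rewrite row_total; apply: eq_bigr => c _; apply: eq_bigr => e _.
by rewrite !mulr1 -kr_gram_entry_modes_lt // other_modesE.
Qed.

Lemma setup_cmd_ok U (j : 'I_N) s : ready U s -> nmem s 21 [::] = j ->
  let s' := exec setup_cmd s in
  [/\ solver_ready U j s',
      forall c e : 'I_r, rmem s' 8 [:: val c; val e] = 0
    & forall (c : 'I_r) (a : 'I_(I j)), rmem s' 9 [:: val c; val a] = 0].
Proof.
move=> hs hj; rewrite /setup_cmd !run_seqs_cons run_seqs_nil.
set s1 := exec hadamard_cmd s; set s2 := exec _ s1; set s3 := exec _ s2.
set s4 := exec _ s3; set s5 := exec _ s4; set s6 := exec _ s5.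
have hH1 : forall m c e, (m <= N)%N -> rmem s1 4 [:: m; val c; val e] = hadam U j m c e.
  exact: hadamard_cmd_ok.
have same1 : same_off (nwrites hadamard_cmd) (rwrites hadamard_cmd) s s1 by exact: run_same_off.
have same2 : same_off [:: 26; 27] [:: 5] s1 s2 by exact: fill2_same.
have same3 : same_off [::] [:: 6] s2 s3 by exact: (run_same_off eig us (Pinv 6 5 eR) s2).
have same4 : same_off [:: 26; 27] [:: 7] s3 s4 by exact: sum2_same.
have same5 : same_off [:: 26; 27] [:: 8] s4 s5 by exact: fill2_same.
have same6 : same_off [:: 26; 25] [:: 9] s5 s6 by exact: fill2_same.
have r1 : ready U s1 := ready_same same1 isT isT hs.
have r2 : ready U s2 := ready_same same2 isT isT r1.
have r3 : ready U s3 := ready_same same3 isT isT r2.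
have r4 : ready U s4 := ready_same same4 isT isT r3.
have r5 : ready U s5 := ready_same same5 isT isT r4.
have r6 : ready U s6 := ready_same same6 isT isT r5.
have [[[hN1 hr1 _ _] _ _] _ _ _] := r1.
have [f2 _] : filled s1 s2 5 r r (fun a b => [:: a; b]) (fun a b => rmem s1 4 [:: N; a; b]).
  apply: fill2_ok => //.
  - by move=> s' hs'; rewrite /= (hs'.1 1%N).
  - by move=> a b a' b' [-> ->].
  move=> a b s' _ _ hs' hx hy _ _; rewrite /= hx hy (hs'.1 0%N) // hN1 (hs'.2 4%N) //.
have g3 c e : rmem s3 6 [:: val c; val e] = gram_pinv U j c e.
  have [[[_ hr2 _ _] _ _] _ _ _] := r2; rewrite /s3 (@run_pinv_ok 6 5 eR s2 r hr2).
  congr (pinv _ _ _); rewrite design_gram_hadam; apply/matrixP => c' e'.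
  by rewrite !mxE f2 ?ltn_ord // hH1.
have g4 : rmem s4 7 [::] = rank_weight U j.
  have [[[_ hr3 _ _] _ _] _ _ _] := r3; rewrite rank_weightE /s4.
  rewrite (@run_sum2 R eig us 26 27 eR eR 7 _ s3 r r
     (fun a b => rmem s3 6 [:: a; b] * rmem s3 5 [:: a; b])) //.
  - apply: eq_bigr => c _; apply: eq_bigr => e _; rewrite g3; congr (_ * _).
    by rewrite same3.2 // f2 ?ltn_ord // hH1.
  - by move=> s' hs'; rewrite /= (hs'.1 1%N).
  by move=> a b s' _ _ hs' hx hy; rewrite /= hx hy (hs'.2 6%N) // (hs'.2 5%N).
have [f5 _] : filled s4 s5 8 r r (fun a b => [:: a; b]) (fun _ _ => 0).
  have [[[_ hr4 _ _] _ _] _ _ _] := r4; apply: fill2_ok => //.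
  - by move=> s' hs'; rewrite /= (hs'.1 1%N).
  - by move=> a b a' b' [-> ->].
  by move=> a b s' _ _ hs' hx hy _ _; rewrite /= hx hy.
have hj5 : nmem s5 21 [::] = j.
  by rewrite same5.1 // same4.1 // same3.1 // same2.1 // same1.1.
have [f6 _] : filled s5 s6 9 r (I j) (fun a b => [:: a; b]) (fun _ _ => 0).
  have [[[_ hr5 _ _] hd5 _] _ _ _] := r5; apply: fill2_ok => //.
  - by move=> s' hs'; rewrite /= (hs'.1 4%N) // (hs'.1 21%N) // hj5 hd5.
  - by move=> a b a' b' [-> ->].
  by move=> a b s' _ _ hs' hx hy _ _; rewrite /= hx hy.
rewrite rmem_tick; split.
- split; first exact: (ready_same (same_off_refl [::] [::] s6) isT isT r6).
  + by rewrite nmem_tick same6.1.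
  + by move=> m c e mN; rewrite rmem_tick same6.2 // same5.2 // same4.2 // same3.2 // same2.2 // hH1.
  + by move=> c e; rewrite rmem_tick same6.2 // same5.2 // same4.2.
  by rewrite rmem_tick same6.2 // same5.2.
- by move=> c e; rewrite same6.2 // f5 ?ltn_ord.
by move=> c a; rewrite f6 ?ltn_ord.
Qed.

Lemma solver_ready_same U j ns rs s s' : same_off ns rs s s' ->
  all (fun b => (7 < b)%N && (b != 21%N)) ns ->
  all (fun b => b \notin [:: 0; 1; 3; 4; 6; 7]%N) rs ->
  solver_ready U j s -> solver_ready U j s'.
Proof.
move=> h h1 h2 [hs hj h4 h6 h7].
have n0 b : b \in [:: 0; 1; 3; 4; 6; 7]%N -> b \notin rs.
  by move=> hb; apply/negP => /(allP h2); rewrite hb.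
split.
- apply: (ready_same h) => //; first by apply: sub_all h1 => b /andP[].
  by apply: sub_all h2 => b; rewrite !inE !negb_or => /and5P[-> -> -> _ _].
- by rewrite h.1 //; apply/negP => /(allP h1); rewrite eqxx andbF.
- by move=> m c e mN; rewrite h.2 ?h4 // n0.
- by move=> c e; rewrite h.2 ?h6 // n0.
by rewrite h.2 // n0.
Qed.

(** * Drawing one row by descent through the modes *)

Definition descend_state U (j m : 'I_N) (h : 'I_r -> R) s : Prop :=
  [/\ solver_ready U j s, nmem s 23 [::] = (N - 1 - m)%N
    & forall c : 'I_r, rmem s 10 [:: val c] = h c].

Lemma descend_state_same U j m h ns rs s s' : same_off ns rs s s' ->
  all (fun b => (7 < b)%N && (b \notin [:: 21; 23]%N)) ns ->
  all (fun b => b \notin [:: 0; 1; 3; 4; 6; 7; 10]%N) rs ->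
  descend_state U j m h s -> descend_state U j m h s'.
Proof.
move=> hs h1 h2 [h3 h4 h5]; split.
- apply: (solver_ready_same hs) => //.
    by apply: sub_all h1 => b; rewrite !inE negb_or => /and3P[-> -> _].
  by apply: sub_all h2 => b; rewrite !inE !negb_or => /and5P[-> -> -> -> /and3P[-> -> _]].
- by rewrite hs.1 //; apply/negP => /(allP h1); rewrite !inE eqxx orbT andbF.
by move=> c; rewrite hs.2 //; apply/negP => /(allP h2); rewrite !inE eqxx !orbT.
Qed.

Lemma eMode_ok (m : 'I_N) s : nmem s 0 [::] = N -> nmem s 23 [::] = (N - 1 - m)%N ->
  neval s eMode = m.
Proof. by move=> h0 h1; rewrite /= h0 h1; have := ltn_ord m; lia. Qed.

Definition cum U j h (m : 'I_N) t : R :=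
  cum_form U (gram_pinv U j) h m (modes_lt j m) t.

Lemma cum_ok U j m h p t s : descend_state U j m h s -> p \in [:: 13; 14]%N ->
  nmem s p [::] = t -> (t <= I m)%N ->
  rmem (exec (sum2 12 26 27 eR eR (rCum (nv p))) s) 12 [::] = cum U j h m t.
Proof.
move=> [[[hp ht hU hG] hj h4 h6 h7] hx hh] hp13 hpt tI; have [[hN hr _ _] _ _] := hp.
have hm := eMode_ok hN hx.
rewrite (@run_sum2 R eig us 26 27 eR eR 12 _ s r r (fun a b =>
  rmem s 6 [:: a; b] * rmem s 4 [:: val m; a; b] *
  (rmem s 10 [:: a] * rmem s 10 [:: b] * rmem s 3 [:: val m; t; a; b]))) //.
- apply: eq_bigr => c _; apply: eq_bigr => e _.
  have -> : rmem s 10 [:: nat_of_ord c] = h c := hh c.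
  have -> : rmem s 10 [:: nat_of_ord e] = h e := hh e.
  have -> : rmem s 6 [:: nat_of_ord c; nat_of_ord e] = gram_pinv U j c e := h6 c e.
  have -> : rmem s 4 [:: nat_of_ord m; nat_of_ord c; nat_of_ord e] = hadam U j m c e.
    by apply: h4; apply: ltnW.
  have -> : rmem s 3 [:: nat_of_ord m; t; nat_of_ord c; nat_of_ord e] = gram_prefix U m t c e.
    exact: hG.
  by rewrite kr_gram_entry_modes_lt // ltnW.
- by move=> s' hs; rewrite /= (hs.1 1%N).
move=> a b s' _ _ hs hx' hy'.
have hm' : neval s' eMode = m by apply: eMode_ok; rewrite hs.1.
have hp' : nmem s' p [::] = t by rewrite hs.1 //; move: hp13; rewrite !inE => /orP[] /eqP ->.
rewrite [LHS]/= -/(neval s' eMode) in hm' *.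
rewrite [LHS]/= hx' hy' hp' (hs.2 6%N) // (hs.2 4%N) // (hs.2 10%N) // (hs.2 3%N) //.
by move: hm'; rewrite /= => ->.
Qed.

(* Loop invariant: the sought position lies in the dyadic interval of length [2 ^ (L - l)]
   that starts at the current one. *)
Lemma search_cmd_ok U j m h tau (a : 'I_(I m)) s : descend_state U j m h s ->
  rmem s 11 [::] = tau -> cum U j h m a <= tau < cum U j h m a.+1 ->
  nmem (exec search_cmd s) 13 [::] = a.
Proof.
move=> hs htau /andP[ca1 ca2]; rewrite /search_cmd run_seq.
set s1 := exec (NSet 13 [::] (NConst 0)) s.
have same1 : same_off [:: 13] [::] s s1 := run_same_off eig us (NSet 13 [::] (NConst 0)) s.
have hs1 : descend_state U j m h s1 := descend_state_same same1 isT isT hs.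
have htau1 : rmem s1 11 [::] = tau by rewrite same1.2.
have [[[[[hN1 _ _ _] _ _] ht1 _ _] _ _ _ _] hx1 _] := hs1.
have [_ hL1 _] := ht1 m; set L := up_log 2 (I m) in hL1.
have cumm t t' : (t <= t')%N -> cum U j h m t <= cum U j h m t'.
  by move=> tt; apply: cum_form_le => // v; apply: pinv_gram_form_ge0.
pose Q l s2 := (nmem s2 13 [::] <= a < nmem s2 13 [::] + 2 ^ (L - l))%N.
suff : Q L (exec (For 24 (eLog eMode) (seqs [:: NSet 14 [::] (NAdd (nv 13)
                 (NGet 6 [:: NSub (NSub (eLog eMode) (NConst 1)) (nv 24)]));
        sum2 12 26 27 eR eR (rCum (nv 14));
        If (BAnd (NLe (NAdd (nv 14) (NConst 1)) (eDim eMode)) (RLe (rv 12) (rv 11)))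
          (NSet 13 [::] (nv 14)) Skip])) s1).
  rewrite /Q subnn expn0 addn1 ltnS => /andP[h1 h2].
  by apply/eqP; rewrite eqn_leq h1 h2.
apply: (@run_for_frame_ind R eig us 24 (eLog eMode) _ s1 L Q).
- by rewrite [neval _ _]/= -[X in [:: X]]/(neval s1 eMode) (eMode_ok hN1 hx1).
- rewrite /Q subn0 nmem_tick [nmem s1 13 _]/= add0n /=.
  exact: leq_trans (ltn_ord a) (up_logP (I m) (isT : 1 < 2)%N).
move=> l s2 lL hs2 /andP[q1 q2]; rewrite !run_seqs_cons run_seqs_nil.
set s3 := enter 24 l s2; set pos := nmem s2 13 [::] in q1 q2.
have same3 : same_off [:: 13; 14; 24; 26; 27] [:: 12] s1 s3.
  by apply: same_enter => //; apply: (same_off_sub hs2).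
have v24 : nmem s3 24 [::] = l by [].
have v13 : nmem s3 13 [::] = pos by [].
clearbody s3 pos.
have hs3 : descend_state U j m h s3 := descend_state_same same3 isT isT hs1.
have [[[[[hN3 _ _ _] hd3 _] ht3 _ _] _ _ _ _] hx3 _] := hs3.
have [_ hL3 hpow3] := ht3 m; have hm3 := eMode_ok hN3 hx3.
set cc := NSet 14 _ _; set s4 := exec cc s3.
have same4 : same_off [:: 14] [::] s3 s4 := run_same_off eig us cc s3.
have hs4 : descend_state U j m h s4 := descend_state_same same4 isT isT hs3.
have v14 : nmem s4 14 [::] = (pos + 2 ^ (L - l.+1))%N.
  have -> : nmem s4 14 [::] = (nmem s3 13 [::] +
      nmem s3 6 [:: (nmem s3 7 [:: neval s3 eMode] - 1 - nmem s3 24 [::])%N])%N by [].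
  rewrite hm3 hL3 v24 v13 hpow3; last by rewrite -/L; lia.
  by congr (pos + 2 ^ _)%N; rewrite -/L; lia.
have t4 : rmem s4 11 [::] = tau by rewrite same4.2 // same3.2.
have v13' : nmem s4 13 [::] = pos by rewrite same4.1.
clearbody s4; set cand := (_ + _)%N in v14.
set ss := sum2 _ _ _ _ _ _; set s5 := exec ss s4.
have same5 : same_off [:: 26; 27] [:: 12] s4 s5 by exact: sum2_same.
have c5 : (cand <= I m)%N -> rmem s5 12 [::] = cum U j h m cand.
  by move=> cI; apply: cum_ok hs4 _ v14 cI.
have [[[[[hN4 _ _ _] hd4 _] _ _ _] _ _ _ _] hx4 _] := hs4.
have hm5 : neval s5 eMode = m by apply: eMode_ok; rewrite same5.1.
have b5 : beval s5 (BAnd (NLe (NAdd (nv 14) (NConst 1)) (eDim eMode)) (RLe (rv 12) (rv 11))) =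
    (cand < I m)%N && (rmem s5 12 [::] <= tau).
  have -> : beval s5 (BAnd (NLe (NAdd (nv 14) (NConst 1)) (eDim eMode)) (RLe (rv 12) (rv 11))) =
    (nmem s5 14 [::] + 1 <= nmem s5 4 [:: neval s5 eMode])%N &&
    (rmem s5 12 [::] <= rmem s5 11 [::]) by [].
  have -> : rmem s5 11 [::] = tau by rewrite same5.2.
  by rewrite hm5 !same5.1 // v14 hd4 addn1.
have e2 : (2 ^ (L - l) = 2 ^ (L - l.+1) + 2 ^ (L - l.+1))%N.
  by rewrite addnn -mul2n -expnS; congr (2 ^ _)%N; lia.
rewrite /Q nmem_tick run_if b5; case: ifP => [/andP[cI ct]|/negbT cN].
  have -> : nmem (exec (NSet 13 [::] (nv 14)) (tick (1 + bcost (BAnd (NLe (NAdd (nv 14) (NConst 1))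
    (eDim eMode)) (RLe (rv 12) (rv 11)))) s5)) 13 [::] = nmem s5 14 [::] by [].
  rewrite same5.1 // v14; apply/andP; split; last first.
    by rewrite /cand -addnA -e2.
  (* An accepted candidate beyond [a] would have cumulative weight at least that at [a.+1], which
     exceeds [tau]. *)
  rewrite leqNgt; apply/negP => ac; move: ct; rewrite c5 1?ltnW // leNgt.
  by rewrite (lt_le_trans ca2) // cumm.
set sk := exec Skip _; have -> : nmem sk 13 [::] = pos by rewrite -v13' -same5.1.
rewrite q1 /= -/cand.
move: cN; rewrite negb_and -leqNgt => /orP[Ic|].
  exact: leq_trans (ltn_ord a) Ic.
case: (leqP cand a) => // ca; rewrite c5; last by rewrite (leq_trans ca) // ltnW.
by rewrite (le_trans (cumm _ _ ca)).
Qed.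

Lemma descend_cmd_ok U j i s : solver_ready U j s ->
  (forall c : 'I_r, rmem s 10 [:: val c] = 1) -> nmem s 12 [::] = 0%N ->
  in_row U (gram_pinv U j) (fun _ => 1) (other_modes j) i (rmem s 11 [::]) ->
  let s' := exec descend_cmd s in
  (forall c : 'I_r, rmem s' 10 [:: val c] = design U j (row_ord (other_modes j) i) c) /\
  nmem s' 12 [::] = (\sum_(k <- other_modes j) i k * stride I k)%N.
Proof.
move=> hs h1 hb0 hin.
(* The chosen part of the row is in [h], the rest of the draw lies in the cell of the remaining
   modes, and product and offset become the final ones once the remaining modes are included. *)
pose Q x s2 := exists h, [/\ forall c : 'I_r, rmem s2 10 [:: val c] = h c,
  in_row U (gram_pinv U j) h (modes_lt j (N - x)) i (rmem s2 11 [::]),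
  forall c, h c * \prod_(k <- modes_lt j (N - x)) U k (i k) c =
    \prod_(k <- other_modes j) U k (i k) c
  & (nmem s2 12 [::] + \sum_(k <- modes_lt j (N - x)) i k * stride I k =
     \sum_(k <- other_modes j) i k * stride I k)%N].
have [[[[hN _ _ _] _ _] _ _ _] _ _ _ _] := hs.
suff [h [q1 _ q3 q4]] : Q N (exec descend_cmd s).
  move: q3 q4; rewrite subnn modes_lt0 big_nil addn0 => q3 q4; split=> // c.
  by rewrite kr_product_row -q3 big_nil mulr1.
apply: (@run_for_frame_ind R eig us 23 eN _ s N Q hN).
  exists (fun _ => 1); rewrite subn0 -other_modesE; split=> //.
    by move=> c; rewrite mul1r.
  by rewrite nmem_tick hb0 add0n.
move=> x s2 xN hs2 [h [q1 q2 q3 q4]]; set s3 := enter 23 x s2.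
have mN : (N - x.+1 < N)%N by lia.
pose m := Ordinal mN; have mE : (N - x = m.+1)%N by rewrite /=; lia.
have same3 := same_enter x hs2 (mem_head _ _); rewrite -/s3 in same3.
have hs3 : solver_ready U j s3.
  by apply: (solver_ready_same same3).
have v23 : nmem s3 23 [::] = (N - 1 - m)%N by rewrite [LHS]/= /=; lia.
have r3 : rmem s3 = rmem s2 by [].
have b3 : nmem s3 12 = nmem s2 12 by [].
rewrite -r3 -b3 mE in q1 q2 q4 q3; clearbody s3.
have d3 : descend_state U j m h s3 by [].
have [[[[hN3 _ _ _] _ _] _ _ _] hj3 _ _ _] := hs3.
have hm3 : neval s3 eMode = m := eMode_ok hN3 v23.
set body := seqs _; rewrite run_if beval_eqn hm3 [neval s3 (nv 21)]hj3 (inj_eq val_inj).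
rewrite -/(val m) modes_ltS in q2 q3 q4; case: ifP => mj; rewrite mj in q2 q3 q4.
  by exists h.
set s4' := tick _ s3.
have d4' : descend_state U j m h s4'.
  exact: (descend_state_same (same_off_refl [::] [::] s4') isT isT d3).
have b4' : nmem s4' 12 [::] = nmem s3 12 [::] by [].
have t4' : rmem s4' 11 [::] = rmem s3 11 [::] by [].
clearbody s4'; rewrite /body !run_seqs_cons run_seqs_nil.
move: (in_row_cons (pinv_gram_form_ge0 (design U j)) q2) => [cumi q2'].
set s4 := (X in exec _ (exec _ (exec _ (exec _ X)))).
have p4 : nmem s4 13 [::] = i m by apply: (search_cmd_ok d4' t4' cumi).
have same4 : same_off (nwrites search_cmd) (rwrites search_cmd) s4' s4 by exact: run_same_off.
have d4 : descend_state U j m h s4 by exact: (descend_state_same same4 isT isT d4').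
have b4 : nmem s4 12 [::] = nmem s3 12 [::] by rewrite same4.1.
have t4 : rmem s4 11 [::] = rmem s3 11 [::] by rewrite same4.2.
clearbody s4; set ss := sum2 _ _ _ _ _ _; set s5 := exec ss s4.
have c5 : rmem s5 12 [::] = cum U j h m (i m).
  by apply: cum_ok d4 _ p4 _ => //; apply: ltnW.
have same5 : same_off [:: 26; 27] [:: 12] s4 s5 by exact: sum2_same.
have d5 : descend_state U j m h s5 by exact: (descend_state_same same5 isT isT d4).
have p5 : nmem s5 13 [::] = i m by rewrite same5.1.
have b5 : nmem s5 12 [::] = nmem s3 12 [::] by rewrite same5.1.
have t5 : rmem s5 11 [::] = rmem s3 11 [::] by rewrite same5.2.
clearbody s5; set rs := RSet 11 _ _; set s6 := exec rs s5.
have same6 : same_off [::] [:: 11] s5 s6 := run_same_off eig us rs s5.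
have t6 : rmem s6 11 [::] = rmem s3 11 [::] - cum U j h m (i m).
  by rewrite -t5 -c5.
have d6 : descend_state U j m h s6 by exact: (descend_state_same same6 isT isT d5).
have p6 : nmem s6 13 [::] = i m by rewrite same6.1.
have b6 : nmem s6 12 [::] = nmem s3 12 [::] by rewrite same6.1.
clearbody s6; have [[[[[hN6 hr6 _ _] hd6 _] _ hU6 _] _ _ _ _] v6 h6] := d6.
set ff := fill2 _ _ _ _ _ _ _; set s7 := exec ff s6.
have [f7 _] : filled s6 s7 10 1 r (fun _ b => [:: b])
    (fun _ b => rmem s6 10 [:: b] * rmem s6 1 [:: val m; val (i m); b]).
  apply: fill2_ok => //.
  - by move=> s' hs'; rewrite /= (hs'.1 1%N).
  - by move=> a b a' b' [->]; rewrite !ltnS !leqn0 => /eqP -> _ /eqP ->.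
  move=> a b s' _ _ hs' hx hy hold _.
  have hm' : neval s' eMode = m by apply: eMode_ok; rewrite hs'.1.
  have -> : reval s' (RMul (RGet 10 [:: nv 26]) (rU eMode (nv 13) (nv 26))) =
    rmem s' 10 [:: nmem s' 26 [::]] *
    rmem s' 1 [:: neval s' eMode; nmem s' 13 [::]; nmem s' 26 [::]] by [].
  by rewrite hm' /= hy hold (hs'.1 13%N) // p6 (hs'.2 1%N).
have same7 : same_off [:: 29; 26] [:: 10] s6 s7 by exact: fill2_same.
have p7 : nmem s7 13 [::] = i m by rewrite same7.1.
have b7 : nmem s7 12 [::] = nmem s3 12 [::] by rewrite same7.1.
have t7 : rmem s7 11 [::] = rmem s3 11 [::] - cum U j h m (i m) by rewrite same7.2.
have s7ok : solver_ready U j s7 by case: d6 => + _ _; apply: (solver_ready_same same7).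
have [[[[hN7 _ _ _] _ _] ht7 _ _] _ _ _ _] := s7ok.
have m7 : neval s7 eMode = m by apply: eMode_ok; rewrite ?same7.1.
have [st7 _ _] := ht7 m.
have {}f7 (c : 'I_r) : rmem s7 10 [:: val c] = h c * U m (i m) c.
  by rewrite (f7 0%N) ?ltn_ord //; congr (_ * _); [apply: h6|apply: hU6].
clearbody s7; exists (scale_row U h (i m)); split.
- exact: f7.
- have -> : (N - x.+1)%N = m by []. 
  by rewrite [rmem _ 11 _]t7; apply: q2'.
- by move=> c; rewrite /scale_row -q3 big_cons mulrA.
rewrite -q4 big_cons addnA; congr (_ + _)%N.
rewrite -[LHS]/(nmem s7 12 [::] + nmem s7 13 [::] * nmem s7 5 [:: neval s7 eMode])%N.
by rewrite b7 p7 m7 st7.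
Qed.

Definition cdf m (q : 'I_m -> R) (i : 'I_m) : R := \sum_(k < m | (k < i)%N) q k.

Definition in_cell m (q : 'I_m -> R) (i : 'I_m) (v : R) : Prop :=
  cdf q i <= v < cdf q i + q i.

Lemma row_mindex j (u : 'I_(rows_but I j)) (a : 'I_(I j)) :
  exists i : mindex I, row_ord (other_modes j) i = u /\ i j = a.
Proof.
pose i0 : mindex I := [ffun k => eqtype.dfwith (fun k => Ordinal (I_gt0 k)) a k].
have uniq_s : uniq (other_modes j) by rewrite rev_uniq filter_uniq // enum_uniq.
have [i [i1 i2]] := row_ord_surj u i0 uniq_s.
exists i; split=> //; rewrite i2 ?mem_other_modes ?eqxx // /i0 ffunE.
exact: eqtype.dfwith_in.
Qed.

(** Scaling the single draw by the total weight replaces the normalization of every cumulative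
    weight. *)
Lemma in_cell_in_row U j i v : 0 < rank_weight U j ->
  in_cell (leverage_prob (design U j)) (row_ord (other_modes j) i) v ->
  in_row U (gram_pinv U j) (fun _ => 1) (other_modes j) i (v * rank_weight U j).
Proof.
move=> W0; rewrite /in_cell /in_row => /andP[h1 h2].
have -> : row_prefix U (gram_pinv U j) (fun _ => 1) (other_modes j)
    (row_index (other_modes j) i) =
    cdf (leverage_prob (design U j)) (row_ord (other_modes j) i) * rank_weight U j.
  rewrite /cdf big_distrl; apply: eq_bigr => u _ /=.
  by rewrite -leverage_row_form /leverage_prob divfK // gt_eqF.
have -> : row_form U (gram_pinv U j) (fun _ => 1) (row_ord (other_modes j) i) =
    leverage_prob (design U j) (row_ord (other_modes j) i) * rank_weight U j.
  by rewrite -leverage_row_form /leverage_prob divfK // gt_eqF.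
by rewrite -mulrDl ler_pM2r // ltr_pM2r // h1.
Qed.

Definition sample_weight U (j : 'I_N) (u : 'I_(rows_but I j)) : R :=
  rank_weight U j / (J%:R * leverage (design U j) u).

Lemma sample_cmd_ok U j (u : 'I_(rows_but I j)) s : solver_ready U j s ->
  0 < rank_weight U j -> in_cell (leverage_prob (design U j)) u (us (draws s)) ->
  let s' := exec sample_cmd s in
  [/\ solver_ready U j s', draws s' = (draws s).+1,
      forall c e : 'I_r, rmem s' 8 [:: val c; val e] = rmem s 8 [:: val c; val e] +
        sample_weight U u * (design U j u c * design U j u e)
    & forall (c : 'I_r) (a : 'I_(I j)),
        rmem s' 9 [:: val c; val a] = rmem s 9 [:: val c; val a] +
        sample_weight U u * (design U j u c * (matricize T j)^T u a)].
Proof.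
move=> hs W0 hu; rewrite /sample_cmd.
have a0 : 'I_(I j) := Ordinal (I_gt0 j).
have [i [iu _]] := row_mindex u a0; rewrite -iu in hu *.
pose kept n s' := [/\ solver_ready U j s', draws s' = n,
  forall iy, rmem s' 8 iy = rmem s 8 iy & forall iy, rmem s' 9 iy = rmem s 9 iy].
have keep ns rs n s1 s2 : same_off ns rs s1 s2 -> draws s2 = draws s1 ->
    all (fun b => (7 < b)%N && (b != 21%N)) ns ->
    all (fun b => b \notin [:: 0; 1; 3; 4; 6; 7; 8; 9]%N) rs -> kept n s1 -> kept n s2.
  move=> h12 d12 h1 /allP h2 [q d k l]; split; last 2 first.
  - by move=> iy; rewrite h12.2 //; apply/negP => /h2.
  - by move=> iy; rewrite h12.2 //; apply/negP => /h2.
  - apply: (solver_ready_same h12) => //; apply/allP => b /h2; apply: contra.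
    by rewrite !inE => /or4P[-> //|->|->|/or3P[] ->]; rewrite ?orbT.
  by rewrite d12.
have K0 : kept (draws s) s by [].
rewrite !run_seqs_cons run_seqs_nil.
set s1 := (X in exec _ (exec _ (exec _ (exec _ (exec _ (exec _ (exec _ (exec _ X)))))))).
have [f1 _] : filled s s1 10 1 r (fun _ b => [:: b]) (fun _ _ => 1).
  have [[[[_ hr _ _] _ _] _ _ _] _ _ _ _] := hs; apply: fill2_ok => //.
  - by move=> s' hs'; rewrite /= (hs'.1 1%N).
  - by move=> a b a' b' [->]; rewrite !ltnS !leqn0 => /eqP -> _ /eqP ->.
  by move=> a b s' _ _ hs' hx hy _ _; rewrite /= hy.
have same1 : same_off [:: 29; 26] [:: 10] s s1 by exact: fill2_same.
have K1 : kept (draws s) s1 by apply: keep same1 _ isT isT K0; exact: run_draws.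
have {}f1 (c : 'I_r) : rmem s1 10 [:: val c] = 1 by rewrite (f1 0%N) ?ltn_ord.
clearbody s1.
set s2 := (X in exec _ (exec _ (exec _ (exec _ (exec _ (exec _ (exec _ X))))))).
have same2 : same_off [::] [:: 11] s1 s2 by exact: (run_same_off eig us (Draw 11 [::]) s1).
have [q1 d1 k1 l1] := K1.
have t2 : rmem s2 11 [::] = us (draws s) by rewrite -d1.
have K2 : kept (draws s).+1 s2.
  split; [exact: (solver_ready_same same2)|by rewrite -d1|..];
    by move=> iy; rewrite same2.2 ?k1 ?l1.
have f2 (c : 'I_r) : rmem s2 10 [:: val c] = 1 by rewrite same2.2.
clearbody s2.
set s3 := (X in exec _ (exec _ (exec _ (exec _ (exec _ (exec _ X)))))).
have same3 : same_off [::] [:: 11] s2 s3 by exact: (run_same_off eig us (RSet 11 [::] _) s2).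
have t3 : rmem s3 11 [::] = us (draws s) * rank_weight U j.
  by have [[_ _ _ _ <-] _ _ _] := K2; rewrite -t2.
have K3 : kept (draws s).+1 s3 by apply: keep same3 _ isT isT K2.
have f3 (c : 'I_r) : rmem s3 10 [:: val c] = 1 by rewrite same3.2.
clearbody s3.
set s4 := (X in exec _ (exec _ (exec _ (exec _ (exec _ X))))).
have same4 : same_off [:: 12] [::] s3 s4 by exact: (run_same_off eig us (NSet 12 [::] _) s3).
have t4 : rmem s4 11 [::] = us (draws s) * rank_weight U j by rewrite -t3.
have b4 : nmem s4 12 [::] = 0%N by [].
have K4 : kept (draws s).+1 s4 by apply: keep same4 _ isT isT K3.
have f4 (c : 'I_r) : rmem s4 10 [:: val c] = 1 by rewrite same4.2.
clearbody s4.
set s5 := (X in exec _ (exec _ (exec _ (exec _ X)))).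
have same5 : same_off (nwrites descend_cmd) (rwrites descend_cmd) s4 s5 by exact: run_same_off.
have in4 := in_cell_in_row W0 hu; rewrite -t4 in in4.
have [q4 _ _ _] := K4; have [f5 b5] := descend_cmd_ok q4 f4 b4 in4; rewrite -/s5 in f5 b5.
have K5 : kept (draws s).+1 s5 by apply: keep same5 _ isT isT K4; exact: run_draws.
clearbody s5; set x := row_ord _ _ in f5 *; set A := design U j in f5 *.
set s6 := (X in exec _ (exec _ (exec _ X))).
have same6 : same_off [:: 26; 27] [:: 12] s5 s6 by exact: sum2_same.
have t6 : rmem s6 12 [::] = leverage A x.
  have [[[[[_ hr _ _] _ _] _ _ _] _ _ h6 _] _ _ _] := K5.
  rewrite /s6 (@run_sum2 R eig us 26 27 eR eR 12 _ s5 r r (fun a b =>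
    rmem s5 6 [:: a; b] * (rmem s5 10 [:: a] * rmem s5 10 [:: b]))) //.
  - rewrite leverage_row_form; apply: eq_bigr => c _; apply: eq_bigr => e _.
    by rewrite !mul1r; congr (_ * (_ * _)); [apply: h6|apply: f5|apply: f5].
  - by move=> s' hs'; rewrite /= (hs'.1 1%N).
  by move=> a b s' _ _ hs' hx hy; rewrite /= hx hy (hs'.2 6%N) // (hs'.2 10%N).
have K6 : kept (draws s).+1 s6 by apply: keep same6 _ isT isT K5; exact: run_draws.
have b6 : nmem s6 12 [::] = (\sum_(k <- other_modes j) i k * stride I k)%N by rewrite same6.1.
have f6 (c : 'I_r) : rmem s6 10 [:: val c] = A x c by rewrite same6.2.
clearbody s6.
set s7 := (X in exec _ (exec _ X)).
have same7 : same_off [::] [:: 13] s6 s7 by exact: (run_same_off eig us (RSet 13 [::] _) s6).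
have t7 : rmem s7 13 [::] = sample_weight U x.
  have [[[[[_ _ hJ _] _ _] _ _ _] _ _ _ h7] _ _ _] := K6.
  by rewrite /sample_weight -h7 -t6 -hJ.
have [q7 d7 k7 l7] : kept (draws s).+1 s7 by apply: keep same7 _ isT isT K6.
have b7 : nmem s7 12 [::] = (\sum_(k <- other_modes j) i k * stride I k)%N by rewrite same7.1.
have f7 (c : 'I_r) : rmem s7 10 [:: val c] = A x c by rewrite same7.2.
clearbody s7.
set s8 := (X in exec _ X).
have [k8 _] : filled s7 s8 8 r r (fun a b => [:: a; b]) (fun a b =>
    rmem s 8 [:: a; b] + sample_weight U x * (rmem s7 10 [:: a] * rmem s7 10 [:: b])).
  have [[[[_ hr _ _] _ _] _ _ _] _ _ _ _] := q7; apply: fill2_ok => //.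
  - by move=> s' hs'; rewrite /= (hs'.1 1%N).
  - by move=> a b a' b' [-> ->].
  move=> a b s' _ _ hs' hx hy hold _; rewrite /= hx hy hold k7.
  by rewrite (hs'.2 13%N) // t7 (hs'.2 10%N).
have same8 : same_off [:: 26; 27] [:: 8] s7 s8 by exact: fill2_same.
have t8 : rmem s8 13 [::] = sample_weight U x by rewrite same8.2.
have d8 : draws s8 = (draws s).+1 by rewrite -d7; exact: run_draws.
have b8 : nmem s8 12 [::] = (\sum_(k <- other_modes j) i k * stride I k)%N by rewrite same8.1.
have q8 : solver_ready U j s8 by exact: (solver_ready_same same8).
have f8 (c : 'I_r) : rmem s8 10 [:: val c] = A x c by rewrite same8.2.
have l8 c e : rmem s8 9 [:: c; e] = rmem s 9 [:: c; e] by rewrite same8.2.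
have {}k8 (c e : 'I_r) : rmem s8 8 [:: val c; val e] = rmem s 8 [:: val c; val e] +
    sample_weight U x * (A x c * A x e).
  by rewrite k8 ?ltn_ord // -!f7.
clearbody s8.
set s9 := exec _ s8.
have [l9 _] : filled s8 s9 9 r (I j) (fun a b => [:: a; b]) (fun a b =>
    rmem s 9 [:: a; b] + sample_weight U x * (rmem s8 10 [:: a] *
      rmem s8 0 [:: (\sum_(k <- other_modes j) i k * stride I k + b * stride I j)%N])).
  have [[[[_ hr _ _] hd _] ht _ _] hj _ _ _] := q8; have [hst _ _] := ht j.
  apply: fill2_ok => //.
  - by move=> s' hs'; rewrite /= (hs'.1 4%N) // (hs'.1 21%N) // hj hd.
  - by move=> a b a' b' [-> ->].
  move=> a b s' _ _ hs' hx hy hold _; rewrite /= hx hy hold l8.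
  rewrite (hs'.2 13%N) // t8 (hs'.2 10%N) // (hs'.2 0%N) // (hs'.1 12%N) // b8.
  by rewrite (hs'.1 21%N) // (hs'.1 5%N) // hj hst.
have same9 : same_off [:: 26; 25] [:: 9] s8 s9 by exact: fill2_same.
have d9 : draws s9 = (draws s).+1 by rewrite -d8; exact: run_draws.
have q9 : solver_ready U j s9 by exact: (solver_ready_same same9).
have k9 (c e : 'I_r) : rmem s9 8 [:: val c; val e] = rmem s 8 [:: val c; val e] +
    sample_weight U x * (A x c * A x e).
  by rewrite same9.2.
split; [exact: (solver_ready_same (same_off_refl [::] [::] s9))|by []|exact: k9|].
move=> c a; rewrite rmem_tick l9 ?ltn_ord //; congr (_ + _ * (_ * _)); first exact: f8.
(* The sampled row fixes all indices except that of mode [j]; completing it by [a] gives the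
   multi-index whose linear index is the offset plus [a] strides. *)
have [i' [i'u ia]] := row_mindex x a.
have [[[_ _ hT] _ _ _] _ _ _ _] := q8.
rewrite mxE -i'u -ia matricizeE -hT (linear_indexE j); congr (rmem s8 0 [:: (_ + _)%N]).
apply: eq_big_seq => k hk; congr (_ * _)%N; congr (val _).
by apply: (row_ord_inj _ hk); rewrite i'u.
Qed.

Lemma sum_lt_all m (F : 'I_m -> R) : \sum_(k < m | (k < m)%N) F k = \sum_k F k.
Proof. by apply: eq_bigl => k; rewrite ltn_ord. Qed.

Lemma same_off_comp ns1 rs1 ns2 rs2 ns rs s1 s2 s3 :
  same_off ns1 rs1 s1 s2 -> same_off ns2 rs2 s2 s3 ->
  all (mem ns) (ns1 ++ ns2) -> all (mem rs) (rs1 ++ rs2) -> same_off ns rs s1 s3.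
Proof.
rewrite !all_cat => h1 h2 /andP[n1 n2] /andP[r1 r2].
exact: (same_off_trans (same_off_sub h1 n1 r1) (same_off_sub h2 n2 r2)).
Qed.

(** * The sketched normal equations and the factor update *)

Section Sketched.
Variables (U : factors R I r) (j : 'I_N) (x : {ffun 'I_J -> 'I_(rows_but I j)}).
Let A := design U j.
Let B := (matricize T j)^T.
Let S := sketch A x.

Lemma samples_ok s : solver_ready U j s -> 0 < rank_weight U j ->
  (forall t : 'I_J, in_cell (leverage_prob A) (x t) (us (draws s + t)%N)) ->
  (forall c e : 'I_r, rmem s 8 [:: val c; val e] = 0) ->
  (forall (c : 'I_r) (a : 'I_(I j)), rmem s 9 [:: val c; val a] = 0) ->
  let s' := exec (For 22 eJ sample_cmd) s in
  [/\ solver_ready U j s', draws s' = (draws s + J)%N,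
      forall c e : 'I_r, rmem s' 8 [:: val c; val e] = ((S *m A)^T *m (S *m A)) c e
    & forall (c : 'I_r) (a : 'I_(I j)),
        rmem s' 9 [:: val c; val a] = ((S *m A)^T *m (S *m B)) c a].
Proof.
move=> hs W0 hx h8 h9.
pose Q n s2 := [/\ solver_ready U j s2, draws s2 = (draws s + n)%N,
  forall c e : 'I_r, rmem s2 8 [:: val c; val e] =
    \sum_(t < J | (t < n)%N) sample_weight U (x t) * (A (x t) c * A (x t) e)
  & forall (c : 'I_r) (a : 'I_(I j)), rmem s2 9 [:: val c; val a] =
    \sum_(t < J | (t < n)%N) sample_weight U (x t) * (A (x t) c * B (x t) a)].
have wE t : sample_weight U (x t) = J%:R^-1 * (leverage_prob A (x t))^-1.
  by rewrite /sample_weight /leverage_prob invf_div invfM mulrCA mulrC.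
have [] : Q J (exec (For 22 eJ sample_cmd) s).
  have [[[[_ _ hJ _] _ _] _ _ _] _ _ _ _] := hs.
  apply: (@run_for_ind R eig us 22 eJ _ s J Q hJ).
    split; first exact: (solver_ready_same (same_off_refl [::] [::] (tick _ s))).
    - by rewrite addn0.
    - by move=> c e; rewrite big_pred0 // rmem_tick h8.
    by move=> c e; rewrite big_pred0 // rmem_tick h9.
  move=> n s2 nJ [q1 q2 q3 q4]; set s3 := enter 22 n s2.
  have same3 : same_off [:: 22] [::] s2 s3.
    by apply: same_enter.
  have hs3 : solver_ready U j s3 by exact: (solver_ready_same same3).
  have d3 : draws s3 = (draws s + n)%N by [].
  rewrite -[rmem s2]/(rmem s3) in q3 q4; clearbody s3.
  have hc : in_cell (leverage_prob (design U j)) (x (Ordinal nJ)) (us (draws s3)).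
    by rewrite d3; apply: (hx (Ordinal nJ)).
  have [g1 g2 g3 g4] := sample_cmd_ok hs3 W0 hc.
  split; first exact: g1.
  - by rewrite g2 d3 addnS.
  - by move=> c e; rewrite g3 q3 (big_ltS _ _ (Ordinal nJ)).
  by move=> c e; rewrite g4 q4 (big_ltS _ _ (Ordinal nJ)).
move=> g1 g2 g3 g4; split=> // [c e|c a].
  rewrite g3 sum_lt_all sketch_gram mxE summxE big_distrr; apply: eq_bigr => t _.
  by rewrite wE !mxE big_ord1 !mxE /= !mulrA.
rewrite g4 sum_lt_all sketch_gram mxE summxE big_distrr; apply: eq_bigr => t _.
by rewrite wE !mxE big_ord1 !mxE /= !mulrA.
Qed.

End Sketched.

(** A zero column has norm zero and is divided by it; program and [normalize_columns] share the
    convention [0 / 0 = 0], so no test is made. *)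
Lemma factor_cmd_ok U j (M : 'M[R]_r) (Rh : 'M[R]_(r, I j)) s : solver_ready U j s ->
  (forall c e : 'I_r, rmem s 8 [:: val c; val e] = M c e) ->
  (forall (c : 'I_r) (a : 'I_(I j)), rmem s 9 [:: val c; val a] = Rh c a) ->
  let V := (pinv M *m Rh)^T in let s' := exec factor_cmd s in
  ready (eqtype.dfwith U (normalize_columns V)) s' /\
  forall c : 'I_r, rmem s' 2 [:: val c] = column_norms V 0 c.
Proof.
move=> [[hp ht hU hG] hj _ _ _] h8 h9 V; rewrite /factor_cmd !run_seqs_cons run_seqs_nil.
have VE a c : V a c = \sum_x pinv M c x * Rh x a by rewrite /V mxE mxE.
have [[_ hr _ _] hd _] := hp.
set s1 := (X in exec _ (exec _ (exec _ (exec _ (exec _ (exec _ (exec _ X))))))).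
have same1 : same_off [::] [:: 14] s s1 by exact: (run_same_off eig us (Pinv 14 8 eR) s).
have p1 (c e : 'I_r) : rmem s1 14 [:: val c; val e] = pinv M c e.
  rewrite /s1 (@run_pinv_ok 14 8 eR s r hr); congr (pinv _ _ _).
  by apply/matrixP => c' e'; rewrite mxE h8.
clearbody s1.
set s2 := (X in exec _ (exec _ (exec _ (exec _ (exec _ (exec _ X)))))).
have dim_ok ns rs s' : same_off ns rs s s' -> [&& 1 \notin ns, 4 \notin ns & 21 \notin ns]%N ->
    neval s' (eDim (nv 21)) = I j /\ neval s' eR = r /\ nmem s' 21 [::] = j.
  by move=> hs /and3P[n1 n4 n21]; rewrite /= !hs.1 // hj hd.
have inj2 a b a' b' : [:: val j; a; b] = [:: val j; a'; b'] -> (a < I j)%N -> (b < r)%N ->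
    (a' < I j)%N -> (b' < r)%N -> a = a' /\ b = b' by move=> [-> ->].
have inj1 a b a' b' : [:: b] = [:: b'] -> (a < 1)%N -> (b < r)%N -> (a' < 1)%N ->
    (b' < r)%N -> a = a' /\ b = b'.
  by move=> [->]; rewrite !ltnS !leqn0 => /eqP -> _ /eqP ->.
have off_j iy : head N iy != j -> forall a' b', (a' < I j)%N -> (b' < r)%N ->
    iy <> [:: val j; a'; b'].
  by move=> h a' b' _ _ iyE; rewrite iyE eqxx in h.
have [z2 o2] : filled s1 s2 1 (I j) r (fun a b => [:: val j; a; b]) (fun _ _ => 0).
  have [e1 [e2 e3]] := dim_ok _ _ _ same1 isT.
  apply: fill2_ok => //; first by move=> s' hs'; rewrite -[LHS]/(nmem s' 1 [::]) (hs'.1 1%N).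
  by move=> a b s' _ _ hs' hx hy _ _; rewrite /= hx hy (hs'.1 21%N) // e3.
have same2 : same_off [:: 25; 26] [:: 14; 1] s s2.
  exact: (same_off_comp same1 (fill2_same _ _ _ _ _ _ _ s1)).
have p2 (c e : 'I_r) : rmem s2 14 [:: val c; val e] = pinv M c e by rewrite -p1 /s2 run_rframe.
have {}o2 iy : head N iy != j -> rmem s2 1 iy = rmem s 1 iy.
  by move=> /off_j /o2 ->; rewrite same1.2.
clearbody s2 => {same1 p1}.
set s3 := (X in exec _ (exec _ (exec _ (exec _ (exec _ X))))).
pose Q n s' :=
  (forall (a : 'I_(I j)) (c : 'I_r), rmem s' 1 [:: val j; val a; val c] =
     \sum_(y < r | (y < n)%N) pinv M c y * Rh y a) /\
  (forall iy, head N iy != j -> rmem s' 1 iy = rmem s 1 iy).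
have [v3 o3] : Q r s3.
  have [_ [hr2 _]] := dim_ok _ _ _ same2 isT.
  apply: (@run_for_frame_ind R eig us 23 eR _ s2 r Q hr2).
    by split=> // a c; rewrite big_pred0 // rmem_tick z2 ?ltn_ord.
  move=> n s' nr hs' [q1 q2]; set s4 := enter 23 n s'.
  have same4 : same_off [:: 23; 25; 26] [:: 14; 1] s s4.
    by apply: same_enter => //; apply: (same_off_comp same2 hs').
  have p4 (c e : 'I_r) : rmem s4 14 [:: val c; val e] = pinv M c e by rewrite -p2 -hs'.2.
  have v4 : nmem s4 23 [::] = n by [].
  rewrite -[rmem s']/(rmem s4) in q1 q2; clearbody s4.
  have [e1 [e2 e3]] := dim_ok _ _ _ same4 isT.
  set ff := fill2 _ _ _ _ _ _ _.
  have [g1 g2] : filled s4 (exec ff s4) 1 (I j) r (fun a b => [:: val j; a; b])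
     (fun a b => rmem s4 1 [:: val j; a; b] + rmem s4 14 [:: b; n] * rmem s4 9 [:: n; a]).
    apply: fill2_ok => //; first by move=> s5 hs5; rewrite -[LHS]/(nmem s5 1 [::]) (hs5.1 1%N).
    move=> a b s5 _ _ hs5 hx hy hold _; rewrite /= hx hy (hs5.1 21%N) // e3 hold.
    by rewrite (hs5.1 23%N) // v4 (hs5.2 14%N) // (hs5.2 9%N).
  split=> [a c|iy hiy]; last by rewrite g2 ?q2 //; apply: off_j.
  rewrite g1 ?ltn_ord // q1 (big_ltS _ _ (Ordinal nr)); congr (_ + _ * _); first exact: p4 _ (Ordinal nr).
  by rewrite same4.2 //; apply: h9 (Ordinal nr) a.
have same3 : same_off [:: 23; 25; 26] [:: 14; 1] s s3.
  exact: (same_off_comp same2 (run_same_off _ _ _ _)).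
have {}v3 (a : 'I_(I j)) (c : 'I_r) : rmem s3 1 [:: val j; val a; val c] = V a c.
  by rewrite v3 VE sum_lt_all.
clearbody s3 => {same2 p2 z2 o2 Q}.
set s4 := (X in exec _ (exec _ (exec _ (exec _ X)))).
have [z4 _] : filled s3 s4 2 1 r (fun _ b => [:: b]) (fun _ _ => 0).
  apply: fill2_ok => //; last by move=> a b s' _ _ hs' hx hy _ _; rewrite /= hy.
  move=> s' hs'; rewrite -[LHS]/(nmem s' 1 [::]) (hs'.1 1%N) //.
  by have [_ [h _]] := dim_ok _ _ _ same3 isT.
have same4 : same_off [:: 23; 25; 26; 29] [:: 14; 1; 2] s s4.
  exact: (same_off_comp same3 (fill2_same _ _ _ _ _ _ _ s3)).
have r4 : rmem s4 1 = rmem s3 1 by rewrite /s4 run_rframe.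
rewrite -r4 in v3 o3; clearbody s4 => {same3 r4}.
set s5 := (X in exec _ (exec _ (exec _ X))).
have same45 : same_off _ _ s4 s5 := run_same_off _ _ _ _.
rewrite [nwrites _]/= [rwrites _]/= in same45.
pose Q n s' := forall c : 'I_r, rmem s' 2 [:: val c] = \sum_(a < I j | (a < n)%N) V a c * V a c.
have n5 : Q (I j) s5.
  have [hj4 [hr4 hjj4]] := dim_ok _ _ _ same4 isT.
  apply: (@run_for_frame_ind R eig us 25 _ _ s4 (I j) Q hj4).
    by move=> c; rewrite big_pred0 // rmem_tick (z4 0%N) ?ltn_ord.
  move=> n s' nI hs' q; set s6 := enter 25 n s'.
  have same6 : same_off [:: 25; 29; 26] [:: 2] s4 s6.
    by apply: same_enter => //; apply: (same_off_sub hs').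
  have v6 : nmem s6 25 [::] = n by [].
  rewrite /Q -[rmem s']/(rmem s6) in q; clearbody s6.
  set ff := fill2 _ _ _ _ _ _ _.
  have [g1 _] : filled s6 (exec ff s6) 2 1 r (fun _ b => [:: b])
     (fun _ b => rmem s6 2 [:: b] + rmem s4 1 [:: val j; n; b] * rmem s4 1 [:: val j; n; b]).
    apply: fill2_ok => //.
      by move=> s7 hs7; rewrite -[LHS]/(nmem s7 1 [::]) (hs7.1 1%N) // same6.1.
    move=> a b s7 _ _ hs7 hx hy hold _; rewrite /= hy hold.
    rewrite (hs7.1 25%N) // v6 (hs7.1 21%N) // same6.1 // hjj4.
    by rewrite (hs7.2 1%N) // (same6.2 1%N).
  by move=> c; rewrite (g1 0%N) ?ltn_ord // q (big_ltS _ _ (Ordinal nI)) -(v3 (Ordinal nI) c).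
have same5 : same_off [:: 23; 25; 26; 29] [:: 14; 1; 2] s s5.
  exact: (same_off_comp same4 same45).
have {}v3 (a : 'I_(I j)) (c : 'I_r) : rmem s5 1 [:: val j; val a; val c] = V a c.
  by rewrite same45.2.
have {}o3 iy : head N iy != j -> rmem s5 1 iy = rmem s 1 iy by rewrite same45.2 //; apply: o3.
clearbody s5 => {same4 same45 z4}.
set s6 := (X in exec _ (exec _ X)).
have [e5 [e5' e5'']] := dim_ok _ _ _ same5 isT.
have [c6 _] : filled s5 s6 2 1 r (fun _ b => [:: b]) (fun _ b => Num.sqrt (rmem s5 2 [:: b])).
  apply: fill2_ok => //; first by move=> s' hs'; rewrite -[LHS]/(nmem s' 1 [::]) (hs'.1 1%N).
  by move=> a b s' _ _ hs' hx hy hold _; rewrite /= hy hold.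
have same56 : same_off [:: 29; 26] [:: 2] s5 s6 by exact: fill2_same.
have same6 : same_off [:: 23; 25; 26; 29] [:: 14; 1; 2] s s6.
  exact: (same_off_comp same5 same56).
have {}c6 (c : 'I_r) : rmem s6 2 [:: val c] = column_norms V 0 c.
  rewrite (c6 0%N) ?ltn_ord // mxE /frob n5 sum_lt_all; congr Num.sqrt.
  by apply: eq_bigr => a _; rewrite big_ord1 [col _ _ _ _]mxE expr2.
rewrite -(same56.2 1%N) // in v3 o3; clearbody s6 => {same5 same56 n5 Q e5 e5' e5''}.
have [e6 [e6' e6'']] := dim_ok _ _ _ same6 isT.
set s7 := (X in exec _ X).
have [v7 o7] : filled s6 s7 1 (I j) r (fun a b => [:: val j; a; b])
    (fun a b => rmem s6 1 [:: val j; a; b] / rmem s6 2 [:: b]).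
  apply: fill2_ok => //; first by move=> s' hs'; rewrite -[LHS]/(nmem s' 1 [::]) (hs'.1 1%N).
  move=> a b s' _ _ hs' hx hy hold _; rewrite /= hx hy (hs'.1 21%N) // e6'' hold.
  by rewrite (hs'.2 2%N).
have same67 : same_off [:: 25; 26] [:: 1] s6 s7 by exact: fill2_same.
have same7 : same_off [:: 23; 25; 26; 29] [:: 14; 1; 2] s s7.
  exact: (same_off_comp same6 same67).
have {}c6 (c : 'I_r) : rmem s7 2 [:: val c] = column_norms V 0 c by rewrite same67.2 // -c6.
have {}v7 (a : 'I_(I j)) (c : 'I_r) : rmem s7 1 [:: val j; val a; val c] = normalize_columns V a c.
  by rewrite v7 ?ltn_ord // v3 -(same67.2 2%N) // [RHS]mxE -c6.
have {}o7 iy : head N iy != j -> rmem s7 1 iy = rmem s 1 iy.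
  by move=> hiy; rewrite o7 ?o3 //; apply: off_j.
clearbody s7 => {same6 same67 v3 o3 e6 e6' e6''}.
have [e7 [e7' e7'']] := dim_ok _ _ _ same7 isT.
have hp7 : params s7 by exact: (params_same same7).
have ht7 : tables s7 by exact: (tables_same same7).
set U' := eqtype.dfwith _ _.
have hU7 : stores_factors U' s7.
  move=> k a c; rewrite /U'; have [kj|kj] := eqVneq k j.
    by subst k; rewrite eqtype.dfwith_in.
  by rewrite eqtype.dfwith_out 1?eq_sym // o7 ?hU // (inj_eq val_inj).
have [g1 g2] := grams_cmd_ok (isT : 21%N \in [:: 21%N; 28%N]) hp7 e7'' (hU7 j).
set s8 := exec _ s7 in g1 g2 *.
have same8 : same_off [:: 26; 27; 25] [:: 3] s7 s8.
  exact: (same_off_sub (run_same_off eig us (grams_cmd 21) s7)).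
split; last by move=> c; rewrite rmem_tick same8.2.
split; [exact: (params_same same8)|exact: (tables_same same8)|exact: (stores_same same8)|].
move=> k t c e tk; rewrite rmem_tick; have [kj|kj] := eqVneq k j.
  by subst k; apply: g1.
rewrite g2 /= ?(inj_eq val_inj) // same7.2 // hG // /U'.
by rewrite /gram_prefix eqtype.dfwith_out 1?eq_sym.
Qed.

Definition stores_coef (W : cp R I r) s : Prop := forall c : 'I_r, rmem s 2 [:: val c] = coef W 0 c.

Notation update := (als_update (@pinv_solver R) T).

(** Here [n] counts the draws already consumed, [J] per solve. Cells of later solves are those of
    the factors updated along [p], hence fixed by [p] alone. *)
Fixpoint hits (W : cp R I r) n (p : seq (solve_sample I J)) : Prop :=
  match p with
  | [::] => True
  | x :: p' =>
      (forall t : 'I_J,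
         in_cell (leverage_prob (design (fac W) (tag x))) (tagged x t) (us (n + t)%N)) /\
      hits (update W x) (n + J) p'
  end.

Lemma hits_cat W n p1 p2 : hits W n (p1 ++ p2) <->
  hits W n p1 /\ hits (als_run (@pinv_solver R) T W p1) (n + size p1 * J) p2.
Proof.
elim: p1 W n => [|x p1 IH] W n /=; first by rewrite addn0; split=> // -[].
by rewrite IH mulSn addnA and_assoc.
Qed.

Lemma nonzero_designs_cat (lsq : solver R) (W : cp R I r) (p1 p2 : seq (solve_sample I J)) :
  nonzero_designs lsq T W (p1 ++ p2) <->
  nonzero_designs lsq T W p1 /\ nonzero_designs lsq T (als_run lsq T W p1) p2.
Proof.
elim: p1 W => [|x p1 IH] W /=; first by split=> // -[].
by rewrite IH and_assoc.
Qed.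

Lemma solve_cmd_ok W (x : solve_sample I J) s : ready (fac W) s -> nmem s 21 [::] = tag x ->
  design (fac W) (tag x) != 0 ->
  (forall t : 'I_J,
     in_cell (leverage_prob (design (fac W) (tag x))) (tagged x t) (us (draws s + t)%N)) ->
  let s' := exec solve_cmd s in
  [/\ ready (fac (update W x)) s', stores_coef (update W x) s' & draws s' = (draws s + J)%N].
Proof.
move=> hs hj A0 hx.
have runs3 c1 c2 c3 : exec (seqs [:: c1; c2; c3]) s = tick 1 (exec c3 (exec c2 (exec c1 s))).
  by [].
rewrite /solve_cmd runs3; set s1 := (X in exec factor_cmd (exec _ X)).
have [h1 h8 h9] := setup_cmd_ok hs hj; rewrite -/s1 in h1 h8 h9.
have d1 : draws s1 = draws s by exact: run_draws.
rewrite -d1 in hx; clearbody s1; set s2 := (X in exec factor_cmd X).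
have [h2 d2 h8' h9'] := samples_ok h1 (sum_leverage_gt0 A0) hx h8 h9.
rewrite -/s2 in h2 d2 h8' h9'; clearbody s2.
have [h3 c3] := factor_cmd_ok h2 h8' h9'; set s3 := exec _ s2 in h3 c3 *.
have d3 : draws s3 = draws s2 by exact: run_draws.
have VE : (pinv ((sketch (design (fac W) (tag x)) (tagged x) *m design (fac W) (tag x))^T *m
     (sketch (design (fac W) (tag x)) (tagged x) *m design (fac W) (tag x))) *m
   ((sketch (design (fac W) (tag x)) (tagged x) *m design (fac W) (tag x))^T *m
     (sketch (design (fac W) (tag x)) (tagged x) *m (matricize T (tag x))^T)))^T =
  (pinv_solver (sketch (design (fac W) (tag x)) (tagged x) *m design (fac W) (tag x))
     (sketch (design (fac W) (tag x)) (tagged x) *m (matricize T (tag x))^T))^T.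
  by rewrite /pinv_solver mulmxA.
rewrite VE in h3 c3; by split=> //; rewrite [LHS]d3 d2 d1.
Qed.

Lemma ready_enter U x k s : (7 < x)%N -> ready U s -> ready U (enter x k s).
Proof.
move=> x7; have h := same_enter k (same_off_refl [:: x] [::] s) (mem_head _ _).
by apply: (ready_same h); rewrite //= x7.
Qed.

Definition run_modes (l : seq nat) s : state R :=
  foldl (fun s' k => exec solve_cmd (enter 21 k s')) s l.

Lemma run_modes_cons k l s : run_modes (k :: l) s = run_modes l (exec solve_cmd (enter 21 k s)).
Proof. by []. Qed.

Lemma als_run_cons (lsq : solver R) (W : cp R I r) x (p : seq (solve_sample I J)) :
  als_run lsq T W (x :: p) = als_run lsq T (als_update lsq T W x) p.
Proof. by []. Qed.

(** Array 2 starts with arbitrary content, so the coefficients are correct only if they were already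
    or at least one solve has run. *)
Lemma run_modes_ok W (p : seq (solve_sample I J)) s : ready (fac W) s ->
  nonzero_designs (@pinv_solver R) T W p -> hits W (draws s) p ->
  let s' := run_modes [seq val (tag x) | x <- p] s in
  let W' := als_run (@pinv_solver R) T W p in
  [/\ ready (fac W') s', draws s' = (draws s + size p * J)%N
    & stores_coef W s \/ p != [::] -> stores_coef W' s'].
Proof.
elim: p W s => [|x p IH] W s hs.
  by move=> _ _; split=> //; [rewrite mul0n addn0|case].
move=> [A0 h0] [hx hp]; rewrite map_cons run_modes_cons als_run_cons; set s1 := enter 21 (tag x) s.
have r1 : ready (fac W) s1 by apply: ready_enter.
have [q1 q2 q3] := solve_cmd_ok r1 (erefl : nmem s1 21 [::] = tag x) A0 hx.
rewrite -[draws s1]/(draws s) in q3.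
have hp' : hits (update W x) (draws (exec solve_cmd s1)) p by rewrite q3.
have [g1 g2 g3] := IH _ _ q1 h0 hp'.
split; [exact: g1|by rewrite g2 q3 mulSn addnA|].
by move=> _; apply: g3; left.
Qed.

Definition rounds (l : seq nat) s : state R :=
  foldl (fun s' k => exec (For 21 eN solve_cmd) (enter 20 k s')) s l.

Lemma rounds_cons k l s :
  rounds (k :: l) s = rounds l (exec (For 21 eN solve_cmd) (enter 20 k s)).
Proof. by []. Qed.

Lemma rounds_ok W (l : seq nat) (p : seq (solve_sample I J)) s : ready (fac W) s ->
  als_path (size l) p -> nonzero_designs (@pinv_solver R) T W p -> hits W (draws s) p ->
  let s' := rounds l s in let W' := als_run (@pinv_solver R) T W p in
  ready (fac W') s' /\ (stores_coef W s \/ l != [::] -> stores_coef W' s').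
Proof.
elim: l W p s => [|k l IH] W p s hs.
  by case: p => // _ _ _; split=> // -[].
rewrite /als_path [flatten _]/= => hp; rewrite rounds_cons -(cat_take_drop N p) nonzero_designs_cat hits_cat.
have sz : size (take N p) = N.
  have : size [seq tag x | x <- p] = (N + size (flatten (nseq (size l) (enum 'I_N))))%N.
    by rewrite hp size_cat size_enum_ord.
  by rewrite size_map size_take => ->; case: ltngtP => //; lia.
have hp1 : [seq tag x | x <- take N p] = enum 'I_N.
  by rewrite map_take hp take_size_cat // size_enum_ord.
have hp2 : als_path (size l) (drop N p).
  by rewrite /als_path map_drop hp drop_size_cat // size_enum_ord.
move=> [z1 z2] [h1 h2]; set p1 := take N p in sz hp1 z1 z2 h1 h2 *; set p2 := drop N p in hp2 z2 h2 *.
set s1 := enter 20 k s.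
have r1 : ready (fac W) s1 by apply: ready_enter.
set s2 := tick (1 + ncost eN) s1.
have r2 : ready (fac W) s2 by apply: (ready_same (same_off_refl [::] [::] s2)).
have d2 : draws s2 = draws s by [].
have E : exec (For 21 eN solve_cmd) s1 = run_modes [seq val (tag x) | x <- p1] s2.
  rewrite run_for -/s2; congr (foldl _ _ _).
  rewrite (map_comp val (@tag _ _)) hp1 val_enum_ord.
  by have [[[hN _ _ _] _ _] _ _ _] := r1; rewrite [neval _ _]hN.
rewrite -d2 in h1 h2; have [g1 g2 g3] := run_modes_ok r2 z1 h1; rewrite -E in g1 g2 g3.
rewrite -g2 in h2; have [g4 g5] := IH _ _ _ g1 hp2 z2 h2.
rewrite /als_run foldl_cat; split; first exact: g4.
move=> _; apply: g5; left; apply: g3; right.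
by rewrite -size_eq0 sz -lt0n.
Qed.

(** The coefficient [0] of the initial state is a placeholder that no update reads; with at least
    one round and one mode it is overwritten. *)
Lemma als_cmd_ok U0 (p : seq (solve_sample I J)) s : als_input T U0 J it s -> (0 < it)%N ->
  als_path it p -> nonzero_designs (@pinv_solver R) T (CP U0 0) p -> hits (CP U0 0) 0 p ->
  als_output (als_run (@pinv_solver R) T (CP U0 0) p) (exec als_cmd s).
Proof.
move=> [h0 h4 hT hU [hd _]] it0 hp hz hh.
have hp0 : params s by [].
have h1 : ready U0 (exec init_cmd s) by exact: init_cmd_ok.
have d1 : draws (exec init_cmd s) = 0%N by rewrite run_draws.
rewrite /als_cmd run_seq; set s1 := exec init_cmd s in h1 d1 *.
rewrite run_for; set s2 := tick _ s1.
have h2 : ready (fac (CP U0 0)) s2 by apply: (ready_same (same_off_refl [::] [::] s2)).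
have d2 : draws s2 = 0%N by [].
set W0 := CP U0 0 in hz hh h2 *; rewrite -d2 in hh.
have -> : neval s1 eIt = size (iota 0 it).
  by rewrite size_iota; have [[[_ _ _ hi] _ _] _ _ _] := h1.
rewrite -(size_iota 0 it) in hp; have [g1 g2] := rounds_ok h2 hp hz hh.
rewrite size_iota; split; first by have [_ _ + _] := g1.
by apply: g2; right; rewrite -size_eq0 size_iota -lt0n.
Qed.

End Correctness.

(** * Law of the sampled path *)

Section CellLaw.
Variables (R : realType) (m : nat) (q : 'I_m -> R).
Hypothesis q_ge0 : forall i, 0 <= q i.

Lemma cdf_step_le (i i' : 'I_m) : (i < i')%N -> cdf q i + q i <= cdf q i'.
Proof.
move=> ii; rewrite /cdf -big_ltS big_mkcond [X in _ <= X]big_mkcond; apply: ler_sum => k _.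
by case: ifP => [ki|_]; [rewrite (leq_trans ki)|case: ifP].
Qed.

Lemma in_cell_inj i i' v : in_cell q i v -> in_cell q i' v -> i = i'.
Proof.
move=> /andP[h1 h2] /andP[h3 h4]; apply/eqP; rewrite -(inj_eq val_inj) eq_le !leEnat.
by apply/andP; split; rewrite leqNgt; apply/negP => /cdf_step_le; clear - h1 h2 h3 h4; lra.
Qed.

Lemma cdf_ge0 i : 0 <= cdf q i. Proof. exact: sumr_ge0. Qed.

Lemma cdf_step_le_total i : cdf q i + q i <= \sum_k q k.
Proof.
rewrite /cdf -big_ltS big_mkcond; apply: ler_sum => k _.
by case: ifP.
Qed.

End CellLaw.

Lemma uniform_prob_itvco (R : realType) (a b : R) : 0 <= a -> a <= b -> b <= 1 ->
  uniform_prob (@ltr01 R) `[a, b[%classic = (b - a)%:E.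
Proof.
move=> a0 ab b1; rewrite /uniform_prob.
transitivity (\int[lebesgue_measure]_(x in `[a, b[%classic) (cst 1%:E : R -> \bar R) x)%E.
  apply: eq_integral => x; rewrite inE /= in_itv /= => /andP[ax xb].
  by rewrite /uniform_pdf subr0 invr1 ifT //; apply/andP; split; lra.
rewrite integral_cst //= mul1e lebesgue_measure_itv /= lte_fin.
case: ltP => // ba; congr (_%:E); lra.
Qed.

Section PathLaw.
Variables (R : realType) (N : nat) (I : 'I_N -> nat) (r : nat) (T : tensor R I) (J : nat).
Implicit Types (W : cp R I r) (p : seq (solve_sample I J)).
Notation update := (als_update (@pinv_solver R) T).

Definition cell W (x : solve_sample I J) (t : 'I_J) : set R :=
  [set` `[cdf (leverage_prob (design (fac W) (tag x))) (tagged x t),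
          cdf (leverage_prob (design (fac W) (tag x))) (tagged x t) +
          leverage_prob (design (fac W) (tag x)) (tagged x t)[].

Fixpoint cells W p : seq (set R) :=
  match p with
  | [::] => [::]
  | x :: p' => [seq cell W x t | t <- enum 'I_J] ++ cells (update W x) p'
  end.

Lemma hits_cells us W n p : hits us T W n p <->
  forall k, (k < size (cells W p))%N -> nth set0 (cells W p) k (us (n + k)%N).
Proof.
elim: p W n => [|x p IH] W n //=.
have szE : size [seq cell W x t | t <- enum 'I_J] = J by rewrite size_map size_enum_ord.
have nthE (t : 'I_J) : nth set0 [seq cell W x t | t <- enum 'I_J] t = cell W x t.
  by rewrite (nth_map t) ?size_enum_ord // nth_ord_enum.
split=> [[h1 h2] k|h].
  rewrite size_cat nth_cat szE; case: (ltnP k J) => kJ.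
    by move=> _; rewrite (nthE (Ordinal kJ)) /cell /= in_itv; exact: (h1 (Ordinal kJ)).
  move=> kS; have /IH/(_ (k - J)%N) := h2.
  by rewrite -addnA subnKC //; apply; lia.
split=> [t|].
  have := h t; rewrite nth_cat szE ltn_ord nthE /cell /= in_itv; apply.
  by rewrite size_cat szE ltn_addr.
apply/IH => k kS; have := h (J + k)%N; rewrite size_cat szE ltn_add2l => /(_ kS).
by rewrite nth_cat szE ltnNge leq_addr /= addKn addnA.
Qed.

Lemma measurable_cells W p k : measurable (nth set0 (cells W p) k).
Proof.
elim: p W k => [|x p IH] W k /=; first by rewrite nth_nil.
rewrite nth_cat; case: ifP => [|_]; last exact: IH.
rewrite size_map => kS; have kJ := kS; rewrite size_enum_ord in kJ.
by rewrite (nth_map (Ordinal kJ)) //; exact: measurable_itv.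
Qed.

(** Each cell is an interval inside [[0, 1)] of length equal to a row probability; a nonzero design
    makes the probabilities sum to 1, which keeps the last cell inside. *)
Lemma cells_prob W p : nonzero_designs (@pinv_solver R) T W p ->
  (\prod_(B <- cells W p) uniform_prob (@ltr01 R) B = (als_prob (@pinv_solver R) T W p)%:E)%E.
Proof.
elim: p W => [|x p IH] W /=; first by rewrite big_nil.
move=> [A0 h]; rewrite big_cat /= IH // EFinM; congr (_ * _)%E.
rewrite big_map big_enum /= /sample_prob.
rewrite (eq_bigr (fun t => (leverage_prob (design (fac W) (tag x)) (tagged x t))%:E)).
  by elim/big_rec2: _ => // t y1 y2 _ ->; rewrite EFinM.
move=> t _; rewrite uniform_prob_itvco.
- by rewrite addrAC subrr add0r.
- by apply: cdf_ge0 => i; apply: leverage_prob_ge0.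
- by rewrite lerDl leverage_prob_ge0.
by rewrite -(sum_leverage_prob A0) cdf_step_le_total // => i; apply: leverage_prob_ge0.
Qed.

(** Half-open cells are disjoint, so the draws determine the rows of the first solve; the updated
    factors then agree, and so do the next cells. *)
Lemma hits_inj us W n p p' : map (@tag _ _) p = map (@tag _ _) p' ->
  hits us T W n p -> hits us T W n p' -> p = p'.
Proof.
elim: p p' W n => [|[j f] p IH] [|[j' f'] p'] W n //= [jj pp] [h1 h2] [h3 h4].
subst j'; have ff : f = f'.
  apply/ffunP => t; apply: in_cell_inj (h1 t) (h3 t) => i; exact: leverage_prob_ge0.
by subst f'; congr (_ :: _); apply: IH h2 h4.
Qed.

Section Law.
Variables (d : measure_display) (Omega : measurableType d) (P : probability Omega R).
Variable u : nat -> {RV P >-> R}.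
Hypothesis iid_u : iid_uniform u.

Lemma hits_bigcap W p : [set w | hits (u^~ w) T W 0 p] =
  \bigcap_(k in [set` [fset k in iota 0 (size (cells W p))]%fset])
    (u k @^-1` nth set0 (cells W p) k).
Proof.
apply/seteqP; split=> w /=.
  by move=> /hits_cells h k /=; rewrite !inE mem_iota => /h.
move=> h; apply/hits_cells => k kS; apply: h => /=.
by rewrite !inE mem_iota.
Qed.

Lemma measurable_hits W p : measurable [set w | hits (u^~ w) T W 0 p].
Proof.
rewrite hits_bigcap; apply: fin_bigcap_measurable => [|k _]; first exact: finite_fset.
rewrite -[_ @^-1` _]setTI; apply: measurable_funP => //; exact: measurable_cells.
Qed.

(** For a fixed path the adaptively chosen cells form a deterministic list with one cell per draw,
    so the product rule for independent draws applies without conditioning. *)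
Lemma prob_hits W p : nonzero_designs (@pinv_solver R) T W p ->
  P [set w | hits (u^~ w) T W 0 p] = (als_prob (@pinv_solver R) T W p)%:E.
Proof.
move=> hz; rewrite hits_bigcap iid_u.2; last by move=> k; exact: measurable_cells.
rewrite -(cells_prob hz) (big_nth set0) /index_iota subn0.
rewrite (perm_big (iota 0 (size (cells W p)))) /=.
  by apply: eq_bigr => k _; rewrite -(proj1 iid_u k) //; exact: measurable_cells.
apply: uniq_perm; [exact: fset_uniq|exact: iota_uniq|].
by move=> k; rewrite !inE.
Qed.

End Law.

End PathLaw.

(** * Complexity *)

Section Complexity.
Variable R : realType.

Lemma ln2_ge_half : 2^-1 <= ln 2 :> R.
Proof.
have : ln (expR 1) <= ln 4 :> R by rewrite ler_ln ?posrE ?expR_gt0 // expR1_le4.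
have -> : 4 = 2 ^+ 2 :> R by ring.
by rewrite expRK lnXn // mulr2n; lra.
Qed.

(** The rounded logarithm less one is below [ln m / ln 2 <= 2 ln m], and the two missing units are
    absorbed in the constant 4. Taking the larger of [I j] and [r] as [m] yields the replacement of
    [log I_j] by [log R]. *)
Lemma up_log2_le n m : (0 < n)%N -> (n <= m)%N -> (up_log 2 n).+1%:R <= 4 * log1 m%:R :> R.
Proof.
move=> n0 nm; have m0 := leq_trans n0 nm; have l1 := log1_ge1 (m%:R : R).
case: (leqP n 1) => n1; first by rewrite (_ : up_log 2 n = 0%N) ?(eqP _) //; [lra|apply/eqP; rewrite up_log_eq0 n1].
have L0 : (0 < up_log 2 n)%N by rewrite up_log_gt0.
have h : ((up_log 2 n).-1)%:R * 2^-1 <= ln m%:R :> R.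
  apply: le_trans (_ : ((up_log 2 n).-1)%:R * ln 2 <= _); first by rewrite ler_wpM2l // ln2_ge_half.
  rewrite mulr_natl -lnXn // ler_ln ?posrE ?exprn_gt0 ?ltr0n ?m0 //.
  by rewrite -natrX ler_nat; apply: leq_trans nm; apply/ltnW/up_log_gtn.
have h2 := ln_le_log1 (m%:R : R).
rewrite -(prednK L0) -addn2 natrD; lra.
Qed.

(* The sampling cost of a mode is charged once in each of the [N] solves. *)
Lemma solve_time_sum N r J d L : (\sum_(j < N) solve_time N r J d L j =
  \sum_(j < N) (N * (r * (r * r)) + N * (J * ((L j).+1 * (r * r))) + J * (r * d j) +
    d j * (r * r)))%N.
Proof.
rewrite /solve_time; have h (F : nat -> nat) :
    (\sum_(j < N) J * \sum_(m < N) F m = \sum_(j < N) N * (J * F j))%N.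
  by rewrite sum_nat_const card_ord -!big_distrr.
have split4 (a b c e : 'I_N -> nat) : (\sum_(j < N) (a j + b j + c j + e j) =
    \sum_(j < N) a j + \sum_(j < N) b j + \sum_(j < N) c j + \sum_(j < N) e j)%N.
  by rewrite !big_split.
rewrite [LHS]split4 [RHS]split4; congr (_ + _ + _ + _)%N; exact: h (fun m => (L m).+1 * (r * r))%N.
Qed.

(** The constants combine as [257 * 4 = 1028] for sampling, [1029] with the remaining terms, and
    [4001 + 50000 * 1029], which is below [10^8]. *)
Lemma solve_time_le (N r J it d L : nat) (Z l : R) :
  (0 < r)%N -> (0 < it)%N -> 1 <= Z -> 1 <= l -> J%:R <= 257 * Z * r%:R -> L.+1%:R <= 4 * l ->
  (4001 * (d * (r * r)) + 500 * 100 * (it * (N * (r * (r * r)) +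
     N * (J * (L.+1 * (r * r))) + J * (r * d) + d * (r * r))))%:R <=
  100 * 1000 * 1000 * Z * it%:R * (N%:R * r%:R ^+ 3 * l + d%:R * r%:R ^+ 2) :> R.
Proof.
move=> r0 it0 Z1 l1 hJ hL.
pose a : R := N%:R * r%:R ^+ 3; pose b : R := d%:R * r%:R ^+ 2.
have a0 : 0 <= a by rewrite mulr_ge0 // exprn_ge0.
have b0 : 0 <= b by rewrite mulr_ge0 // exprn_ge0.
have Z0 : 0 <= Z by lra.
pose Q := Z * (a * l) + Z * b.
have al : a <= a * l by rewrite ler_peMr.
have al0 : 0 <= a * l by lra.
have q1 : a * l <= Z * (a * l) by rewrite ler_peMl.
have q2 : b <= Z * b by rewrite ler_peMl.
have h1 : N%:R * (J%:R * (L.+1%:R * (r%:R * r%:R))) <= 1028 * (Z * (a * l)).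
  have -> : 1028 * (Z * (a * l)) = N%:R * r%:R ^+ 2 * ((257 * Z * r%:R) * (4 * l)).
    by rewrite /a; ring.
  have -> : N%:R * (J%:R * (L.+1%:R * (r%:R * r%:R))) = N%:R * r%:R ^+ 2 * (J%:R * L.+1%:R) :> R.
    by ring.
  by rewrite ler_wpM2l ?ler_pM // mulr_ge0 // exprn_ge0.
have h2 : J%:R * (r%:R * d%:R) <= 257 * (Z * b).
  have -> : 257 * (Z * b) = 257 * Z * r%:R * (r%:R * d%:R) by rewrite /b; ring.
  by rewrite ler_wpM2r // mulr_ge0.
pose S : R := a + N%:R * (J%:R * (L.+1%:R * (r%:R * r%:R))) + J%:R * (r%:R * d%:R) + b.
have hS : S <= 1029 * Q by rewrite /S /Q; lra.
have Q0 : 0 <= Q by rewrite /Q; lra.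
have itR : 1 <= it%:R :> R by rewrite ler1n.
have hb : b <= it%:R * Q by apply: (@le_trans _ _ Q); rewrite ?ler_peMl // /Q; lra.
have hS' : it%:R * S <= 1029 * (it%:R * Q) by rewrite mulrCA ler_wpM2l.
rewrite natrD !natrM [X in 500 * 100 * (it%:R * X)](_ : _ = S); last first.
  by rewrite !natrD !natrM /S /a /b; ring.
rewrite [d%:R * _](_ : _ = b); last by rewrite /b; ring.
rewrite [X in _ <= X](_ : _ = 100 * 1000 * 1000 * (it%:R * Q)).
  have key (x y z : R) : z <= y -> x <= 1029 * y -> 0 <= y ->
    4001 * z + 500 * 100 * x <= 100 * 1000 * 1000 * y by lra.
  by apply: key => //; rewrite mulr_ge0.
by rewrite /Q /a /b; ring.
Qed.

End Complexity.

Lemma als_cmd_clock (R : realType) (eig : eig_routine R) us N (I : 'I_N -> nat) r (T : tensor R I)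
    (U0 : factors R I r) J it (s : state R) :
  (0 < N)%N -> (forall k, (0 < I k)%N) -> (0 < r)%N -> (0 < J)%N -> (0 < it)%N ->
  als_input T U0 J it s ->
  (clock (run eig us als_cmd s) <= \sum_(j < N) (4001 * (I j * (r * r)) + 500 * 100 * (it *
     (N * (r * (r * r)) + N * (J * ((up_log 2 (I j)).+1 * (r * r))) + J * (r * I j) +
      I j * (r * r)))))%N.
Proof.
move=> N0 I0 r0 J0 it0 [h0 h4 hT hU [_ hc]].
have hp : params r T J it s by [].
have [[[hN hr hJ hit] hd _] ht _ _] := init_cmd_ok eig us hp hU.
pose d k := nmem s 4 [:: k]; pose L k := nmem (run eig us init_cmd s) 7 [:: k].
have dE (j : 'I_N) : d j = I j by exact: h4.
have LE (j : 'I_N) : L j = up_log 2 (I j) by have [_ <- _] := ht j.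
have d0 k : (k < N)%N -> (0 < d k)%N by move=> kN; rewrite (dE (Ordinal kN)).
(* Before initialization array 7 is arbitrary. This environment contains its future values, as
   [time_init] expects, and agrees with memory on all cells that loop bounds of the initialization
   read. *)
pose nm : nenv := fun a iy => if a == 7%N then L (head 0%N iy) else nmem s a iy.
have nm_ok : env_ok N r J it d L nm by case: h0.
have nm_ok' : env_ok N r J it d L (nmem (run eig us init_cmd s)).
  by split=> // k kN; rewrite (hd (Ordinal kN)) (dE (Ordinal kN)).
have := time_main N0 r0 J0 it0 d0 nm_ok'; have := time_init N0 r0 J0 it0 d0 nm_ok.
set A := (4000 * _)%N; set B := (500 * 100 * _)%N => hA hB.
have h1 : (clock (run eig us init_cmd s) <= clock s + A)%N.
  apply: leq_trans (run_time (nm := nm) eig us _ _) _; rewrite ?leq_add2l //.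
  have /allP no7 : all (fun a : nat * bool => a.1 != 7%N) (bound_reads init_cmd) by [].
  by move=> a /no7 /negbTE a7 iy _; rewrite /nm a7.
have h2 : (clock (run eig us als_cmd s) <= clock s + A + B)%N.
  apply: leq_trans (_ : clock (run eig us init_cmd s) + B <= _)%N; last by rewrite leq_add2r.
  have run_time2 s1 := @run_time R eig us (For 20 eIt (For 21 eN solve_cmd)) s1 (nmem s1) isT
    (fun _ _ _ _ => erefl).
  by rewrite /als_cmd run_seq; apply: leq_trans (run_time2 _) _; rewrite leq_add2l.
apply: leq_trans h2 _; rewrite hc /A /B solve_time_sum !big_distrr -!big_split /=.
have le4001 a b : (a <= b -> a + 4000 * b <= 4001 * b)%N by lia.
apply: leq_sum => j _; rewrite dE LE leq_add2r; apply: le4001.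
by rewrite leq_mul2l leq_pmulr ?orbT.
Qed.

Section AlternatingLeastSquares.
Variables (R : realType) (N : nat) (I : 'I_N -> nat) (r : nat) (T : tensor R I).
Variables (eps delta : R) (it : nat) (U0 : factors R I r) (s0 : state R) (eig : eig_routine R).
Let J := sample_count r eps delta.
Hypotheses (N_gt0 : (0 < N)%N) (I_gt0 : forall k, (0 < I k)%N) (r_gt0 : (0 < r)%N).
Hypotheses (eps01 : 0 < eps < 1) (delta01 : 0 < delta < 1) (it_gt0 : (0 < it)%N).
Hypothesis input_s0 : als_input T U0 J it s0.

Lemma als_cmd_time us : (clock (run eig us als_cmd s0))%:R <=
  100 * 1000 * 1000 * polylog 1 r delta * (it%:R / (eps * delta)) *
  \sum_(j < N) (N%:R * r%:R ^+ 3 * log1 (maxn (I j) r)%:R + (I j)%:R * r%:R ^+ 2).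
Proof.
have /andP[e0 e1] := eps01; have /andP[d0 d1] := delta01.
have ed0 : 0 < eps * delta by rewrite mulr_gt0.
have ed1 : 1 <= (eps * delta)^-1 by rewrite invf_ge1 // mulr_ile1 // ltW.
pose Z := polylog 1 r delta / (eps * delta).
have Z1 : 1 <= Z by rewrite mulr_ege1 // polylog_ge1.
have hJ : J%:R <= 257 * Z * r%:R.
  by apply: le_trans (sample_count_le r_gt0 eps01 delta01) _; rewrite /Z; lra.
have J_gt0 : (0 < J)%N by [].
have := als_cmd_clock eig us N_gt0 I_gt0 r_gt0 J_gt0 it_gt0 input_s0.
rewrite -(ler_nat R) natr_sum => /le_trans; apply.
rewrite (_ : 100 * 1000 * 1000 * polylog 1 r delta * (it%:R / (eps * delta)) =
  100 * 1000 * 1000 * Z * it%:R); last by rewrite /Z; ring.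
rewrite big_distrr; apply: ler_sum => j _.
by apply: solve_time_le => //; [apply: log1_ge1|apply: up_log2_le; rewrite ?leq_maxl].
Qed.

(** At most one admissible path is hit by given draws. The default [[::]] marks streams that hit
    none; it is no [als_path], as there is at least one round and one mode. *)
Definition sampled_path (us : nat -> R) : seq (solve_sample I J) :=
  xget [::] [set p | [/\ als_path it p, nonzero_designs (@pinv_solver R) T (CP U0 0) p
                        & hits us T (CP U0 0) 0 p]].

Lemma sampled_pathE us p : als_path it p ->
  nonzero_designs (@pinv_solver R) T (CP U0 0) p ->
  sampled_path us = p <-> hits us T (CP U0 0) 0 p.
Proof.
move=> hp hz; rewrite /sampled_path; set S := [set q | _]; split=> [pE|hh].
  case: (pselect (exists q, S q)) => [[q Sq]|none].
    by have := xgetI [::] Sq; rewrite pE => -[].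
  move: pE; rewrite xgetPN => [pE|q Sq]; last by apply: none; exists q.
  have := congr1 size hp; rewrite -pE /= => /esym/eqP; rewrite size_eq0.
  by case: it it_gt0 => // n _ /=; rewrite -size_eq0 size_cat size_enum_ord addn_eq0 gtn_eqF.
apply: xget_subset1 => //= x y [hx _ hhx] [hy _ hhy].
by apply: hits_inj hhx hhy; rewrite hx hy.
Qed.

(** On the event that the draws hit [p], correct output is automatic, so the joint event is the
    hitting event, whose probability is a product of cell lengths. *)
Lemma als_cmd_law (d : measure_display) (Omega : measurableType d) (P : probability Omega R)
    (u : nat -> {RV P >-> R}) : iid_uniform u ->
  forall p, als_path it p -> nonzero_designs (@pinv_solver R) T (CP U0 0) p ->
  let E := [set w | sampled_path (u^~ w) = p /\
              als_output (als_run (@pinv_solver R) T (CP U0 0) p)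
                (run eig (u^~ w) als_cmd s0)] in
  measurable E /\ P E = (als_prob (@pinv_solver R) T (CP U0 0) p)%:E.
Proof.
move=> iid_u p hp hz E.
have -> : E = [set w | hits (u^~ w) T (CP U0 0) 0 p].
  apply/seteqP; split=> w /=; first by move=> [/(sampled_pathE _ hp hz)].
  move=> hh; split; first exact/(sampled_pathE _ hp hz).
  exact: als_cmd_ok input_s0 it_gt0 hp hz hh.
by split; [apply: measurable_hits|apply: prob_hits].
Qed.

End AlternatingLeastSquares.

Theorem corollary3p3 (R : realType) :
  exists (C : R) (e : nat) (samples : nat -> R -> R -> nat) (als : cmd)
         (lsq : solver R),
    argmin_solver lsq /\
    forall (N : nat) (I : 'I_N -> nat) (r : nat) (T : tensor R I)
           (eps delta : R),
      (0 < N)%N -> (forall k, (0 < I k)%N) -> (0 < r)%N ->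
      0 < eps < 1 -> 0 < delta < 1 ->
      let J := samples r eps delta in
      [/\ J%:R <= C * polylog e r delta * (r%:R / (eps * delta)),
          forall (U : factors R I r) (j : 'I_N),
            design U j != 0 ->
            1 - delta <=
              sample_Pr (design U j)
                (good_sample (design U j) (matricize T j)^T eps (J := J))
        & forall (U0 : factors R I r) (it : nat) (s0 : state R)
                 (eig : eig_routine R),
            (0 < it)%N -> als_input T U0 J it s0 -> eig_correct eig ->
            (forall us : nat -> R, (forall k, 0 <= us k <= 1) ->
               (clock (run eig us als s0))%:R <=
                 C * polylog e r delta * (it%:R / (eps * delta)) *
                 \sum_(j < N) (N%:R * r%:R ^+ 3 * log1 (maxn (I j) r)%:R
                               + (I j)%:R * r%:R ^+ 2)) /\
            exists X : (nat -> R) -> seq (solve_sample I J),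
              forall (d : measure_display) (Omega : measurableType d)
                     (P : probability Omega R) (u : nat -> {RV P >-> R}),
                iid_uniform u ->
                forall p : seq (solve_sample I J),
                  als_path it p ->
                  nonzero_designs lsq T (CP U0 0) p ->
                  let E := [set w | X (u^~ w) = p /\
                              als_output (als_run lsq T (CP U0 0) p)
                                (run eig (u^~ w) als s0)] in
                  measurable E /\
                  P E = (als_prob lsq T (CP U0 0) p)%:E].
Proof.
(* The constant is dictated by the running time and exceeds the 257 of the sample count. The
   pseudoinverse solver is the minimizer that the program computes. *)
exists (100 * 1000 * 1000), 1%N, (@sample_count R), als_cmd, (@pinv_solver R).
split=> [|N I r T eps delta N0 I0 r0 eps01 delta01 J]; first exact: pinv_solver_argmin.
split.
- apply: le_trans (sample_count_le r0 eps01 delta01) _.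
  have /andP[e0 _] := eps01; have /andP[d0 _] := delta01.
  apply: ler_wpM2r; first by rewrite divr_ge0 // mulr_ge0 // ltW.
  by apply: ler_wpM2r; [apply: le_trans (polylog_ge1 _ _ _)|lra].
- by move=> U j A0; apply: leverage_sampling_good.
move=> U0 it s0 eig it0 hin _; split=> [us _|]; first exact: (als_cmd_time eig N0 I0 r0 eps01 delta01 it0 hin us).
by exists (sampled_path T eps delta it U0) => d Omega P u iid_u p; apply: als_cmd_law.
Qed.
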